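(* There exist Axiom A polynomial skew products $f_1,f_2,f_3,f_4$ of $\mathbb{C}^2$, none of which is in the hyperbolic component of a product, such that (with $p$ denoting in each case the base polynomial of the map in question): 1. for $f_1$, $A_{pt}(C_{J_p}) = A_{cc}(C_{J_p}) = A(C_{J_p}) = \emptyset$; 2. for $f_2$, $A_{pt}(C_{J_p}) = A_{cc}(C_{J_p}) = A(C_{J_p}) \neq \emptyset$; 3. for $f_3$, $A_{pt}(C_{J_p}) \neq A_{cc}(C_{J_p}) = A(C_{J_p})$; 4. for $f_4$, $A_{pt}(C_{J_p}) = A_{cc}(C_{J_p}) \neq A(C_{J_p})$. Moreover, each $f_k$ is also Axiom A as an endomorphism from $\mathbb{P}^2$ to itself.
   Context: A polynomial skew product of $\mathbb{C}^2$ is a map $f(z,w)=(p(z),q(z,w))$, with $p,q$ polynomials, that extends holomorphically to an endomorphism of $\mathbb{P}^2$ of degree $d\ge 2$ (so $p$ and $q$ both have degree $d$). A product is a map of the form $(z,w)\mapsto(p_0(z),q_0(w))$. Write $q_z(w)=q(z,w)$ and $Q_z^n=q_{p^{n-1}(z)}\circ\cdots\circ q_{p(z)}\circ q_z$. $K_p$ and $J_p=\partial K_p$ are the filled Julia set and Julia set of $p$; $A_p$ is the finite set of attracting periodic points of $p$ in $\mathbb{C}$. $K=\{x\in\mathbb{C}^2:\sup_n\|f^n(x)\|<\infty\}$, $K_z=K\cap(\{z\}\times\mathbb{C})$, and $J_z=\partial K_z$ (boundary in $\{z\}\times\mathbb{C}$). Vertical expansion: for a compact $Z\subseteq K_p$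 with $p(Z)\subseteq Z$, $f$ is vertically expanding over $Z$ if there are $c>0$, $L>1$ with $|(Q_z^n)'(w)|\ge cL^n$ for all $z\in Z$, $w\in J_z$, $n\ge1$. Axiom A: (by a characterization of Jonsson, used as the definition) $f$ is Axiom A on $\mathbb{C}^2$ iff (i) $p$ is hyperbolic (expanding on $J_p$), (ii) $f$ is vertically expanding over $J_p$, and (iii) $f$ is vertically expanding over $A_p$. Further, $f$ is Axiom A on $\mathbb{P}^2$ if in addition (iv) the restriction of the extension of $f$ to the line at infinity of $\mathbb{P}^2$ (which, in the coordinate $\zeta=w/z$, is a one-variable polynomial of degree $d$) is hyperbolic as a one-dimensional polynomial. Hyperbolic component: the Axiom A maps (on $\mathbb{C}^2$) form an open subset of the parameter space (space of coefficients) of all polynomial skew products of degree $d$; a hyperbolic component is a connected component of this open subset. Critical locus over $J_p$: $C_{J_p}=\{(z,c): z\in J_p,\ q_z'(c)=0\}$. For $X\subseteq\mathbb{C}^2$ the accumulation set is $A(X)=\bigcap_{N\ge0}\overline{\bigcup_{n\ge N}f^n(X)}$ (closure in $\mathbb{C}^2$); for a point $x$, $A(x)=A(\{x\})$. Set $A_{pt}(C_{J_p})=\overline{\bigcup_{x\in C_{J_p}}A(x)}$ and $A_{cc}(C_{J_p})=\overline{\bigcup_{C}A(C)}$, the latter union over all connected components $C$ of $C_{J_p}$. *)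

(* Defs.v *)
From HB Require Import structures.
From mathcomp Require Import all_boot all_order all_algebra.
From mathcomp Require Import all_classical all_reals all_analysis.
From mathcomp Require Import complex.

Set Implicit Arguments.
Unset Strict Implicit.
Unset Printing Implicit Defensive.

Import Order.TTheory GRing.Theory Num.Theory.
Import numFieldNormedType.Exports.
Local Open Scope classical_set_scope.
Local Open Scope ring_scope.
Local Open Scope complex_scope.

(* The usual topology of the complex plane, induced by the modulus. *)
HB.instance Definition _ (R : rcfType) := PseudoPointedMetric.copy R[i] R[i]^o.
HB.instance Definition _ (R : rcfType) := NormedModule.copy R[i] R[i]^o.

Definition boundary (T : topologicalType) (A : set T) : set T :=
  closure A `\` interior A.

Section OneVariable.
Context {R : realType}.
Implicit Type p : {poly R[i]}.

Definition poly_iter p (n : nat) : {poly R[i]} :=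
  iter n (fun r => p \Po r) 'X.

Definition filled_julia p : set R[i] :=
  [set z | bounded_set (range (fun n => iter n (horner p) z))].

Definition julia p : set R[i] := boundary (filled_julia p).

Definition attracting_periodic p : set R[i] :=
  [set z | exists n : nat, [/\ (0 < n)%N, iter n (horner p) z = z
                             & `|(poly_iter p n)^`().[z]| < 1]].

Definition hyperbolic_poly p : Prop :=
  exists c L : R, [/\ 0 < c, 1 < L
    & forall (z : R[i]) (n : nat), julia p z -> (0 < n)%N ->
        (c * L ^+ n)%:C <= `|(poly_iter p n)^`().[z]|].

End OneVariable.

(* Coefficients (f.1, f.2) of the pair (p, q):
     p(z) = \sum_i f.1 0 i * z^i,   q(z, w) = \sum_(i, j) f.2 i j * z^i * w^j. *)
Definition coefs (R : realType) (d : nat) : Type :=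
  ('rV[R[i]]_d.+1 * 'M[R[i]]_d.+1)%type.

Section SkewProducts.
Context {R : realType} {d : nat}.
Implicit Type f : coefs R d.

Definition base f : {poly R[i]} := rVpoly f.1.

(* q_z, as a polynomial in w *)
Definition fiber f (z : R[i]) : {poly R[i]} :=
  \sum_(i < d.+1) \sum_(j < d.+1) (f.2 i j * z ^+ i) *: 'X^j.

Definition skew_map f (x : R[i] * R[i]) : R[i] * R[i] :=
  ((base f).[x.1], (fiber f x.1).[x.2]).

(* Degree-d homogenizations of p and q: in homogeneous coordinates
   f is [z : w : t] |-> [hom_base f z t : hom_fiber f z w t : t^d]. *)
Definition hom_base f (z t : R[i]) : R[i] :=
  \sum_(i < d.+1) f.1 0 i * z ^+ i * t ^+ (d - i).

Definition hom_fiber f (z w t : R[i]) : R[i] :=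
  \sum_(i < d.+1) \sum_(j < d.+1 | (i + j <= d)%N)
    f.2 i j * z ^+ i * w ^+ j * t ^+ (d - (i + j)).

(* The extension to P^2 is holomorphic of degree d exactly when the
   homogeneous lift vanishes only at the origin. *)
Definition skew_product f : Prop :=
  [/\ (2 <= d)%N,
      forall i j : 'I_d.+1, (d < i + j)%N -> f.2 i j = 0
    & forall z w t : R[i],
        hom_base f z t = 0 -> hom_fiber f z w t = 0 -> t ^+ d = 0 ->
        [/\ z = 0, w = 0 & t = 0]].

(* On the line t = 0 the extension is
     [z : w : 0] |-> [f.1 0 d * z^d : \sum_j f.2 (d - j) j * z^(d-j) * w^j : 0],
   read here in the coordinate w / z. *)
Definition infinity_poly f : {poly R[i]} :=
  \sum_(j < d.+1) (f.2 (rev_ord j) j / f.1 0 ord_max) *: 'X^j.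

Definition is_product f : Prop :=
  exists p0 q0 : {poly R[i]}, forall z w : R[i],
    skew_map f (z, w) = (p0.[z], q0.[w]).

(* Q_z^n = q_{p^(n-1)(z)} \o ... \o q_{p(z)} \o q_z *)
Fixpoint fiber_iter f (z : R[i]) (n : nat) : {poly R[i]} :=
  if n is m.+1
  then fiber f (iter m (horner (base f)) z) \Po fiber_iter f z m
  else 'X.

Definition bounded_orbits f : set (R[i] * R[i]) :=
  [set x | bounded_set (range (fun n => iter n (skew_map f) x))].

(* K_z and J_z, with {z} x C identified with C *)
Definition fiber_filled_julia f (z : R[i]) : set R[i] :=
  [set w | bounded_orbits f (z, w)].

Definition fiber_julia f (z : R[i]) : set R[i] :=
  boundary (fiber_filled_julia f z).

Definition vertically_expanding f (Z : set R[i]) : Prop :=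
  exists c L : R, [/\ 0 < c, 1 < L
    & forall (z w : R[i]) (n : nat),
        Z z -> fiber_julia f z w -> (0 < n)%N ->
        (c * L ^+ n)%:C <= `|(fiber_iter f z n)^`().[w]|].

Definition axiomA f : Prop :=
  [/\ skew_product f,
      hyperbolic_poly (base f),
      vertically_expanding f (julia (base f))
    & vertically_expanding f (attracting_periodic (base f))].

Definition axiomA_P2 f : Prop :=
  axiomA f /\ hyperbolic_poly (infinity_poly f).

Definition hyperbolic_component (H : set (coefs R d)) : Prop :=
  exists2 g : coefs R d, axiomA g & H = connected_component axiomA g.

Definition in_component_of_product f : Prop :=
  exists H : set (coefs R d), [/\ hyperbolic_component H, H f
    & exists2 g : coefs R d, H g & is_product g].

Definition critical_locus f : set (R[i] * R[i]) :=
  [set x | julia (base f) x.1 /\ (fiber f x.1)^`().[x.2] = 0].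

Definition accumulation f (X : set (R[i] * R[i])) : set (R[i] * R[i]) :=
  \bigcap_(N in [set: nat])
    closure (\bigcup_(n in [set n : nat | (N <= n)%N]) (iter n (skew_map f) @` X)).

Definition A_crit f : set (R[i] * R[i]) := accumulation f (critical_locus f).

Definition A_pt f : set (R[i] * R[i]) :=
  closure (\bigcup_(x in critical_locus f) accumulation f [set x]).

Definition A_cc f : set (R[i] * R[i]) :=
  closure (\bigcup_(x in critical_locus f)
             accumulation f (connected_component (critical_locus f) x)).

End SkewProducts.

(* Main.v *)
(* The examples are
     f1 = (z^2, w^2 + 10 z),            f2 = (z^3, w^3 + 10 z w^2),
     f3 = (z^2, w^2 - a (1 - z)^2),     f4 = (z^2 + 100 z, w^2 + z / 8)
   with a large. In f1 the critical points over the unit circle all escape; in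
   f2 they either lie on the invariant circle w = 0 or escape. In f3 and f4 the
   critical orbit over one repelling fixed point of the base is bounded and all
   others over J_p escape, but those over nearby base points follow the bounded
   orbit for a long time before they leave it along the unstable direction;
   the limits of these transient points belong to A(C_{J_p}) but not to
   A_pt(C_{J_p}). They belong to A_cc(C_{J_p}) for f3, where C_{J_p} is a
   circle, and do not for f4, where C_{J_p} is totally disconnected.

   No f_k lies in the component of a product because of the invariant [mixed]:
   the base has fixed points a and b such that all critical points of q_a are
   bounded while some critical point of q_b escapes. A product is never mixed,
   as q_a = q_b. The invariant is locally constant on Axiom A maps: every fixed
   point of a hyperbolic base is in J_p or A_p, so q_a is hyperbolic for every
   fixed point a, and for a hyperbolic polynomial both the boundedness and the
   escape of critical points persist under perturbation. *)

Require Import Defs.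
From mathcomp Require Import all_boot all_order all_algebra.
From mathcomp Require Import all_classical all_reals all_analysis.
From mathcomp Require Import complex ring lra zify.

Set Implicit Arguments.
Unset Strict Implicit.
Unset Printing Implicit Defensive.

Import Order.TTheory GRing.Theory Num.Theory.
Import numFieldNormedType.Exports.
Local Open Scope classical_set_scope.
Local Open Scope ring_scope.
Local Open Scope complex_scope.

Local Notation Re := complex.Re.
Local Notation Im := complex.Im.

(** * The modulus and the topology of the complex plane *)

Section Modulus.
Variable R : realType.
Implicit Types x y z w : R[i].

(** One-variable dynamics is developed without normal families, inverse branches or Hurwitz's
    theorem. Their place is taken by [root_near]: a polynomial that is small at a point has a root
    nearby. It makes Julia sets backward invariant, lets fixed and critical points follow the
    coefficients, and turns expansion on a Julia set into repulsion of nearby points from it. In the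
    examples vertical expansion comes from a bound |q_z'| >= L > 1 in one step, at the points with
    bounded orbit that are not interior to K_z. For quadratic fibers q_z' = 2w, so each point with
    |w| near or below 1/2 must either have a disc of bounded points around it or escape. This
    dictates the constants of f3 and f4. A disc of radius r > 1/2 is mapped into itself while the
    additive term has modulus at most r - r^2, and once that bound fails the term must already be
    strong enough to force escape. In f4 a gap in J_p gives this at once; in f3 the circle has no
    gap, and the direction of the additive term has to be used. *)

Definition cmod z : R := Num.sqrt (Re z ^+ 2 + Im z ^+ 2).

(** The norm of [R[i]] has values in [R[i]]; [cmod] has them in [R], where the order is total and
    [lra] and [nra] apply. The epsilon characterizations below likewise replace complex radii by
    real ones. *)
Lemma normcE z : `|z| = (cmod z)%:C.
Proof. by rewrite normc_def. Qed.

Lemma cmod_ge0 z : 0 <= cmod z.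
Proof. exact: sqrtr_ge0. Qed.

Lemma cmod_sqr z : cmod z ^+ 2 = Re z ^+ 2 + Im z ^+ 2.
Proof. by rewrite sqr_sqrtr // addr_ge0 ?sqr_ge0. Qed.

Lemma cmod0 : cmod 0 = 0.
Proof. by apply: complexI; rewrite -normcE normr0. Qed.

Lemma cmod1 : cmod 1 = 1.
Proof. by apply: complexI; rewrite -normcE normr1. Qed.

Lemma cmodM x y : cmod (x * y) = cmod x * cmod y.
Proof. by apply: complexI; rewrite rmorphM /= -!normcE normrM. Qed.

Lemma cmodN x : cmod (- x) = cmod x.
Proof. by apply: complexI; rewrite -!normcE normrN. Qed.

Lemma cmodX x n : cmod (x ^+ n) = cmod x ^+ n.
Proof. by apply: complexI; rewrite rmorphXn /= -!normcE normrX. Qed.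

Lemma cmodV x : cmod x^-1 = (cmod x)^-1.
Proof. by apply: complexI; rewrite fmorphV /= -!normcE normfV. Qed.

Lemma cmod_eq0 x : (cmod x == 0) = (x == 0).
Proof. by rewrite -(inj_eq (@complexI R)) -normcE normr_eq0. Qed.

Lemma cmod_gt0 x : (0 < cmod x) = (x != 0).
Proof. by rewrite lt0r cmod_eq0 cmod_ge0 andbT. Qed.

Lemma cmodD x y : cmod (x + y) <= cmod x + cmod y.
Proof. by rewrite -lecR rmorphD /= -!normcE ler_normD. Qed.

Lemma cmodB x y : cmod (x - y) = cmod (y - x).
Proof. by rewrite -opprB cmodN. Qed.

Lemma cmod_triangle y x z : cmod (x - z) <= cmod (x - y) + cmod (y - z).
Proof. by rewrite -{1}(subrK y x) -addrA cmodD. Qed.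

Lemma cmod_geB x y : cmod x - cmod y <= cmod (x + y).
Proof.
have := cmodD (x + y) (- y).
by rewrite addrK cmodN -lerBlDr.
Qed.

Lemma cmodR (r : R) : cmod r%:C = `|r|.
Proof. by rewrite /cmod /= expr0n /= addr0 sqrtr_sqr. Qed.

Lemma cmod_nat n : cmod n%:R = n%:R.
Proof. by rewrite -(rmorph_nat (real_complex R)) cmodR normr_nat. Qed.

Lemma cmod_geRe z : `|Re z| <= cmod z.
Proof.
rewrite -(ler_pXn2r (n := 2)) ?nnegrE ?normr_ge0 ?cmod_ge0 //.
by rewrite real_normK ?num_real // cmod_sqr lerDl sqr_ge0.
Qed.

Lemma cmod_geIm z : `|Im z| <= cmod z.
Proof.
rewrite -(ler_pXn2r (n := 2)) ?nnegrE ?normr_ge0 ?cmod_ge0 //.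
by rewrite real_normK ?num_real // cmod_sqr lerDr sqr_ge0.
Qed.

Lemma cmod_leReIm z : cmod z <= `|Re z| + `|Im z|.
Proof.
rewrite -(ler_pXn2r (n := 2)) ?nnegrE ?addr_ge0 ?normr_ge0 ?cmod_ge0 //.
rewrite cmod_sqr -(real_normK (num_real (Re z))) -(real_normK (num_real (Im z))).
have := normr_ge0 (Re z); have := normr_ge0 (Im z).
by move: `|Re z| `|Im z| => a b; nra.
Qed.

Lemma nbhscP x (A : set R[i]) :
  nbhs x A <-> exists2 e : R, 0 < e & forall y, cmod (y - x) < e -> A y.
Proof.
split=> [/nbhs_ballP[e /= e0 eA]|[e e0 eA]].
- have [r er] := complex_realP _ (ger0_real (ltW e0)).
  exists r; first by rewrite -ltcR -er.
  by move=> y yx; apply: eA; rewrite /ball /= distrC normcE er ltcR.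
- apply/nbhs_ballP; exists e%:C => /=; first by rewrite ltcR.
  by move=> y; rewrite /ball /= distrC normcE ltcR; apply: eA.
Qed.

Lemma nbhsc2P (x : R[i] * R[i]) (A : set (R[i] * R[i])) :
  nbhs x A <-> exists2 e : R, 0 < e &
    forall y : R[i] * R[i], cmod (y.1 - x.1) < e -> cmod (y.2 - x.2) < e -> A y.
Proof.
split=> [[[A1 A2] /= [/nbhscP[e1 e10 e1A] /nbhscP[e2 e20 e2A]] AA]|[e e0 eA]].
- exists (Num.min e1 e2); first by rewrite lt_min e10.
  move=> y; rewrite !lt_min => /andP[y1 _] /andP[_ y2].
  by apply: AA; split; [exact: e1A|exact: e2A].
- exists ([set y | cmod (y - x.1) < e], [set y | cmod (y - x.2) < e]).
    by split; apply/nbhscP; exists e.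
  by move=> [y1 y2] [/= h1 h2]; apply: eA.
Qed.

Lemma boundedcP (A : set R[i]) :
  bounded_set A <-> exists M : R, forall x, A x -> cmod x <= M.
Proof.
split=> [[M [Mr MA]]|[M MA]].
- have [r Mr'] := complex_realP _ Mr.
  exists (r + 1) => x Ax; rewrite -lecR -normcE.
  by apply: (MA (r + 1)%:C) => //; rewrite Mr' ltcR ltrDl.
- exists M%:C; split; first by apply/complex_realP; exists M.
  move=> r Mr x /MA xM; rewrite /= normcE.
  by apply: le_trans (ltW Mr); rewrite lecR.
Qed.

Lemma boundedc2P (A : set (R[i] * R[i])) :
  bounded_set A <->
  exists M : R, forall x : R[i] * R[i], A x -> cmod x.1 <= M /\ cmod x.2 <= M.
Proof.
have maxE (x : R[i] * R[i]) : `|x| = (Num.max (cmod x.1) (cmod x.2))%:C.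
  have -> : `|x| = Num.max `|x.1| `|x.2| by []. rewrite !normcE /Num.max /Order.max ltcR.
  by case: ifP.
split=> [[M [Mr MA]]|[M MA]].
- have [r Mr'] := complex_realP _ Mr.
  exists (r + 1) => x Ax; apply/andP; rewrite -ge_max -lecR -maxE.
  by apply: (MA (r + 1)%:C) => //; rewrite Mr' ltcR ltrDl.
- exists M%:C; split; first by apply/complex_realP; exists M.
  move=> r Mr x /MA[x1M x2M]; rewrite /= maxE.
  by apply: le_trans (ltW Mr); rewrite lecR ge_max x1M.
Qed.

Lemma closurecP (A : set R[i]) x :
  closure A x <-> forall e : R, 0 < e -> exists2 y, A y & cmod (y - x) < e.
Proof.
split=> [clA e e0|clA B /nbhscP[e e0 eB]].
- have [|y [Ay yx]] := clA [set y | cmod (y - x) < e].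
    by apply/nbhscP; exists e.
  by exists y.
- by have [y Ay /eB By] := clA e e0; exists y.
Qed.

Lemma closurec2P (A : set (R[i] * R[i])) (x : R[i] * R[i]) :
  closure A x <-> forall e : R, 0 < e ->
    exists y : R[i] * R[i], [/\ A y, cmod (y.1 - x.1) < e & cmod (y.2 - x.2) < e].
Proof.
split=> [clA e e0|clA B /nbhsc2P[e e0 eB]].
- have [|y [Ay [y1 y2]]] :=
    clA [set y : R[i] * R[i] | cmod (y.1 - x.1) < e /\ cmod (y.2 - x.2) < e].
    by apply/nbhsc2P; exists e.
  by exists y.
- by have [y [Ay y1 y2]] := clA e e0; exists y; split=> //; apply: eB.
Qed.

Lemma interiorcP (A : set R[i]) x :
  interior A x <-> exists2 e : R, 0 < e & forall y, cmod (y - x) < e -> A y.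
Proof. exact: nbhscP. Qed.

Lemma boundarycP (A : set R[i]) x : boundary A x <-> forall e : R, 0 < e ->
  (exists2 y, A y & cmod (y - x) < e) /\ (exists2 y, ~ A y & cmod (y - x) < e).
Proof.
split=> [[/closurecP clA nintA] e e0|bA].
- split; first exact: clA.
  apply: contrapT => nex; apply: nintA; apply/interiorcP; exists e => // y yx.
  by apply: contrapT => nAy; apply: nex; exists y.
- split; first by apply/closurecP => e /bA[].
  by move=> /interiorcP[e e0 eA]; have [_ [y nAy /eA]] := bA e e0.
Qed.

Lemma filled_juliaP (p : {poly R[i]}) z :
  filled_julia p z <-> exists M, forall n, cmod (iter n (horner p) z) <= M.
Proof.
split=> [/boundedcP[M MA]|[M MA]].
  by exists M => n; apply: MA; exists n.
by apply/boundedcP; exists M => _ [n _ <-].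
Qed.

Lemma bounded_orbitsP d (f : coefs R d) (x : R[i] * R[i]) : bounded_orbits f x <->
  exists M, forall n, cmod (iter n (skew_map f) x).1 <= M /\
                      cmod (iter n (skew_map f) x).2 <= M.
Proof.
split=> [/boundedc2P[M MA]|[M MA]].
  by exists M => n; apply: MA; exists n.
by apply/boundedc2P; exists M => _ [n _ <-].
Qed.

End Modulus.

(** * Polynomials *)

Section Polynomials.
Variable R : realType.
Implicit Types (p q P : {poly R[i]}) (x y z : R[i]).

(** If all n roots were farther than [e] from [x], the factorization of [P] would give [m * e ^+ n <
    cmod P.[x]]. *)
Lemma root_near P n (m e : R) x : size P = n.+1 -> (0 < n)%N -> 0 < m ->
  0 <= e -> m <= cmod (lead_coef P) -> cmod P.[x] <= m * e ^+ n ->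
  exists2 r, root P r & cmod (x - r) <= e.
Proof.
move=> sP n0 m0 e0 mP Px.
have P0 : P != 0 by rewrite -size_poly_gt0 sP.
have [rs def_P] := closed_field_poly_normal P.
have srs : size rs = n.
  move: sP; rewrite {1}def_P size_scale ?lead_coef_eq0 //.
  by rewrite size_prod_XsubC => -[].
have rootP r : r \in rs -> root P r.
  by rewrite {1}def_P rootZ ?lead_coef_eq0 // root_prod_XsubC.
apply: contrapT => nex.
have far r : r \in rs -> e < cmod (x - r).
  move=> r_rs; rewrite ltNge; apply/negP => er.
  by apply: nex; exists r => //; apply: rootP.
suff : m * e ^+ n < cmod P.[x] by rewrite ltNge Px.
rewrite {1}def_P hornerZ cmodM horner_prod.
under eq_bigr do rewrite hornerXsubC.
apply: (@lt_le_trans _ _ (m * cmod (\prod_(i <- rs) (x - i)))); last first.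
  by rewrite ler_wpM2r ?cmod_ge0.
rewrite ltr_pM2l // -srs.
have : rs != [::] by rewrite -size_eq0 srs -lt0n.
elim: rs far {def_P srs rootP} => // r rs IH far _.
rewrite big_cons /= cmodM exprS.
have er : e < cmod (x - r) by apply: far; rewrite mem_head.
have [->|rs0] := eqVneq rs [::].
  by rewrite big_nil cmod1 expr0 !mulr1.
apply: ltr_pM => //; first by rewrite exprn_ge0.
by apply: IH => // s s_rs; apply: far; rewrite in_cons s_rs orbT.
Qed.

Lemma horner_bound p (M : R) :
  exists2 B : R, 0 < B & forall x, cmod x <= M -> cmod p.[x] <= B.
Proof.
elim/poly_ind: p => [|p c [B B0 IH]].
  by exists 1 => // x _; rewrite horner0 cmod0.
exists (B * `|M| + cmod c + 1).
  by rewrite ltr_wpDl // addr_ge0 ?cmod_ge0 // mulr_ge0 // ltW.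
move=> x xM; rewrite hornerMXaddC (le_trans (cmodD _ _)) //.
rewrite cmodM -addrA lerD //; last by rewrite lerDl.
by rewrite ler_pM ?cmod_ge0 ?IH // (le_trans xM) ?ler_norm.
Qed.

Lemma horner_lipschitz p (M : R) : exists2 B : R, 0 < B &
  forall x y, cmod x <= M -> cmod y <= M ->
  cmod (p.[x] - p.[y]) <= B * cmod (x - y).
Proof.
elim/poly_ind: p => [|p c [B B0 IH]].
  exists 1 => // x y _ _.
  by rewrite !horner0 subrr cmod0 mul1r cmod_ge0.
have [D D0 HD] := horner_bound p M.
exists (B * `|M| + D); first by rewrite ltr_wpDl // mulr_ge0 // ltW.
move=> x y xM yM; rewrite !hornerMXaddC.
have -> : p.[x] * x + c - (p.[y] * y + c) =
    (p.[x] - p.[y]) * x + p.[y] * (x - y) by ring.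
rewrite (le_trans (cmodD _ _)) // !cmodM mulrDl lerD //.
  rewrite mulrAC ler_pM ?cmod_ge0 ?IH // (le_trans xM) ?ler_norm //.
by rewrite ler_wpM2r ?cmod_ge0 ?HD.
Qed.

Lemma horner_taylor p (M : R) : exists2 B : R, 0 < B &
  forall x y, cmod x <= M -> cmod y <= M ->
  cmod (p.[x] - p.[y] - p^`().[y] * (x - y)) <= B * cmod (x - y) ^+ 2.
Proof.
elim/poly_ind: p => [|p c [B B0 IH]].
  exists 1 => // x y _ _; rewrite deriv0 !horner0 mul0r !subrr cmod0 mul1r.
  by rewrite exprn_ge0 ?cmod_ge0.
have [D D0 HD] := horner_lipschitz p M.
exists (B * `|M| + D); first by rewrite ltr_wpDl // mulr_ge0 // ltW.
move=> x y xM yM; rewrite !hornerMXaddC derivMXaddC hornerD hornerM hornerX.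
have -> : p.[x] * x + c - (p.[y] * y + c)
    - (p.[y] + p^`().[y] * y) * (x - y) =
    (p.[x] - p.[y] - p^`().[y] * (x - y)) * y + (p.[x] - p.[y]) * (x - y).
  by ring.
rewrite (le_trans (cmodD _ _)) // !cmodM mulrDl lerD //.
  rewrite mulrAC ler_pM ?cmod_ge0 ?IH // (le_trans yM) ?ler_norm //.
by rewrite expr2 mulrA ler_wpM2r ?cmod_ge0 ?HD.
Qed.

Lemma coef_bounded p : exists2 B : R, 0 <= B & forall i, cmod p`_i <= B.
Proof.
exists (\sum_(i < size p) cmod p`_i).
  by apply: sumr_ge0 => i _; apply: cmod_ge0.
move=> i; have [ni|ni] := leqP (size p) i.
  by rewrite nth_default // cmod0 sumr_ge0 // => j _; apply: cmod_ge0.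
rewrite (bigD1 (Ordinal ni)) //= lerDl.
by apply: sumr_ge0 => j _; apply: cmod_ge0.
Qed.

Lemma horner_lower p n : size p = n.+1 -> (0 < n)%N ->
  forall m B : R, 0 <= B -> m <= cmod p`_n -> (forall i, cmod p`_i <= B) ->
  forall x, 1 <= cmod x ->
  (m * cmod x - n%:R * B) * cmod x ^+ n.-1 <= cmod p.[x].
Proof.
move=> sp n0 m B B0 mp pB x x1.
rewrite horner_coef sp big_ord_recr /= addrC.
apply: le_trans (cmod_geB _ _); rewrite cmodM cmodX.
have sumB : cmod (\sum_(i < n) p`_i * x ^+ i) <= n%:R * B * cmod x ^+ n.-1.
  have -> : n%:R * B * cmod x ^+ n.-1 = \sum_(i < n) B * cmod x ^+ n.-1.
    by rewrite sumr_const card_ord -mulrA mulr_natl.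
  elim/big_ind2: _ => [|a b c d ab cd|i _]; first by rewrite cmod0.
    by apply: le_trans (cmodD _ _) (lerD _ _).
  rewrite cmodM cmodX ler_pM ?cmod_ge0 ?exprn_ge0 ?cmod_ge0 //.
  by rewrite ler_weXn2l // -ltnS prednK.
have -> : cmod x ^+ n = cmod x * cmod x ^+ n.-1 by rewrite -exprS prednK.
rewrite mulrBl lerB // -mulrA ler_wpM2r // mulr_ge0 ?exprn_ge0 ?cmod_ge0 //.
Qed.

Lemma horner_escape p n : size p = n.+1 -> (1 < n)%N ->
  forall m B : R, 0 <= B -> m <= cmod p`_n ->
  (forall i, cmod p`_i <= B) ->
  forall x, 1 <= cmod x -> n%:R * B + 2 <= m * cmod x ->
  2 * cmod x <= cmod p.[x].
Proof.
move=> sp n1 m B B0 mp pB x x1 xB.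
apply: le_trans (horner_lower sp (ltnW n1) B0 mp pB x1).
apply: ler_pM => //; [exact: cmod_ge0|by rewrite lerBrDl|].
by rewrite -[leLHS]expr1 ler_weXn2l // -ltnS prednK // (ltn_trans _ n1).
Qed.

Lemma const_coef_bound p (r M : R) : 0 <= r ->
  (forall x, cmod x = r -> cmod p.[x] <= M) -> cmod p.[0] <= M.
Proof.
(* The mean of [p] over [x] and [-x] is a polynomial of half the degree in
   [x ^ 2], with the same constant term. *)
elim: {p}(size p) {-2}p (leqnn (size p)) r => [|n IH] p sp r r0 pM.
  have p0 : p = 0 by apply/eqP; rewrite -size_poly_leq0.
  have /pM : cmod r%:C = r by rewrite cmodR ger0_norm.
  by rewrite p0 !horner0.
have [sp1|sp1] := leqP (size p) 1.
  have /pM : cmod r%:C = r by rewrite cmodR ger0_norm.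
  by rewrite (size1_polyC sp1) !hornerC.
have evenE x : (even_poly p).[x ^+ 2] = (p.[x] + p.[- x]) / 2.
  rewrite -[p in RHS](@poly_even_odd _ p) !(hornerD, hornerM, hornerX).
  by rewrite !horner_comp !hornerXn sqrrN; field.
have -> : p.[0] = (even_poly p).[0].
  by rewrite !horner_coef0 coef_even_poly.
apply: (IH _ _ (r ^+ 2)); rewrite ?exprn_ge0 //.
  by apply: leq_trans (size_even_poly _) _; rewrite uphalfE; lia.
move=> x xr.
have sx : cmod (sqrtc x) = r.
  apply/eqP; rewrite -(@eqrXn2 _ 2) ?cmod_ge0 //.
  by rewrite -cmodX sqr_sqrtc xr.
rewrite -[x]sqr_sqrtc evenE cmodM cmodV cmod_nat ler_pdivrMr //.
rewrite (le_trans (cmodD _ _)) // mulr_natr mulr2n lerD ?pM // ?cmodN //.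
Qed.

(** Cauchy's estimate, from [const_coef_bound] applied to the polynomial (p(x) - p(a)) / (x - a),
    whose value at a is p'(a). Subtracting p(a) costs the factor 2. *)
Lemma deriv_bound p a (r M : R) : 0 < r ->
  (forall x, cmod (x - a) = r -> cmod p.[x] <= M) ->
  cmod p.[a] <= M -> cmod p^`().[a] * r <= 2 * M.
Proof.
move=> r0 pM paM.
have : root (p - p.[a]%:P) a by rewrite rootE !hornerE subrr.
case/factor_theorem => q def_q.
have pE : p = q * ('X - a%:P) + p.[a]%:P by rewrite -def_q subrK.
have qa : p^`().[a] = q.[a].
  by rewrite pE derivD derivM derivXsubC derivC addr0 !(hornerD, hornerM, hornerX, hornerN, hornerC, hornerE) subrr mulr0 add0r.
have : cmod (q \Po ('X + a%:P)).[0] <= 2 * M / r.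
  apply: (@const_coef_bound _ r); first exact: ltW.
  move=> x xr; rewrite horner_comp !hornerE.
  rewrite ler_pdivlMr // -[X in _ * X]xr -cmodM.
  have -> : q.[x + a] * x = p.[x + a] - p.[a].
    by rewrite [in X in X - _]pE !hornerE addrK addrK.
  rewrite (le_trans (cmodD _ _)) // cmodN mulr_natl mulr2n lerD //.
  by apply: pM; rewrite addrK.
by rewrite horner_comp !hornerE qa ler_pdivlMr.
Qed.

End Polynomials.

(** * Filled Julia sets of polynomials *)

Section Julia.
Variable R : realType.
Implicit Types (p q P : {poly R[i]}) (x y z : R[i]).

Lemma doubling_unbounded (u : nat -> R) (c : R) : 0 < c ->
  (forall n, 2 ^+ n * c <= u n) -> ~ exists M, forall n, u n <= M.
Proof.
move=> c0 uc [M uM].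
have : M / c < 2 ^+ (Num.bound `|M / c|).
  apply: le_lt_trans (ler_norm _) _.
  apply: lt_le_trans (archi_boundP (normr_ge0 _)) _.
  by rewrite -natrX ler_nat (ltnW (ltn_expl _ _)).
rewrite ltr_pdivrMr // ltNge.
move: (Num.bound _) => n.
by rewrite (le_trans (uc n) (uM n)).
Qed.

Lemma doubling_ge (u : nat -> R) (M : R) : 0 <= M -> M <= u 0%N ->
  (forall n, M <= u n -> 2 * u n <= u n.+1) ->
  forall n, M <= u n /\ 2 ^+ n * u 0%N <= u n.
Proof.
move=> M0 u0 uS; elim=> [|n [Mn IH]]; first by rewrite expr0 mul1r.
have := uS n Mn; rewrite exprS; split; first by nra.
by apply: le_trans (uS n Mn); rewrite -mulrA ler_wpM2l.
Qed.

Lemma poly_iterE p n x : (poly_iter p n).[x] = iter n (horner p) x.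
Proof.
by elim: n => [|n IH]; rewrite /= ?hornerX // horner_comp IH.
Qed.

Lemma size_poly_iter p n k : size p = n.+1 -> (0 < n)%N ->
  size (poly_iter p k) = (n ^ k).+1.
Proof.
move=> sp n0; elim: k => [|k IH]; first by rewrite size_polyX expn0.
rewrite -[poly_iter p k.+1]/(p \Po poly_iter p k).
have := size_comp_poly p (poly_iter p k); rewrite IH sp /= -expnS.
move=> /(congr1 S) <-; rewrite prednK // size_poly_gt0.
rewrite comp_poly_eq0; first by rewrite -size_poly_gt0 sp.
by rewrite IH ltnS expn_gt0 n0.
Qed.

Lemma filled_julia_iter p k z :
  filled_julia p z <-> filled_julia p (iter k (horner p) z).
Proof.
rewrite !filled_juliaP; split=> [[M HM]|[M HM]].
  by exists M => n; rewrite -iterD; apply: HM.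
have [B HB] : exists B, forall n, (n <= k)%N -> cmod (iter n (horner p) z) <= B.
  elim: k {HM} => [|k [B HB]].
    by exists (cmod z) => n; rewrite leqn0 => /eqP ->.
  exists (Num.max B (cmod (iter k.+1 (horner p) z))) => n.
  rewrite le_max leq_eqVlt => /orP[/eqP ->|/HB ->] //.
  by rewrite lexx orbT.
exists (Num.max B M) => n; rewrite le_max.
have [/HB ->//|kn] := leqP n k.
by rewrite -(subnK (ltnW kn)) iterD HM orbT.
Qed.

Lemma filled_juliaS p z : filled_julia p z <-> filled_julia p p.[z].
Proof. exact: (filled_julia_iter p 1). Qed.

Lemma escape_radius p : (2 < size p)%N ->
  exists2 M : R, 1 <= M & forall x, M <= cmod x -> 2 * cmod x <= cmod p.[x].
Proof.
move=> sp2; have [n sp n1] : exists2 n, size p = n.+1 & (1 < n)%N.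
  by exists (size p).-1; lia.
have m0 : 0 < cmod p`_n.
  rewrite cmod_gt0; have := lead_coef_eq0 p; rewrite lead_coefE sp /= => ->.
  by rewrite -size_poly_gt0 sp.
have [B B0 pB] := coef_bounded p.
exists (Num.max 1 ((n%:R * B + 2) / cmod p`_n)); first by rewrite le_max lexx.
move=> x; rewrite ge_max ler_pdivrMr // [cmod x * _]mulrC => /andP[x1 xB].
by apply: (horner_escape sp n1 B0 (lexx _) pB).
Qed.

Lemma filled_julia_bounded p : (2 < size p)%N ->
  exists2 M : R, 1 <= M & forall z, filled_julia p z ->
    forall n, cmod (iter n (horner p) z) <= M.
Proof.
move=> /escape_radius[M M1 HM]; exists M => // z /filled_juliaP zK n.
rewrite leNgt; apply/negP => Mn.
have M0 : 0 <= M by rewrite (le_trans _ M1).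
pose u m := cmod (iter m (horner p) (iter n (horner p) z)).
have uS m : M <= u m -> 2 * u m <= u m.+1 by rewrite /u iterS; apply: HM.
have := doubling_ge M0 (ltW Mn) uS => ud.
apply: (@doubling_unbounded u (u 0%N)).
- by rewrite (lt_trans _ Mn) // (lt_le_trans _ M1).
- by move=> m; have [] := ud m.
- by case: zK => B HB; exists B => m; rewrite /u -iterD.
Qed.

Lemma horner_continuous p x (e : R) : 0 < e -> exists2 d : R, 0 < d &
  forall y, cmod (y - x) < d -> cmod (p.[y] - p.[x]) < e.
Proof.
move=> e0; have [B B0 HB] := horner_lipschitz p (cmod x + 1).
exists (Num.min 1 (e / B)); first by rewrite lt_min ltr01 divr_gt0.
move=> y; rewrite lt_min ltr_pdivlMr // mulrC => /andP[y1 yB].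
apply: le_lt_trans (HB _ _ _ _) yB; last by rewrite lerDl.
by have := cmodD (y - x) x; rewrite subrK; lra.
Qed.

(** One bound [M] serves all orbits in the filled Julia set, which is therefore closed: an orbit
    that exceeds [M] at time n does so for all nearby starting points. *)
Lemma julia_sub p z : (2 < size p)%N -> julia p z -> filled_julia p z.
Proof.
move=> sp /boundarycP zJ; have [M _ HM] := filled_julia_bounded sp.
apply/filled_juliaP; exists M => n; rewrite leNgt; apply/negP => Mn.
rewrite -subr_gt0 in Mn.
have [d d0 Hd] := horner_continuous (poly_iter p n) z Mn.
have [[y /HM yK yz] _] := zJ d d0.
have := Hd y yz; rewrite !poly_iterE cmodB => zy.
have := cmodD (iter n (horner p) z - iter n (horner p) y) (iter n (horner p) y).
by rewrite subrK; have := yK n; lra.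
Qed.

(** Escaping points y close to p(r) have preimages close to r, by [root_near] applied to p - y. *)
Lemma julia_preim p r : (2 < size p)%N -> julia p p.[r] -> julia p r.
Proof.
move=> sp prJ; have rK : filled_julia p r.
  by apply: (filled_juliaS p r).2; apply: julia_sub.
move/boundarycP: prJ => prJ.
apply/boundarycP => e e0; split; first by exists r => //; rewrite subrr cmod0.
have e20 : 0 < e / 2 by rewrite divr_gt0.
have [n sp' n1] : exists2 n, size p = n.+1 & (1 < n)%N.
  by exists (size p).-1; lia.
have sx y : size (p - y%:P) = n.+1.
  rewrite size_polyDl // size_polyN sp'.
  by apply: leq_ltn_trans (size_polyC_leq1 _) _; apply: ltn_trans n1 _.
have lx y : lead_coef (p - y%:P) = p`_n.
  rewrite lead_coefE sx /= coefB coefC; case: (n) n1 => // k _.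
  by rewrite subr0.
have m0 : 0 < cmod p`_n.
  by rewrite cmod_gt0 -(lx 0) subr0 lead_coef_eq0 -size_poly_gt0 sp'.
have d0 : 0 < cmod p`_n * (e / 2) ^+ n by rewrite mulr_gt0 ?exprn_gt0.
have [_ [y yK yr]] := prJ _ d0.
have [|||s + rs] := root_near (sx y) _ m0 (ltW e20) _ (x := r).
- exact: ltn_trans n1.
- by rewrite lx.
- by rewrite !hornerE cmodB ltW.
- rewrite rootE !hornerE subr_eq0 => /eqP psy.
  exists s; last by rewrite cmodB; lra.
  by move=> /(filled_juliaS p s).1; rewrite psy.
Qed.

Lemma julia_preim_iter p k r : (2 < size p)%N ->
  julia p (iter k (horner p) r) -> julia p r.
Proof.
move=> sp; elim: k => [|k IH]; first exact: id.
by rewrite iterS => h; apply: IH; apply: julia_preim.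
Qed.

(** On the segment from [y] to a point [z] outside [A], the supremum of the parameters with value in
    [A] gives a boundary point, at distance less than [s] from [y]. *)
Lemma ball_sub_of_boundary_far (A : set R[i]) y z (s : R) : A y ->
  (forall j, boundary A j -> s <= cmod (y - j)) -> cmod (z - y) < s -> A z.
Proof.
move=> Ay far zy; apply: contrapT => nAz.
pose pt (t : R) : R[i] := y + t%:C * (z - y).
have pt_dist t u : cmod (pt t - pt u) = `|t - u| * cmod (z - y).
  have -> : pt t - pt u = (t - u)%:C * (z - y).
    by rewrite /pt rmorphB /=; ring.
  by rewrite cmodM cmodR.
pose T := [set t : R | 0 <= t <= 1 /\ A (pt t)].
have T0 : T 0 by split; rewrite ?lexx ?ler01 // /pt mul0r addr0.
have supT : has_sup T by split; [exists 0|exists 1 => t [/andP[]]].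
have zy0 : 0 < cmod (z - y) + 1 by have := cmod_ge0 (z - y); lra.
have s01 : 0 <= sup T <= 1.
  rewrite (ub_le_sup supT.2) //= ge_sup //; first by exists 0.
  by move=> t [/andP[]].
suff : boundary A (pt (sup T)).
  move=> /far; rewrite leNgt => /negP; apply; apply: le_lt_trans zy.
  have -> : y = pt 0 by rewrite /pt mul0r addr0.
  rewrite pt_dist sub0r normrN ger0_norm; last by case/andP: s01.
  by rewrite /pt mul0r addr0 ler_piMl ?cmod_ge0 //; case/andP: s01.
apply/boundarycP => e e0.
have d0 : 0 < e / (cmod (z - y) + 1) by rewrite divr_gt0.
have small t : `|t| < e / (cmod (z - y) + 1) -> `|t| * cmod (z - y) < e.
  rewrite ltr_pdivlMr // mulrDr mulr1 => h.
  by have := normr_ge0 t; lra.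
split.
- have [t [t01 At] st] := sup_adherent d0 supT.
  exists (pt t) => //; rewrite pt_dist; apply: small.
  rewrite ler0_norm ?subr_le0 ?ub_le_sup //; first lra; first exact: supT.2.
- have [s1|s1] := ltP (sup T) 1; last first.
    exists z => //; have -> : sup T = 1 by case/andP: s01 => *; lra.
    have -> : pt 1 = z by rewrite /pt rmorph1 mul1r addrC subrK.
    by rewrite subrr cmod0.
  (* [T] records only parameters in [0, 1], hence the cap at 1. *)
  pose t := Num.min 1 (sup T + e / (cmod (z - y) + 1) / 2).
  have st : sup T < t by rewrite /t lt_min s1 /= ltrDl divr_gt0.
  exists (pt t).
    move=> At; move: (st); rewrite ltNge => /negP; apply.
    apply: ub_le_sup; first exact: supT.2.
    split=> //; rewrite ge_min lexx andbT (le_trans _ (ltW st)) //.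
    by case/andP: s01.
  rewrite pt_dist; apply: small; rewrite gtr0_norm ?subr_gt0 //.
  have : t <= sup T + e / (cmod (z - y) + 1) / 2 by rewrite ge_min lexx orbT.
  by move: d0; set w := e / _; lra.
Qed.

End Julia.

(** * Stability of bounded orbits of hyperbolic polynomials *)

Section Stability.
Variable R : realType.
Implicit Types (p q P : {poly R[i]}) (x y z : R[i]).

Lemma bernoulli_le (L : R) n : 1 <= L -> 1 + n%:R * (L - 1) <= L ^+ n.
Proof.
move=> L1; elim: n => [|n IH]; first by rewrite expr0 mul0r addr0.
have n0 : (0 : R) <= n%:R by [].
have := mulr_ge0 n0 (sqr_ge0 (L - 1)).
have : L * (1 + n%:R * (L - 1)) <= L * L ^+ n.
  by rewrite ler_wpM2l // (le_trans _ L1).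
rewrite [L ^+ n.+1]exprS -natr1 expr2; lra.
Qed.

Lemma horner_close N (M : R) : exists2 C : R, 0 < C &
  forall p q (d : R), (size p <= N)%N -> (size q <= N)%N ->
    (forall i, cmod (q`_i - p`_i) <= d) ->
    forall x, cmod x <= M -> cmod (q.[x] - p.[x]) <= C * d.
Proof.
have B0 : 0 <= Num.max 1 M by rewrite le_max ler01.
pose C : R := \sum_(i < N) (Num.max 1 M) ^+ i.
have C0 : 0 <= C by apply: sumr_ge0 => i _; rewrite exprn_ge0.
exists (C + 1); first by rewrite ltr_wpDl.
move=> p q d sp sq pq x xM.
have d0 : 0 <= d by apply: le_trans (pq 0%N); apply: cmod_ge0.
rewrite (horner_coef_wide _ sp) (horner_coef_wide _ sq) -sumrB.
apply: (@le_trans _ _ (C * d)); last by rewrite ler_wpM2r // lerDl.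
rewrite /C mulr_suml.
elim/big_ind2: _ => [|a b c e ab ce|i _]; first by rewrite cmod0.
  by apply: le_trans (cmodD _ _) (lerD _ _).
rewrite -mulrBl cmodM mulrC cmodX ler_pM ?exprn_ge0 ?cmod_ge0 //.
by rewrite lerXn2r ?nnegrE ?cmod_ge0 // le_max xM orbT.
Qed.

Lemma iter_close p k (M e : R) : 0 < e -> exists2 d : R, 0 < d &
  forall q, (size q <= size p)%N -> (forall i, cmod (q`_i - p`_i) <= d) ->
    forall x, cmod x <= M ->
      cmod (iter k (horner q) x - iter k (horner p) x) <= e.
Proof.
elim: k e => [|k IH] e e0.
  exists 1 => // q _ _ x _; rewrite subrr cmod0; exact: ltW.
have [B B0 HB] := horner_bound (poly_iter p k) M.
have [L L0 HL] := horner_lipschitz p (B + 1).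
have [C C0 HC] := horner_close (size p) (B + 1).
(* The cap 1 keeps the perturbed orbit in the disc of radius [B + 1], where the constants [L] and
   [C] are valid. *)
have e10 : 0 < Num.min 1 (e / (2 * L)) by rewrite lt_min ltr01 divr_gt0 ?mulr_gt0.
have [d d0 Hd] := IH _ e10.
exists (Num.min d (e / (2 * C))); first by rewrite lt_min d0 divr_gt0 ?mulr_gt0.
move=> q sq pq x xM; rewrite !iterS.
have pq1 i : cmod (q`_i - p`_i) <= d by have := pq i; rewrite le_min => /andP[].
have pq2 i : cmod (q`_i - p`_i) <= e / (2 * C).
  by have := pq i; rewrite le_min => /andP[].
have := Hd q sq pq1 x xM; rewrite le_min => /andP[u1 uL].
have := HB x xM; rewrite poly_iterE => pB.
have qB : cmod (iter k (horner q) x) <= B + 1.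
  have := cmodD (iter k (horner q) x - iter k (horner p) x) (iter k (horner p) x).
  by rewrite subrK; lra.
have pB1 : cmod (iter k (horner p) x) <= B + 1 by lra.
have h1 := HC p q _ (leqnn _) sq pq2 _ qB.
have h2 := HL _ _ qB pB1.
have h3 := cmod_triangle p.[iter k (horner q) x] q.[iter k (horner q) x]
  p.[iter k (horner p) x].
have e1 : C * (e / (2 * C)) = e / 2 by field; rewrite gt_eqF.
have e2 : L * cmod (iter k (horner q) x - iter k (horner p) x) <= e / 2.
  have -> : e / 2 = L * (e / (2 * L)) by field; rewrite gt_eqF.
  by rewrite ler_wpM2l // ltW.
by rewrite (le_trans h3) //; lra.
Qed.

Lemma bounded_of_iter_mul p k x (M : R) : (0 < k)%N ->
  (forall m, cmod (iter (k * m) (horner p) x) <= M) -> filled_julia p x.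
Proof.
move=> k0 HM.
have [B HB] : exists B : R, forall r, (r <= k)%N ->
    forall y, cmod y <= M -> cmod (iter r (horner p) y) <= B.
  elim: (k) => [|n [B HB]].
    by exists M => r; rewrite leqn0 => /eqP ->.
  have [D D0 HD] := horner_bound (poly_iter p n.+1) M.
  exists (Num.max B D) => r; rewrite leq_eqVlt => /orP[/eqP -> y yM|rn y yM].
    by rewrite le_max -poly_iterE HD ?orbT.
  by rewrite le_max HB.
apply/filled_juliaP; exists B => n.
rewrite (divn_eq n k) addnC iterD mulnC; apply: HB; last exact: HM.
by rewrite ltnW // ltn_mod.
Qed.

(* The roots of [F - j] for [j] in the Julia set lie in the Julia set, where
   the iterate [F] expands by more than 2; hence [F] doubles the distance to
   the Julia set of every point which it maps near it. *)
Lemma hyperbolic_repels p : (2 < size p)%N -> hyperbolic_poly p ->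
  exists (k : nat) (e0 : R), [/\ (0 < k)%N, 0 < e0 &
    forall (e : R) x, 0 < e -> e <= e0 ->
      (forall j, julia p j -> e <= cmod (x - j)) ->
      forall j, julia p j -> 2 * e <= cmod (iter k (horner p) x - j)].
Proof.
move=> sp2 [c [L [c0 L1 hyp]]].
have [n sp n1] : exists2 n, size p = n.+1 & (1 < n)%N.
  by exists (size p).-1; lia.
have [k k0 kL] : exists2 k, (0 < k)%N & 4 <= c * L ^+ k.
  have L10 : 0 < L - 1 by rewrite subr_gt0.
  pose m := (Num.bound (4 / c / (L - 1))).+1.
  exists m => //.
  have mB : 4 / c / (L - 1) <= m%:R.
    rewrite /m; apply: le_trans (ltW (archi_boundP _)) _.
      by rewrite !divr_ge0 // ltW.
    by rewrite ler_nat.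
  rewrite ler_pdivrMr // ler_pdivrMr // in mB.
  have : c * (1 + m%:R * (L - 1)) <= c * L ^+ m by rewrite ler_wpM2l ?bernoulli_le // ltW.
  by lra.
have [M M1 HM] := filled_julia_bounded sp2.
set F := poly_iter p k.
have sF : size F = (n ^ k).+1 by apply: size_poly_iter => //; apply: ltnW.
have nk0 : (0 < n ^ k)%N by rewrite expn_gt0 (ltnW n1).
have nk1 : (1 < n ^ k)%N by rewrite -(exp1n k) ltn_exp2r.
have [C C0 HC] := horner_taylor F (M + 1).
have m0 : 0 < cmod (lead_coef F).
  by rewrite cmod_gt0 lead_coef_eq0 -size_poly_gt0 sF.
(* Within [eta] of a root r the Taylor error is at most the distance v to it, so expansion by 4 at r
   leaves at least 3 v >= 3 e, more than 2 e. *)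
pose eta : R := Num.min 1 C^-1.
have eta0 : 0 < eta by rewrite lt_min ltr01 invr_gt0.
have eta1 : eta <= 1 by rewrite ge_min lexx.
have etaC : C * eta <= 1.
  by rewrite mulrC -ler_pdivlMr // mul1r ge_min lexx orbT.
(* For [e] up to this bound, |F(x) - j| < 2 e is small enough for [root_near] to give a root of F -
   j within [eta] of x. *)
exists k, (cmod (lead_coef F) * eta ^+ (n ^ k) / 2); split=> //.
  by rewrite divr_gt0 // mulr_gt0 // exprn_gt0.
move=> e x e0; rewrite ler_pdivlMr // mulrC => ee0 far j jJ.
rewrite leNgt; apply/negP => Fxj.
have sFj : size (F - j%:P) = (n ^ k).+1.
  rewrite size_polyDl // size_polyN sF.
  by apply: leq_ltn_trans (size_polyC_leq1 _) _.
have [||r + xr] := root_near sFj nk0 m0 (ltW eta0) _ (x := x).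
- rewrite lead_coefDl // size_polyN sF.
  by apply: leq_ltn_trans (size_polyC_leq1 _) _.
- by rewrite !hornerE poly_iterE; apply: le_trans ee0; apply: ltW.
rewrite rootE !hornerE subr_eq0 => /eqP Fr.
have rJ : julia p r.
  have Fr' : iter k (horner p) r = j by rewrite -poly_iterE.
  by apply: (julia_preim_iter sp2 (k := k)); rewrite Fr'.
have rM : cmod r <= M by have := HM r (julia_sub sp2 rJ) 0%N.
have xM : cmod x <= M + 1.
  have := cmodD (x - r) r; rewrite subrK; lra.
have rM1 : cmod r <= M + 1 by lra.
have dF : 4 <= cmod F^`().[r].
  by apply: le_trans kL _; rewrite -lecR -normcE; apply: hyp.
have T := HC x r xM rM1.
have := cmod_geB (F^`().[r] * (x - r)) (F.[x] - F.[r] - F^`().[r] * (x - r)).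
rewrite [F^`().[r] * (x - r) + _]addrC subrK cmodM Fr poly_iterE.
rewrite Fr poly_iterE in T.
have xr0 := cmod_ge0 (x - r).
have xre := far r rJ.
move: T Fxj; rewrite -/(horner p); set u := cmod (iter _ _ _ - j).
set v := cmod (x - r) in xr xr0 xre *; move=> T uE U.
have : C * v ^+ 2 <= v by rewrite expr2; nra.
by nra.
Qed.

(** The points of the filled Julia set of p at distance at least [e] from the Julia set form a set
    invariant under the k-th iterate of q: that of p raises the distance to [2 * e], and that of q
    stays within [e] of it. No boundary point is crossed in between, so the image remains in the
    filled Julia set. *)
Lemma hyperbolic_stable_bounded p x : (2 < size p)%N -> hyperbolic_poly p ->
  filled_julia p x -> ~ julia p x ->
  exists d r : R, [/\ 0 < d, 0 < r &
    forall q, (size q <= size p)%N -> (forall i, cmod (q`_i - p`_i) <= d) ->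
      forall y, cmod (y - x) < r -> filled_julia q y].
Proof.
move=> sp hyp xK xJ.
have [k [e0 [k0 e00 rep]]] := hyperbolic_repels sp hyp.
have [M M1 HM] := filled_julia_bounded sp.
have [e1 e10 xe1] : exists2 e1 : R, 0 < e1 &
    forall y, cmod (y - x) < e1 -> filled_julia p y.
  apply: contrapT => nex; apply: xJ; split; first exact: subset_closure.
  by move=> /interiorcP[e e_gt0 eK]; apply: nex; exists e.
pose e := Num.min e0 (e1 / 2).
have e_gt0 : 0 < e by rewrite lt_min e00 divr_gt0.
have ee0 : e <= e0 by rewrite ge_min lexx.
have ee1 : 2 * e <= e1 by rewrite mulrC -ler_pdivlMr // ge_min lexx orbT.
have [d d0 Hd] := iter_close p k M e_gt0.
exists d, e; split=> // q sq pq y yx.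
pose T z := filled_julia p z /\ forall j, julia p j -> e <= cmod (z - j).
have far_x j : julia p j -> e1 <= cmod (x - j).
  move=> /boundarycP jJ; rewrite leNgt; apply/negP => xj.
  have d1 : 0 < e1 - cmod (x - j) by rewrite subr_gt0.
  have [_ [z nzK zj]] := jJ _ d1.
  apply: nzK; apply: xe1; have := cmod_triangle j z x.
  by rewrite (cmodB j x); lra.
have Ty : T y.
  split; first by apply: xe1; lra.
  move=> j /far_x; have := cmod_triangle y x j; rewrite (cmodB x y); lra.
have TS z : T z -> T (iter k (horner q) z).
  move=> [zK zfar].
  have Fz : filled_julia p (iter k (horner p) z).
    exact: (filled_julia_iter p k z).1.
  have far := rep e z e_gt0 ee0 zfar.
  have close : cmod (iter k (horner q) z - iter k (horner p) z) <= e.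
    by apply: Hd => //; apply: HM z zK 0%N.
  split.
    apply: (ball_sub_of_boundary_far Fz far); lra.
  move=> j jJ; have := far j jJ.
  have := cmod_triangle (iter k (horner q) z) (iter k (horner p) z) j.
  by rewrite (cmodB _ (iter k (horner q) z)); lra.
apply: (@bounded_of_iter_mul _ k _ M) => // m.
suff /HM : filled_julia p (iter (k * m) (horner q) y) by move/(_ 0%N).
suff [] : T (iter (k * m) (horner q) y) by [].
elim: m => [|m IH]; first by rewrite muln0.
by rewrite mulnS iterD; apply: TS.
Qed.

Lemma deriv_poly_iter_fixed p a n : p.[a] = a ->
  (poly_iter p n)^`().[a] = p^`().[a] ^+ n.
Proof.
move=> pa; elim: n => [|n IH]; first by rewrite /= derivX hornerC expr0.
rewrite -[poly_iter p n.+1]/(p \Po poly_iter p n) deriv_comp hornerM IH.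
rewrite horner_comp poly_iterE exprS; congr (_^`().[_] * _).
by elim: (n) => //= m ->.
Qed.

(* Otherwise a small perturbation of [p] makes the interior fixed point
   repelling while keeping its neighbours bounded, which contradicts
   Cauchy's estimate for the derivatives of the iterates. *)
Lemma hyperbolic_fixed p a : (2 < size p)%N -> hyperbolic_poly p ->
  p.[a] = a -> julia p a \/ attracting_periodic p a.
Proof.
move=> sp hyp pa.
have [aJ|aJ] := pselect (julia p a); [by left|right].
exists 1%N; split=> //; rewrite normcE deriv_poly_iter_fixed // expr1.
rewrite -[1]/(1%:C) ltcR ltNge; apply/negP => mult1.
have aK : filled_julia p a.
  apply/filled_juliaP; exists (cmod a) => n.
  suff -> : iter n (horner p) a = a by [].
  by elim: n => //= n ->.
have [d [r [d0 r0 stab]]] := hyperbolic_stable_bounded sp hyp aK aJ.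
pose la := p^`().[a].
have la0 : 0 < cmod la by apply: lt_le_trans mult1.
(* Adding (s la)(X - a) to p keeps the fixed point a and multiplies its multiplier by 1 + s; [s] is
   as large as [d] allows. *)
pose s : R := d / (cmod la * (1 + cmod a)).
have s0 : 0 < s by rewrite divr_gt0 // mulr_gt0 // ltr_pwDl ?cmod_ge0.
pose h : {poly R[i]} := (s%:C * la) *: ('X - a%:P).
have sh : (size h <= 2)%N.
  by rewrite (leq_trans (size_scale_leq _ _)) // size_XsubC.
have sq : size (p + h) = size p by rewrite size_polyDl // (leq_ltn_trans sh).
have cl i : cmod ((p + h)`_i - p`_i) <= d.
  rewrite coefD addrAC subrr add0r coefZ coefB coefX coefC !cmodM cmodR.
  rewrite gtr0_norm //.
  have hi : cmod ((i == 1%N)%:R - (if i == 0%N then a else 0)) <= 1 + cmod a.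
    case: i => [|[|i]] /=.
    - by rewrite sub0r cmodN lerDr.
    - by rewrite subr0 cmod1 lerDl cmod_ge0.
    - by rewrite subr0 cmod0 addr_ge0 ?cmod_ge0.
  have -> : d = s * cmod la * (1 + cmod a).
    have a1 : 0 < 1 + cmod a by rewrite ltr_pwDl ?cmod_ge0.
    by rewrite /s; field; rewrite !gt_eqF.
  by rewrite ler_wpM2l // mulr_ge0 ?ltW.
have sq2 : (2 < size (p + h)%R)%N by rewrite sq.
have [M M1 HM] := filled_julia_bounded sq2.
have qa : (p + h).[a] = a by rewrite hornerD hornerZ !hornerE subrr mulr0 addr0.
have dqa : (p + h)^`().[a] = (1 + s%:C) * la.
  rewrite derivD hornerD derivZ derivXsubC hornerZ hornerC mulr1 mulrDl mul1r //.
(* Cauchy's estimate for the iterates, on a circle of points with bounded orbits, bounds all powers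
   of the new multiplier, although its modulus is at least 1 + s. *)
have bd n : cmod ((p + h)^`().[a] ^+ n) * (r / 2) <= 2 * M.
  rewrite -deriv_poly_iter_fixed //; apply: deriv_bound; first by rewrite divr_gt0.
    move=> x xr; rewrite poly_iterE; apply: HM; apply: stab => //.
      by rewrite sq.
    by rewrite xr ltr_pdivrMr // mulr_natr mulr2n ltrDl.
  rewrite poly_iterE; apply: HM; apply: stab => //; first by rewrite sq.
  by rewrite subrr cmod0.
have mu : 1 + s <= cmod (p + h)^`().[a].
  rewrite dqa.
  have -> : (1 + s%:C) * la = (1 + s)%:C * la by rewrite rmorphD rmorph1.
  rewrite cmodM cmodR gtr0_norm; last by rewrite ltr_pwDl ?ltW.
  by rewrite ler_peMr // addr_ge0 // ltW.
have bern n : 1 + n%:R * s <= cmod ((p + h)^`().[a] ^+ n).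
  have s1 : 1 <= 1 + s by rewrite lerDl ltW.
  have := bernoulli_le n s1; rewrite addrAC subrr add0r => /le_trans; apply.
  by rewrite cmodX lerXn2r // nnegrE ?cmod_ge0 // (le_trans _ s1).
pose N := Num.bound (4 * M / r / s).
have N1 : 4 * M / r / s < N%:R.
  have M0 : 0 <= M by rewrite (le_trans _ M1).
  apply: archi_boundP.
  exact: divr_ge0 (divr_ge0 (mulr_ge0 (ler0n _ 4) M0) (ltW r0)) (ltW s0).
rewrite ltr_pdivrMr // ltr_pdivrMr // in N1.
have := bd N; have := bern N.
move: (cmod _) => u uN ur.
have : (1 + N%:R * s) * r <= u * r by rewrite ler_wpM2r // ltW.
by nra.
Qed.

End Stability.

(** * Critical points under perturbation *)

Section Components.
Variable R : realType.
Implicit Types (p q P Q : {poly R[i]}) (x y z : R[i]).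

(** The roots of [P] and of nearby [Q] lie in a common disc, on which the two polynomials differ
    little, so a root of one is almost a root of the other and [root_near] applies. Half the leading
    coefficient of [P] is a lower bound valid for both. *)
Lemma roots_close P n (e : R) : size P = n.+1 -> (0 < n)%N -> 0 < e ->
  exists2 d : R, 0 < d & forall Q, size Q = n.+1 ->
    (forall i, cmod (Q`_i - P`_i) <= d) ->
    (forall x, root P x -> exists2 y, root Q y & cmod (x - y) <= e) /\
    (forall y, root Q y -> exists2 x, root P x & cmod (y - x) <= e).
Proof.
move=> sP n0 e0.
have P0 : 0 < cmod P`_n.
  rewrite cmod_gt0; have := lead_coef_eq0 P; rewrite lead_coefE sP /= => ->.
  by rewrite -size_poly_gt0 sP.
pose m := cmod P`_n / 2; have m0 : 0 < m by rewrite divr_gt0.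
have mP : cmod P`_n = 2 * m by rewrite /m; field.
have [B B0 PB] := coef_bounded P.
pose E := Num.max 1 ((n%:R * (B + m) + 1) / m).
have rootE Q y : size Q = n.+1 -> (forall i, cmod (Q`_i - P`_i) <= m) ->
    root Q y -> cmod y <= E.
  move=> sQ PQ /eqP Qy; rewrite leNgt; apply/negP.
  rewrite gt_max ltr_pdivrMr // => /andP[y1 yB].
  have Qn : m <= cmod Q`_n.
    have := PQ n; have := cmodD (P`_n - Q`_n) Q`_n.
    by rewrite subrK cmodB mP; lra.
  have QB i : cmod Q`_i <= B + m.
    have := PQ i; have := cmodD (Q`_i - P`_i) P`_i; have := PB i.
    by rewrite subrK; lra.
  have Bm : 0 <= B + m by lra.
  have := horner_lower sQ n0 Bm Qn QB (ltW y1); rewrite Qy cmod0.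
  apply/negP; rewrite -ltNge; apply: mulr_gt0; first by lra.
  by rewrite exprn_gt0 // (lt_trans _ y1).
have [C C0 HC] := horner_close n.+1 E.
exists (Num.min m (m * e ^+ n / C)).
  by rewrite lt_min m0 divr_gt0 // mulr_gt0 // exprn_gt0.
move=> Q sQ PQ.
have PQm i : cmod (Q`_i - P`_i) <= m by have := PQ i; rewrite le_min => /andP[].
have Qn : m <= cmod Q`_n.
  have := PQm n; have := cmodD (P`_n - Q`_n) Q`_n.
  by rewrite subrK cmodB mP; lra.
have close x : cmod x <= E -> cmod (Q.[x] - P.[x]) <= m * e ^+ n.
  move=> xE; have := HC P Q (m * e ^+ n / C) _ _ _ x xE.
  rewrite sP sQ mulrCA divff ?gt_eqF // mulr1; apply=> // i.
  by have := PQ i; rewrite le_min => /andP[].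
split=> [x Px|y Qy].
- have xE : cmod x <= E.
    by apply: (rootE P) => // i; rewrite subrr cmod0 ltW.
  apply: (root_near sQ n0 m0 (ltW e0)); first by rewrite lead_coefE sQ.
  by have := close x xE; rewrite (eqP Px) subr0.
- have yE : cmod y <= E by apply: (rootE Q).
  apply: (root_near sP n0 m0 (ltW e0)).
    by rewrite lead_coefE sP mP; lra.
  by have := close y yE; rewrite (eqP Qy) sub0r cmodN.
Qed.

(** In degree at least 2 this is equivalent to connectedness of the Julia set of [q]. *)
Definition crit_bounded q : Prop :=
  forall c, q^`().[c] = 0 -> filled_julia q c.

Lemma poly_iter1 p : poly_iter p 1 = p.
Proof. exact: comp_polyXr. Qed.

Lemma crit_notin_julia q c : hyperbolic_poly q -> q^`().[c] = 0 -> ~ julia q c.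
Proof.
move=> [a [L [a0 L1 hyp]]] qc cJ; have := hyp c 1%N cJ isT.
rewrite poly_iter1 expr1 qc normr0 -[0]/(0%:C) lecR leNgt.
by rewrite mulr_gt0 // (lt_trans _ L1).
Qed.

(** Critical points and fixed points of the base are finite in number, so a common radius can
    replace the individual ones. *)
Lemma seq_small (T : eqType) (s : seq T) (Pr : T -> R -> Prop) :
  (forall a (d d' : R), d' <= d -> Pr a d -> Pr a d') ->
  (forall a, a \in s -> exists2 d : R, 0 < d & Pr a d) ->
  exists2 d : R, 0 < d & forall a, a \in s -> Pr a d.
Proof.
move=> mono; elim: s => [|a s IH] Ps; first by exists 1.
have [d d0 Pd] := Ps a (mem_head _ _).
have [|d' d'0 Pd'] := IH; first by move=> b bs; apply: Ps; rewrite in_cons bs orbT.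
exists (Num.min d d'); first by rewrite lt_min d0.
move=> b; rewrite in_cons => /predU1P[->|/Pd' Pb].
  by apply: mono Pd; rewrite ge_min lexx.
by apply: mono Pb; rewrite ge_min lexx orbT.
Qed.

Lemma poly_roots P : P != 0 -> exists s : seq R[i], forall x, (x \in s) = root P x.
Proof.
move=> P0; have [s defP] := closed_field_poly_normal P; exists s => x.
by rewrite defP rootZ ?lead_coef_eq0 // root_prod_XsubC.
Qed.

Lemma size_deriv_char0 q n : size q = n.+1 -> size q^`() = n.
Proof.
case: n => [|n] sq; first by rewrite (size1_polyC (eq_leq sq)) derivC size_poly0.
apply/eqP; rewrite eqn_leq -ltnS -sq lt_size_deriv -?size_poly_gt0 ?sq //=.
have : q^`()`_n != 0.
  rewrite coef_deriv -mulr_natr mulf_neq0 ?pnatr_eq0 //.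
  have := lead_coef_eq0 q; rewrite lead_coefE sq /= => ->.
  by rewrite -size_poly_gt0 sq.
by apply: contraR; rewrite -leqNgt => /leq_sizeP ->.
Qed.

Lemma coef_deriv_close p q n (d : R) : size p = n.+1 -> size q = n.+1 ->
  0 <= d -> (forall i, cmod (q`_i - p`_i) <= d) ->
  forall i, cmod (q^`()`_i - p^`()`_i) <= n%:R * d.
Proof.
move=> sp sq d0 pq i; have [ni|ni] := leqP n i.
  rewrite !nth_default ?(size_deriv_char0 sp) ?(size_deriv_char0 sq) //.
  by rewrite subrr cmod0 mulr_ge0.
rewrite !coef_deriv -mulrnBl -[X in cmod X]mulr_natl cmodM cmod_nat.
by rewrite ler_pM ?cmod_ge0 // ler_nat.
Qed.

Lemma crit_close q n (e : R) : size q = n.+1 -> (1 < n)%N -> 0 < e ->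
  exists2 d : R, 0 < d & forall q', size q' = n.+1 ->
    (forall i, cmod (q'`_i - q`_i) <= d) ->
    (forall c, q^`().[c] = 0 ->
       exists2 c', q'^`().[c'] = 0 & cmod (c - c') <= e) /\
    (forall c', q'^`().[c'] = 0 ->
       exists2 c, q^`().[c] = 0 & cmod (c' - c) <= e).
Proof.
move=> sq n1 e0.
have sdq : size q^`() = n.-1.+1 by rewrite (size_deriv_char0 sq); lia.
have n10 : (0 < n.-1)%N by lia.
have [d d0 Hd] := roots_close sdq n10 e0.
have nR : (0 : R) < n%:R by rewrite ltr0n ltnW.
exists (d / n%:R); first by rewrite divr_gt0.
move=> q' sq' qq'; have [||H1 H2] := Hd q'^`().
- by rewrite (size_deriv_char0 sq'); lia.
- move=> i; have dn : 0 <= d / n%:R by rewrite divr_ge0 // ltW.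
  apply: le_trans (coef_deriv_close sq sq' dn qq' i) _.
  by rewrite mulrCA divff ?mulr1 // gt_eqF.
split=> c /eqP c0; [have [c' /eqP]:= H1 c c0|have [c' /eqP] := H2 c c0];
  by exists c'.
Qed.

Lemma escape_uniform q n : size q = n.+1 -> (1 < n)%N ->
  exists2 M : R, 1 <= M & exists2 d : R, 0 < d & forall q', size q' = n.+1 ->
    (forall i, cmod (q'`_i - q`_i) <= d) ->
    forall x, M <= cmod x -> 2 * cmod x <= cmod q'.[x].
Proof.
move=> sq n1.
have q0 : 0 < cmod q`_n.
  rewrite cmod_gt0; have := lead_coef_eq0 q; rewrite lead_coefE sq /= => ->.
  by rewrite -size_poly_gt0 sq.
pose m := cmod q`_n / 2; have m0 : 0 < m by rewrite divr_gt0.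
have mq : cmod q`_n = 2 * m by rewrite /m; field.
have [B B0 qB] := coef_bounded q.
exists (Num.max 1 ((n%:R * (B + m) + 2) / m)); first by rewrite le_max lexx.
exists m => // q' sq' qq' x.
rewrite ge_max ler_pdivrMr // [cmod x * _]mulrC => /andP[x1 xB].
apply: (horner_escape sq' n1 _ _ _ x1 xB); first by lra.
  have := qq' n; have := cmodD (q`_n - q'`_n) q'`_n.
  by rewrite subrK cmodB mq; lra.
move=> i; have := qq' i; have := cmodD (q'`_i - q`_i) q`_i; have := qB i.
by rewrite subrK; lra.
Qed.

(** Expansion excludes critical points from the Julia set, so [hyperbolic_stable_bounded] gives each
    one a disc of points that are bounded for all nearby [q']; the critical points of [q'] fall into
    these discs. *)
Lemma crit_bounded_open q n : size q = n.+1 -> (1 < n)%N ->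
  hyperbolic_poly q -> crit_bounded q ->
  exists2 d : R, 0 < d & forall q', size q' = n.+1 ->
    (forall i, cmod (q'`_i - q`_i) <= d) -> crit_bounded q'.
Proof.
move=> sq n1 hyp bd.
have sq2 : (2 < size q)%N by rewrite sq.
have [|s Hs] := @poly_roots q^`().
  by rewrite -size_poly_gt0 (size_deriv_char0 sq); lia.
have [||e e0 He] := @seq_small _ s (fun c e => forall q', size q' = n.+1 ->
    (forall i, cmod (q'`_i - q`_i) <= e) ->
    forall y, cmod (y - c) <= e -> filled_julia q' y).
- move=> c e e' ee' H q' sq' qq' y yc; apply: H => // [i|]; exact: le_trans ee'.
- move=> c; rewrite Hs => /eqP c0.
  have [e [r [e0 r0 H]]] := hyperbolic_stable_bounded sq2 hyp (bd c c0)
    (crit_notin_julia hyp c0).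
  exists (Num.min e (r / 2)); first by rewrite lt_min e0 divr_gt0.
  move=> q' sq' qq' y; rewrite le_min => /andP[_ yr]; apply: H.
  + by rewrite sq sq'.
  + by move=> i; have := qq' i; rewrite le_min => /andP[].
  + by lra.
have [d d0 Hd] := crit_close sq n1 e0.
exists (Num.min d e); first by rewrite lt_min d0.
move=> q' sq' qq' c' c'0.
have [|_ H] := Hd q' sq'.
  by move=> i; have := qq' i; rewrite le_min => /andP[].
have [c c0 cc'] := H c' c'0.
apply: (He c _ q' sq' _ c' cc'); first by rewrite Hs; apply/eqP.
by move=> i; have := qq' i; rewrite le_min => /andP[].
Qed.

Lemma crit_unbounded_open q n : size q = n.+1 -> (1 < n)%N ->
  ~ crit_bounded q ->
  exists2 d : R, 0 < d & forall q', size q' = n.+1 ->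
    (forall i, cmod (q'`_i - q`_i) <= d) -> ~ crit_bounded q'.
Proof.
move=> sq n1 nbd.
have [c [c0 cK]] : exists c, q^`().[c] = 0 /\ ~ filled_julia q c.
  apply: contrapT => nex; apply: nbd => c c0; apply: contrapT => cK.
  by apply: nex; exists c.
have [M M1 [d1 d10 esc]] := escape_uniform sq n1.
have [k Mk] : exists k, M + 1 < cmod (iter k (horner q) c).
  apply: contrapT => nex; apply: cK; apply/filled_juliaP; exists (M + 1) => k.
  by rewrite leNgt; apply/negP => Mk; apply: nex; exists k.
(* Moving the critical point and moving the polynomial each cost at most 1/2, so an orbit beyond
   [M + 1] stays beyond [M]. *)
have h0 : (0 : R) < 1 / 2 by lra.
have [r r0 Hr] := horner_continuous (poly_iter q k) c h0.
have [d2 d20 Hd2] := iter_close q k (cmod c + r) h0.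
have r20 : 0 < r / 2 by rewrite divr_gt0.
have [d3 d30 Hd3] := crit_close sq n1 r20.
exists (Num.min d1 (Num.min d2 d3)); first by rewrite !lt_min d10 d20.
move=> q' sq' qq' bd.
have q1 i : cmod (q'`_i - q`_i) <= d1 by have := qq' i; rewrite !le_min => /and3P[].
have q2 i : cmod (q'`_i - q`_i) <= d2 by have := qq' i; rewrite !le_min => /and3P[].
have q3 i : cmod (q'`_i - q`_i) <= d3 by have := qq' i; rewrite !le_min => /and3P[].
have [H _] := Hd3 q' sq' q3; have [c' c'0 cc'] := H c c0.
have := bd c' c'0 => /(filled_julia_iter q' k c').1.
have cr : cmod (c' - c) < r by rewrite cmodB; lra.
have c'M : cmod c' <= cmod c + r.
  by have := cmodD (c' - c) c; rewrite subrK; lra.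
have sqq : (size q' <= size q)%N by rewrite sq sq'.
have h1 := Hd2 q' sqq q2 c' c'M.
have := Hr c' cr; rewrite !poly_iterE => h2.
have h3 : M <= cmod (iter k (horner q') c').
  have := cmod_triangle (iter k (horner q') c') (iter k (horner q) c)
    (iter k (horner q') c').
  have := cmodD (iter k (horner q) c - iter k (horner q) c')
    (iter k (horner q) c').
  have := cmodD (iter k (horner q) c' - iter k (horner q') c')
    (iter k (horner q') c').
  by rewrite !subrK (cmodB (iter k (horner q) c) (iter k (horner q) c'))
    (cmodB (iter k (horner q) c') (iter k (horner q') c')); lra.
move=> /filled_juliaP; set y := iter k _ c'.
have M0 : 0 <= M by lra.
have ud := @doubling_ge _ (fun n => cmod (iter n (horner q') y)) M M0 h3
  (fun n => esc q' sq' q1 _).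
apply: (@doubling_unbounded _ _ (cmod y)); first by rewrite (lt_le_trans _ h3) //; lra.
by move=> m; have [] := ud m.
Qed.

End Components.

(** * The invariant separating the components *)

Section SkewComponents.
Variables (R : realType) (d : nat).
Implicit Types (f g : coefs R d) (x y z w : R[i]).

Definition coef_close (e : R) f g : Prop :=
  (forall i, cmod (g.1 0 i - f.1 0 i) <= e) /\
  (forall i j, cmod (g.2 i j - f.2 i j) <= e).

Lemma coef_close_nbhs f (e : R) : 0 < e -> nbhs f [set g | coef_close e f g].
Proof.
move=> e0; case: f => [r m].
have near_le x : nbhs x [set y | cmod (y - x) <= e].
  by apply/nbhscP; exists e => // y /ltW.
exists ([set s : 'rV[R[i]]_d.+1 | forall i, cmod (s 0 i - r 0 i) <= e],
        [set n : 'M[R[i]]_d.+1 | forall k, cmod (n k.1 k.2 - m k.1 k.2) <= e]).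
  split => /=.
  - apply: (@filter_forall _ 'I_d.+1
      (fun i => [set s : 'rV[R[i]]_d.+1 | cmod (s 0 i - r 0 i) <= e])
      (nbhs r) (nbhs_filter r)) => i.
    exact: (@coord_continuous R[i] _ _ 0 i r _ (near_le (r 0 i))).
  - apply: (@filter_forall _ ('I_d.+1 * 'I_d.+1)%type
      (fun k => [set n : 'M[R[i]]_d.+1 | cmod (n k.1 k.2 - m k.1 k.2) <= e])
      (nbhs m) (nbhs_filter m)) => k.
    exact: (@coord_continuous R[i] _ _ k.1 k.2 m _ (near_le (m k.1 k.2))).
move=> [s n] /= [hs hn]; split=> //= i j; exact: (hn (i, j)).
Qed.

Lemma coef_base f (i : 'I_d.+1) : (base f)`_i = f.1 0 i.
Proof. exact: coef_rVpoly_ord. Qed.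

(** The coefficient of w^j in q(z, w), as a polynomial in z. *)
Definition fiber_coef f (j : 'I_d.+1) : {poly R[i]} := rVpoly (row j f.2^T).

Lemma coef_fiber_coef f (i j : 'I_d.+1) : (fiber_coef f j)`_i = f.2 i j.
Proof. by rewrite coef_rVpoly_ord !mxE. Qed.

Lemma size_rVpoly_le n (v : 'rV[R[i]]_n) : (size (rVpoly v) <= n)%N.
Proof. exact: size_poly. Qed.

Lemma coef_fiber f z (j : 'I_d.+1) : (fiber f z)`_j = (fiber_coef f j).[z].
Proof.
rewrite (horner_coef_wide _ (size_rVpoly_le _)) /fiber coef_sum.
apply: eq_bigr => i _; rewrite coef_fiber_coef coef_sum (bigD1 j) //= coefZ.
rewrite coefXn eqxx mulr1 big1 ?addr0 // => k kj.
by rewrite coefZ coefXn eq_sym (inj_eq val_inj) (negbTE kj) mulr0.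
Qed.

Lemma size_fiber_le f z : (size (fiber f z) <= d.+1)%N.
Proof.
apply/leq_sizeP => k dk; rewrite /fiber coef_sum big1 // => i _.
rewrite coef_sum big1 // => j _; rewrite coefZ coefXn.
by rewrite gtn_eqF ?mulr0 // (leq_trans (ltn_ord j)).
Qed.

(** Otherwise the homogeneous lift would vanish at (0, 1, 0). *)
Lemma skew_top f : skew_product f -> f.2 0 ord_max != 0.
Proof.
move=> [d2 f0 hom]; apply/negP => /eqP ftop.
have d0 : (0 < d)%N by apply: ltnW.
have [||| _ /eqP] := hom 0 1 0; last by rewrite oner_eq0.
- rewrite /hom_base big1 // => i _.
  have [i0|i0] := eqVneq (i : nat) 0%N.
    by rewrite i0 subn0 [X in _ * X]expr0n (gtn_eqF d0) mulr0.
  by rewrite expr0n (negbTE i0) mulr0 mul0r.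
- rewrite /hom_fiber big1 // => i _; rewrite big1 // => j ij.
  have [i0|i0] := eqVneq (i : nat) 0%N; last first.
    by rewrite expr0n (negbTE i0) mulr0 !mul0r.
  have [jd|jd] := eqVneq (j : nat) d.
    have -> : i = 0 by apply: val_inj.
    have -> : j = ord_max by apply: val_inj.
    by rewrite ftop !mul0r.
  rewrite i0 add0n [X in _ * X]expr0n.
  have -> : (d - j == 0)%N = false by have := ltn_ord j; lia.
  by rewrite mulr0.
- by rewrite expr0n (gtn_eqF d0).
Qed.

Lemma size_fiber f z : skew_product f -> size (fiber f z) = d.+1.
Proof.
move=> sk; apply/eqP; rewrite eqn_leq size_fiber_le /= ltnNge.
apply/negP => /leq_sizeP /(_ d (leqnn _)) /eqP.
rewrite -[d in _`_d]/(val (@ord_max d)) coef_fiber.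
rewrite (horner_coef_wide _ (size_rVpoly_le _)) (bigD1 ord0) //= big1.
  by rewrite addr0 mulr1 (coef_fiber_coef f ord0) (negbTE (skew_top sk)).
move=> i i0; rewrite coef_fiber_coef; case: sk => _ -> //; first by rewrite mul0r.
by rewrite /= -[X in (X < _)%N]add0n ltn_add2r lt0n.
Qed.

(** If the coefficient of z^d were zero, the lift would vanish at (1, w, 0) for any root w of [P],
    the top-degree form of q at z = 1, which has positive degree by [skew_top]. *)
Lemma size_base f : skew_product f -> size (base f) = d.+1.
Proof.
move=> sk; have [d2 _ hom] := sk.
have d0 : (0 < d)%N by apply: ltnW.
apply/eqP; rewrite eqn_leq size_rVpoly_le /= ltnNge; apply/negP.
move=> /leq_sizeP /(_ d (leqnn _)).
rewrite -[d in _`_d]/(val (@ord_max d)) coef_base => f0.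
pose P := \poly_(j < d.+1) f.2 (inord (d - j)) (inord j).
have PE (j : 'I_d.+1) : P`_j = f.2 (rev_ord j) j.
  rewrite coef_poly ltn_ord; congr (f.2 _ _); apply: val_inj => /=.
    by rewrite inordK ?subSS // ltnS leq_subr.
  by rewrite inordK.
have sP : (size P == 1)%N = false.
  have : P`_d != 0.
    have := PE ord_max => /= ->; have -> : rev_ord ord_max = ord0 :> 'I_d.+1.
      by apply: val_inj => /=; rewrite subnn.
    exact: skew_top.
  apply: contraNF => /eqP sP; have /leq_sizeP -> // : (size P <= d)%N.
  by rewrite sP.
have /closed_rootP[w Pw] : size P != 1%N by rewrite sP.
have [|||/eqP] := hom 1 w 0; last by rewrite oner_eq0.
- rewrite /hom_base (bigD1 ord_max) //= f0 !mul0r add0r big1 // => i id.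
  rewrite [X in _ * X]expr0n.
  have -> : (d - i == 0)%N = false.
    by have := ltn_ord i; move: id; rewrite -val_eqE /=; lia.
  by rewrite mulr0.
- move/eqP: Pw; rewrite (horner_coef_wide _ (size_poly _ _)) => Pw0.
  rewrite -[RHS]Pw0 /hom_fiber (exchange_big_dep xpredT) //=.
  apply: eq_bigr => j _; have jd : (j <= d)%N by rewrite -ltnS.
  rewrite PE (bigD1 (rev_ord j)) /=; last first.
    by rewrite subSS subnK.
  rewrite expr1n mulr1 subSS subnK // subnn expr0 mulr1.
  rewrite big1 ?addr0 // => i /andP[ij ir]; rewrite [X in _ * X]expr0n.
  have -> : (d - (i + j) == 0)%N = false.
    have := ltn_ord j; move: ij ir; rewrite -val_eqE /= subSS; lia.
  by rewrite mulr0.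
- by rewrite expr0n (gtn_eqF d0).
Qed.

Definition mixed f : Prop := exists a b,
  [/\ (base f).[a] = a, (base f).[b] = b,
      crit_bounded (fiber f a) & ~ crit_bounded (fiber f b)].

Lemma iter_fixed (T : Type) (h : T -> T) t n : h t = t -> iter n h t = t.
Proof. by move=> ht; elim: n => //= n ->. Qed.

Lemma iter_skew_map f z w n : (iter n (skew_map f) (z, w)).1 =
  iter n (horner (base f)) z.
Proof. by elim: n => //= n ->. Qed.

Lemma iter_skew_map_fixed f a w n : (base f).[a] = a ->
  iter n (skew_map f) (a, w) = (a, iter n (horner (fiber f a)) w).
Proof. by move=> fa; elim: n => //= n ->; rewrite /skew_map /= fa. Qed.

Lemma fiber_filled_julia_fixed f a : (base f).[a] = a ->
  fiber_filled_julia f a = filled_julia (fiber f a).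
Proof.
move=> fa; apply/seteqP; split=> w.
  move=> /bounded_orbitsP[M HM]; apply/filled_juliaP; exists M => n.
  by have [_] := HM n; rewrite iter_skew_map_fixed.
move=> /filled_juliaP[M HM]; apply/bounded_orbitsP.
exists (Num.max (cmod a) M) => n; rewrite iter_skew_map_fixed //= !le_max lexx.
by rewrite HM orbT.
Qed.

Lemma fiber_iter_fixed f a n : (base f).[a] = a ->
  fiber_iter f a n = poly_iter (fiber f a) n.
Proof.
by move=> fa; elim: n => //= n ->; rewrite (iter_fixed _ fa).
Qed.

Lemma axiomA_fixed_hyperbolic f a : axiomA f -> (base f).[a] = a ->
  hyperbolic_poly (fiber f a).
Proof.
move=> [sk hyp vJ vA] fa.
have sb : (2 < size (base f))%N by rewrite (size_base sk); case: sk.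
have [c [L [c0 L1 H]]] : exists c L : R, [/\ 0 < c, 1 < L & forall w n,
    fiber_julia f a w -> (0 < n)%N ->
    (c * L ^+ n)%:C <= `|(fiber_iter f a n)^`().[w]|].
  have [aJ|aA] := hyperbolic_fixed sb hyp fa.
    by have [c [L [c0 L1 H]]] := vJ; exists c, L; split=> // w n; apply: H.
  by have [c [L [c0 L1 H]]] := vA; exists c, L; split=> // w n; apply: H.
exists c, L; split=> // w n wJ n0; rewrite -fiber_iter_fixed //; apply: H => //.
by rewrite /fiber_julia fiber_filled_julia_fixed.
Qed.

Lemma fiber_close f z (e : R) : 0 < e -> exists2 r : R, 0 < r &
  forall g z', coef_close r f g -> cmod (z' - z) <= r ->
    forall i, cmod ((fiber g z')`_i - (fiber f z)`_i) <= e.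
Proof.
move=> e0; have e20 : 0 < e / 2 by rewrite divr_gt0.
have [||r r0 Hr] := @seq_small R _ (enum 'I_d.+1) (fun j r => forall g z',
    coef_close r f g -> cmod (z' - z) <= r ->
    cmod ((fiber g z')`_j - (fiber f z)`_j) <= e).
- move=> j r r' rr' H g z' [g1 g2] zr; apply: H.
    by split=> *; apply: le_trans rr'.
  exact: le_trans rr'.
- move=> j _.
  have [r r0 Hr] := horner_continuous (fiber_coef f j) z e20.
  have [C C0 HC] := horner_close d.+1 (cmod z + r).
  exists (Num.min (r / 2) (e / 2 / C)); first by rewrite lt_min !divr_gt0.
  move=> g z' [_ fg]; rewrite !coef_fiber le_min => /andP[zr _].
  have zr' : cmod (z' - z) < r by lra.
  have h1 := Hr z' zr'.
  have z'M : cmod z' <= cmod z + r.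
    by have := cmodD (z' - z) z; rewrite subrK; lra.
  have cl i : cmod ((fiber_coef g j)`_i - (fiber_coef f j)`_i) <= e / 2 / C.
    have [id|id] := leqP d.+1 i.
      rewrite !nth_default ?(leq_trans (size_rVpoly_le _)) // subrr cmod0.
      by rewrite !divr_ge0 // ltW.
    rewrite (coef_fiber_coef g (Ordinal id)) (coef_fiber_coef f (Ordinal id)).
    by have := fg (Ordinal id) j; rewrite le_min => /andP[].
  have := HC _ _ _ (size_rVpoly_le _) (size_rVpoly_le _) cl _ z'M.
  rewrite mulrCA divff ?gt_eqF // mulr1 => h2.
  rewrite -!/(fiber_coef _ _) in h2.
  have := cmod_triangle (fiber_coef f j).[z'] (fiber_coef g j).[z']
    (fiber_coef f j).[z].
  lra.
exists r => // g z' fg zr i.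
have [id|id] := leqP d.+1 i.
  by rewrite !nth_default ?(leq_trans (size_fiber_le _ _)) // subrr cmod0 ltW.
by apply: (Hr (Ordinal id)) => //; rewrite mem_enum.
Qed.

(** Fixed points of the two bases are matched in both directions by [roots_close]: none of f is
    lost, and every one of g has the critical behaviour of a neighbouring one of f. *)
Lemma mixed_locally_constant f : axiomA f -> exists2 e : R, 0 < e &
  forall g, skew_product g -> coef_close e f g -> (mixed g <-> mixed f).
Proof.
move=> Af; have [sk _ _ _] := Af; have [d2 _ _] := sk.
have sfix g : skew_product g -> size (base g - 'X) = d.+1.
  move=> skg; rewrite size_polyDl size_base // size_polyN size_polyX.
  by rewrite ltnS.
have fixE g a : root (base g - 'X) a <-> (base g).[a] = a.
  by rewrite rootE !hornerE subr_eq0; split=> /eqP.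
have [|s Hs] := @poly_roots _ (base f - 'X).
  by rewrite -size_poly_gt0 sfix.
have [||r r0 Hr] := @seq_small R _ s (fun a r => forall g a',
    skew_product g -> coef_close r f g -> cmod (a' - a) <= r ->
    (crit_bounded (fiber g a') <-> crit_bounded (fiber f a))).
- move=> a r r' rr' H g z' skg [g1 g2] zr; apply: H => //.
    by split=> *; apply: le_trans rr'.
  exact: le_trans rr'.
- move=> a; rewrite Hs => /fixE fa.
  have hyp := axiomA_fixed_hyperbolic Af fa.
  have sfa := size_fiber a sk.
  have [bd|nbd] := pselect (crit_bounded (fiber f a)).
    have [e e0 He] := crit_bounded_open sfa d2 hyp bd.
    have [r r0 Hr] := fiber_close f a e0; exists r => // g a' skg fg aa'.
    by split=> // _; apply: He; [exact: size_fiber|exact: Hr].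
  have [e e0 He] := crit_unbounded_open sfa d2 nbd.
  have [r r0 Hr] := fiber_close f a e0; exists r => // g a' skg fg aa'.
  by split=> // /He []; [exact: size_fiber|exact: Hr].
have [e e0 He] := roots_close (sfix f sk) (ltnW d2) r0.
exists (Num.min e r); first by rewrite lt_min e0.
move=> g skg [fg1 fg2].
have fgr : coef_close r f g.
  split=> [i|i j]; first by have := fg1 i; rewrite le_min => /andP[].
  by have := fg2 i j; rewrite le_min => /andP[].
have cl i : cmod ((base g - 'X)`_i - (base f - 'X)`_i) <= e.
  have -> : (base g - 'X)`_i - (base f - 'X)`_i = (base g)`_i - (base f)`_i.
    by rewrite !coefB; ring.
  have [id|id] := leqP d.+1 i.
    by rewrite !nth_default ?(leq_trans (size_rVpoly_le _)) // subrr cmod0 ltW.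
  rewrite (coef_base g (Ordinal id)) (coef_base f (Ordinal id)).
  by have := fg1 (Ordinal id); rewrite le_min => /andP[].
have [fg gf] := He _ (sfix g skg) cl.
have gf' a' : (base g).[a'] = a' -> exists2 a, (base f).[a] = a &
    (crit_bounded (fiber g a') <-> crit_bounded (fiber f a)).
  move=> /fixE /gf [a af aa']; exists a; first exact/fixE.
  by apply: Hr; rewrite ?Hs.
have fg' a : (base f).[a] = a -> exists2 a', (base g).[a'] = a' &
    (crit_bounded (fiber g a') <-> crit_bounded (fiber f a)).
  move=> /fixE fa; have [a' ga' aa'] := fg a fa; exists a'; first exact/fixE.
  by apply: Hr; rewrite ?Hs // cmodB.
split=> [[a [b [ga gb Ca Cb]]]|[a [b [fa fb Ca Cb]]]].
- have [a' fa' [h1 h2]] := gf' a ga; have [b' fb' [h3 h4]] := gf' b gb.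
  by exists a', b'; split=> //; [exact: h1|move=> /h4].
- have [a' ga' [h1 h2]] := fg' a fa; have [b' gb' [h3 h4]] := fg' b fb.
  by exists a', b'; split=> //; [exact: h2|move=> /h3].
Qed.

Lemma product_not_mixed f : is_product f -> ~ mixed f.
Proof.
move=> [p0 [q0 fE]] [a [b [_ _ Ca Cb]]].
suff fab : fiber f a = fiber f b by rewrite -fab in Cb.
have fq z w : (fiber f z).[w] = q0.[w] by have [] := fE z w.
apply/eqP; rewrite -subr_eq0; set P := _ - _.
have P0 w : P.[w] = 0 by rewrite hornerD hornerN !fq subrr.
(* A polynomial vanishing everywhere is zero: [P + 1] takes only the value 1, so it has no root and
   must be constant. *)
have /size_poly1P[c c0 Pc] : size (P + 1) == 1%N.
  apply/negPn/negP => /closed_rootP[w].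
  by rewrite rootE hornerD P0 hornerC add0r oner_eq0.
have PC : P = (c - 1)%:P by rewrite rmorphB /= -Pc rmorph1 addrK.
by have := P0 0; rewrite PC hornerC => ->; rewrite rmorph0.
Qed.

Lemma mixed_not_in_component f : mixed f -> ~ in_component_of_product f.
Proof.
move=> mf [H [[g0 _ ->] Hf [g Hg pg]]].
(* [V mx] is open and meets the Axiom A maps exactly in those with [mixed h <-> mx]. The mixed maps
   of the component are thus cut out both by the open set [V True] and by the closed complement of
   [V False]. The guard [skew_product g'] is there because nearby coefficients need not define a
   skew product. *)
pose V (mx : Prop) := \bigcup_(h in [set h | axiomA h /\ (mixed h <-> mx)])
  interior [set g' | skew_product g' -> (mixed g' <-> mx)].
have Vopen mx : open (V mx) by apply: bigcup_open => h _; apply: open_interior.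
have VP mx h : axiomA h -> (V mx h <-> (mixed h <-> mx)).
  move=> Ah; split=> [[h' _ /interior_subset]|hmx]; first by apply; case: Ah.
  exists h => //; have [e e0 He] := mixed_locally_constant Ah.
  apply: filterS (coef_close_nbhs h e0) => g' hg' skg'.
  by rewrite (He g' skg' hg').
have HA h : connected_component axiomA g0 h -> axiomA h.
  exact: connected_component_sub.
have : [set h | connected_component axiomA g0 h /\ mixed h] =
    connected_component axiomA g0.
  apply: (@component_connected _ axiomA g0).
  - by exists f.
  - exists (V True) => //; apply/seteqP; split=> h [Hh mh]; split=> //.
      by apply/VP; [exact: HA|split].
    by apply: (proj1 (VP True h (HA h Hh)) mh).2.
  - exists (~` V False); first exact: open_closedC.
    apply/seteqP; split=> h [Hh mh]; split=> //.
      by move=> /(proj1 (VP False h (HA h Hh))) [].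
    apply: contrapT => nmh; apply: mh; apply/VP; [exact: HA|by split].
move/seteqP => [_ /(_ g Hg) [_ mg]]; exact: (product_not_mixed pg mg).
Qed.

End SkewComponents.

(** * Expansion along non-autonomous orbits *)

Section Nonautonomous.
Variable R : realType.
Implicit Types (p q : {poly R[i]}) (P : nat -> {poly R[i]}) (x y z w : R[i]).

(** Arbitrary sequences cover two cases at once: a constant sequence gives the iterates of one
    polynomial, and [fiber_seq] gives Q_z^n. *)
Fixpoint poly_comp_seq P (n : nat) : {poly R[i]} :=
  if n is m.+1 then P m \Po poly_comp_seq P m else 'X.

Lemma poly_comp_seqS P n w :
  (poly_comp_seq P n.+1).[w] = (P n).[(poly_comp_seq P n).[w]].
Proof. exact: horner_comp. Qed.

Lemma poly_comp_seq0 P w : (poly_comp_seq P 0).[w] = w.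
Proof. exact: hornerX. Qed.

Lemma poly_comp_seq_shift P n m w :
  (poly_comp_seq (fun k => P (k + n)%N) m).[(poly_comp_seq P n).[w]] =
  (poly_comp_seq P (m + n)).[w].
Proof.
elim: m => [|m IH]; first by rewrite poly_comp_seq0.
by rewrite addSn !poly_comp_seqS IH.
Qed.

Definition bounded_along P : set R[i] :=
  [set w | exists M : R, forall n, cmod (poly_comp_seq P n).[w] <= M].

Lemma bounded_along_shift P n w : bounded_along P w ->
  bounded_along (fun k => P (k + n)%N) (poly_comp_seq P n).[w].
Proof.
by move=> [M HM]; exists M => m; rewrite poly_comp_seq_shift; apply: HM.
Qed.

Lemma bounded_along_unshift P n w :
  bounded_along (fun k => P (k + n)%N) (poly_comp_seq P n).[w] ->
  bounded_along P w.
Proof.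
move=> [M HM].
have [B HB] : exists B, forall k, (k <= n)%N -> cmod (poly_comp_seq P k).[w] <= B.
  elim: (n) => [|k [B HB]].
    by exists (cmod w) => k; rewrite leqn0 => /eqP ->; rewrite poly_comp_seq0.
  exists (Num.max B (cmod (poly_comp_seq P k.+1).[w])) => l.
  rewrite le_max leq_eqVlt => /orP[/eqP ->|/HB ->] //.
  by rewrite lexx orbT.
exists (Num.max B M) => k; rewrite le_max.
have [/HB ->//|kn] := leqP k n.
by rewrite -(subnK (ltnW kn)) -poly_comp_seq_shift HM orbT.
Qed.

(** Two facts carry the one-step bound along the orbit of a boundary point. The bound [M], uniform
    over the shift-invariant family [F], makes the bounded sets closed, so [w] itself has a bounded
    orbit; and if an image of [w] were interior, continuity would make [w] interior. The chain rule
    multiplies the bounds. *)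
Lemma expanding_along (F : set (nat -> {poly R[i]})) (M L : R) : 0 <= L ->
  (forall P n, F P -> F (fun k => P (k + n)%N)) ->
  (forall P w, F P -> bounded_along P w -> cmod w <= M) ->
  (forall P w, F P -> bounded_along P w -> ~ interior (bounded_along P) w ->
     L <= cmod (P 0%N)^`().[w]) ->
  forall P w n, F P -> boundary (bounded_along P) w ->
    L ^+ n <= cmod (poly_comp_seq P n)^`().[w].
Proof.
move=> L0 Fs FM FL P w n FP wJ.
have wK : bounded_along P w.
  exists M => k; rewrite leNgt; apply/negP => Mk.
  rewrite -subr_gt0 in Mk.
  have [d d0 Hd] := horner_continuous (poly_comp_seq P k) w Mk.
  move/boundarycP : wJ => /(_ d d0)[[y yK yw] _].
  have := FM _ _ (Fs P k FP) (bounded_along_shift k yK) => yM.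
  have := Hd y yw; rewrite cmodB.
  have := cmodD ((poly_comp_seq P k).[w] - (poly_comp_seq P k).[y])
    (poly_comp_seq P k).[y].
  by rewrite subrK; lra.
elim: n => [|n IH]; first by rewrite expr0 derivX hornerC cmod1.
rewrite exprS deriv_comp hornerM cmodM; apply: ler_pM => //.
  exact: exprn_ge0.
rewrite horner_comp.
apply: (FL _ _ (Fs P n FP)); first exact: bounded_along_shift.
move=> /interiorcP[e e0 eK].
have [d d0 Hd] := horner_continuous (poly_comp_seq P n) w e0.
case: wJ => _; apply; apply/interiorcP; exists d => // y /Hd /eK.
exact: bounded_along_unshift.
Qed.

Lemma unbounded_of_doubling P w (c : R) N : 0 < c ->
  (forall n, 2 ^+ n * c <= cmod (poly_comp_seq P (n + N)).[w]) ->
  ~ bounded_along P w.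
Proof.
move=> c0 H [M HM].
apply: (@doubling_unbounded _ (fun n => cmod (poly_comp_seq P (n + N)).[w]) c) => //.
by exists M => n.
Qed.

Lemma poly_comp_seq_const p n : poly_comp_seq (fun=> p) n = poly_iter p n.
Proof. by elim: n => //= n ->. Qed.

Lemma bounded_along_const p : bounded_along (fun=> p) = filled_julia p.
Proof.
apply/seteqP; split=> w.
  move=> [M HM]; apply/filled_juliaP; exists M => n.
  by rewrite -poly_iterE -poly_comp_seq_const.
move=> /filled_juliaP[M HM]; exists M => n.
by rewrite poly_comp_seq_const poly_iterE.
Qed.

Lemma hyperbolic_polyI p (M L : R) : 1 < L ->
  (forall w, filled_julia p w -> cmod w <= M) ->
  (forall w, filled_julia p w -> ~ interior (filled_julia p) w ->
     L <= cmod p^`().[w]) ->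
  hyperbolic_poly p.
Proof.
move=> L1 HM HL; exists 1, L; split=> // w n wJ _.
rewrite mul1r normcE lecR -poly_comp_seq_const.
apply: (@expanding_along [set fun=> p] M) => //.
- by rewrite (le_trans _ (ltW L1)).
- by move=> P k ->.
- by move=> P v ->; rewrite bounded_along_const; apply: HM.
- by move=> P v ->; rewrite bounded_along_const; apply: HL.
- by rewrite bounded_along_const.
Qed.

Definition fiber_seq d (f : coefs R d) z (n : nat) : {poly R[i]} :=
  fiber f (iter n (horner (base f)) z).

Lemma fiber_iterE d (f : coefs R d) z n :
  fiber_iter f z n = poly_comp_seq (fiber_seq f z) n.
Proof. by elim: n => //= n ->. Qed.

Lemma iter_skew_map2 d (f : coefs R d) z w n :
  (iter n (skew_map f) (z, w)).2 = (poly_comp_seq (fiber_seq f z) n).[w].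
Proof.
elim: n => [|n IH]; first by rewrite poly_comp_seq0.
by rewrite poly_comp_seqS iterS /skew_map /= IH iter_skew_map.
Qed.

Lemma fiber_filled_juliaE d (f : coefs R d) z : filled_julia (base f) z ->
  fiber_filled_julia f z = bounded_along (fiber_seq f z).
Proof.
move=> /filled_juliaP[M0 HM0]; apply/seteqP; split=> w.
  move=> /bounded_orbitsP[M HM]; exists M => n.
  by have [_] := HM n; rewrite iter_skew_map2.
move=> [M HM]; apply/bounded_orbitsP; exists (Num.max M0 M) => n.
by rewrite iter_skew_map iter_skew_map2 !le_max HM0 HM orbT.
Qed.

Lemma vertically_expandingI d (f : coefs R d) (Z : set R[i]) (M L : R) : 1 < L ->
  Z `<=` filled_julia (base f) -> (forall z, Z z -> Z (base f).[z]) ->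
  (forall z w, Z z -> bounded_along (fiber_seq f z) w -> cmod w <= M) ->
  (forall z w, Z z -> bounded_along (fiber_seq f z) w ->
     ~ interior (bounded_along (fiber_seq f z)) w ->
     L <= cmod (fiber f z)^`().[w]) ->
  vertically_expanding f Z.
Proof.
move=> L1 ZK ZS HM HL; exists 1, L; split=> // z w n Zz wJ _.
rewrite mul1r normcE lecR fiber_iterE.
apply: (@expanding_along [set P | exists2 z, Z z & P = fiber_seq f z] M) => //.
- by rewrite (le_trans _ (ltW L1)).
- move=> P k [y Zy ->]; exists (iter k (horner (base f)) y).
    by elim: k => //= k; apply: ZS.
  by apply/funext => m; rewrite /fiber_seq -iterD.
- by move=> P v [y Zy ->]; apply: HM.
- by move=> P v [y Zy ->]; apply: HL.
- by exists z.
- by rewrite -fiber_filled_juliaE //; apply: ZK.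
Qed.

Lemma vertically_expanding_set0 d (f : coefs R d) : vertically_expanding f set0.
Proof. by exists 1, 2; split=> //; lra. Qed.

End Nonautonomous.

(** * Power maps: Julia set, hyperbolicity and attracting cycles *)

Section PowerMap.
Variables (R : realType) (d : nat).
Hypothesis d2 : (1 < d)%N.
Implicit Types (x y z w : R[i]).

Lemma iter_Xn z n : iter n (horner 'X^d) z = z ^+ (d ^ n).
Proof.
elim: n => [|n IH]; first by rewrite expr1.
by rewrite iterS IH hornerXn -exprM expnSr.
Qed.

Lemma filled_julia_Xn z : filled_julia 'X^d z <-> cmod z <= 1.
Proof.
rewrite filled_juliaP; split=> [[M HM]|z1]; last first.
  by exists 1 => n; rewrite iter_Xn cmodX exprn_ile1 // cmod_ge0.
rewrite leNgt; apply/negP => z1.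
have s0 : 0 < cmod z - 1 by rewrite subr_gt0.
pose n := Num.bound (`|M| / (cmod z - 1)).
have : `|M| / (cmod z - 1) < n%:R by apply: archi_boundP; rewrite divr_ge0 // ltW.
rewrite ltr_pdivrMr // => nM.
have := bernoulli_le n (ltW z1); have := HM n; rewrite iter_Xn cmodX.
have : cmod z ^+ n <= cmod z ^+ (d ^ n).
  by rewrite ler_weXn2l ?ltW // (ltnW (ltn_expl _ _)).
by have := ler_norm M; lra.
Qed.

Lemma julia_Xn z : julia 'X^d z <-> cmod z = 1.
Proof.
split=> [/boundarycP zJ|z1].
  apply/eqP; rewrite eq_le; apply/andP; split; rewrite leNgt; apply/negP => z1.
    have e0 : 0 < cmod z - 1 by rewrite subr_gt0.
    have [[y /filled_julia_Xn y1 yz] _] := zJ _ e0.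
    by have := cmodD (z - y) y; rewrite subrK cmodB; lra.
  have e0 : 0 < 1 - cmod z by rewrite subr_gt0.
  have [_ [y nyK yz]] := zJ _ e0; apply: nyK; apply/filled_julia_Xn.
  by have := cmodD (y - z) z; rewrite subrK; lra.
apply/boundarycP => e e0; split.
  by exists z; [apply/filled_julia_Xn; rewrite z1|rewrite subrr cmod0].
exists ((1 + e / 2)%:C * z).
  rewrite filled_julia_Xn cmodM cmodR z1 mulr1 ger0_norm; last by lra.
  by apply/negP; rewrite -ltNge; lra.
have -> : (1 + e / 2)%:C * z - z = (e / 2)%:C * z.
  by rewrite rmorphD rmorph1; ring.
by rewrite cmodM cmodR z1 mulr1 ger0_norm; lra.
Qed.

Lemma hyperbolic_Xn : hyperbolic_poly ('X^d : {poly R[i]}).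
Proof.
apply: (@hyperbolic_polyI _ _ 1 2); first by lra.
  by move=> w /filled_julia_Xn.
move=> w wK wint.
have : julia 'X^d w by split=> //; apply: subset_closure.
move=> /julia_Xn w1.
by rewrite derivXn hornerMn hornerXn -[w ^+ _ *+ _]mulr_natl cmodM cmod_nat cmodX w1
  expr1n mulr1 ler_nat.
Qed.

(** A non-zero point with z^(d^n) = z satisfies z^(d^n - 1) = 1, so its multiplier is d^n. *)
Lemma attracting_periodic_Xn z : attracting_periodic 'X^d z -> z = 0.
Proof.
move=> [n [n0 zn dz]]; apply/eqP; apply: contraT => z0.
move: zn dz; rewrite iter_Xn => zn.
have dn : (1 < d ^ n)%N by rewrite -(exp1n n) ltn_exp2r.
have z1 : z ^+ (d ^ n).-1 = 1.
  by apply: (mulfI z0); rewrite -exprS prednK ?mulr1 // ltnW.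
have -> : poly_iter 'X^d n = 'X^(d ^ n) :> {poly R[i]}.
  elim: (n) => [|k IH]; first by rewrite expr1.
  rewrite -[poly_iter _ k.+1]/('X^d \Po poly_iter 'X^d k) IH comp_Xn_poly.
  by rewrite -exprM expnSr.
rewrite derivXn hornerMn hornerXn z1 normr_nat -[X in _ < X]/(1%:R).
by rewrite ltr_nat ltnNge (ltnW dn).
Qed.

End PowerMap.

(** * Accumulation sets: inclusions and a criterion for emptiness *)

Section Accumulation.
Variables (R : realType) (d : nat).
Implicit Types (f : coefs R d) (X Y : set (R[i] * R[i])).

Lemma accumulationP f X y : accumulation f X y <->
  forall N (e : R), 0 < e -> exists n x, [/\ (N <= n)%N, X x,
    cmod ((iter n (skew_map f) x).1 - y.1) < e &
    cmod ((iter n (skew_map f) x).2 - y.2) < e].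
Proof.
split=> [accy N e e0|H N _].
  have /closurec2P /(_ e e0) [_ [[n /= Nn [x Xx <-]] y1 y2]] := accy N I.
  by exists n, x.
apply/closurec2P => e e0; have [n [x [Nn Xx y1 y2]]] := H N e e0.
by exists (iter n (skew_map f) x); split=> //; exists n => //; exists x.
Qed.

Lemma accumulation_closed f X : closed (accumulation f X).
Proof. by apply: closed_bigI => N _; apply: closed_closure. Qed.

Lemma accumulationS f X Y : X `<=` Y -> accumulation f X `<=` accumulation f Y.
Proof.
move=> XY y /accumulationP H; apply/accumulationP => N e e0.
have [n [x [Nn Xx y1 y2]]] := H N e e0; exists n, x; split=> //; exact: XY.
Qed.

Lemma A_pt_sub f : A_pt f `<=` A_cc f.
Proof.
apply: closureS => y [x xC yx]; exists x => //.
by apply: accumulationS yx => _ ->; apply: connected_component_refl.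
Qed.

Lemma A_cc_sub f : A_cc f `<=` A_crit f.
Proof.
move=> y; rewrite [A_crit f](closure_id _).1; last exact: accumulation_closed.
apply: closureS => {}y [x xC]; apply: accumulationS.
exact: connected_component_sub.
Qed.

(** [c] and [N] are common to all points of [X]. Escape of each orbit at its own time would not
    suffice, because A(X) also collects limits along orbits of varying points; f3 and f4 rest on
    this. *)
Lemma accumulation_set0 f X (c : R) (N : nat) : 0 < c ->
  (forall x n, X x -> 2 ^+ n * c <= cmod (iter (n + N) (skew_map f) x).2) ->
  accumulation f X = set0.
Proof.
move=> c0 H; apply/seteqP; split=> // y /accumulationP acc.
apply: (@doubling_unbounded _ (fun n => 2 ^+ n * c) c) => //.
exists (cmod y.2 + 1) => n.
have [m [x [nm Xx _ xy]]] := acc (n + N)%N 1 ltr01.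
have := H x (m - N)%N Xx; rewrite subnK; last exact: leq_trans (leq_addl _ _) nm.
have := cmodD ((iter m (skew_map f) x).2 - y.2) y.2; rewrite subrK.
suff : 2 ^+ n * c <= 2 ^+ (m - N) * c by lra.
by rewrite ler_pM2r // ler_weXn2l ?ler1n //; lia.
Qed.

End Accumulation.

(** * The circle and accumulation sets *)

Section Circle.
Variable R : realType.
Implicit Types (x y z w : R[i]) (t s : R).

Definition cis t : R[i] := cos t +i* sin t.

Lemma cmod_cis t : cmod (cis t) = 1.
Proof. by rewrite /cmod /= cos2Dsin2 sqrtr1. Qed.

Lemma cisD s t : cis (s + t) = cis s * cis t.
Proof.
rewrite /cis cosD sinD; apply/eqP; rewrite eq_complex /=.
by rewrite eqxx /= addrC eqxx.
Qed.

Lemma cis0 : cis 0 = 1.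
Proof. by rewrite /cis cos0 sin0. Qed.

Lemma cisMn t n : cis (n%:R * t) = cis t ^+ n.
Proof.
elim: n => [|n IH]; first by rewrite mul0r cis0 expr0.
by rewrite -natr1 mulrDl mul1r cisD IH exprSr.
Qed.

Lemma cis_surj z : cmod z = 1 -> exists2 t, `|t| <= pi & z = cis t.
Proof.
move=> z1; have := cmod_sqr z; rewrite z1 expr1n => zE.
have sI := sqr_ge0 (Im z).
have xB : -1 <= Re z <= 1 by apply/andP; split; nra.
have [/andP[a0 ap] ca] := acos_def xB.
have sa := sin_acos xB.
have sE : Num.sqrt (1 - Re z ^+ 2) = `|Im z|.
  by rewrite -sqrtr_sqr; congr Num.sqrt; lra.
have [i0|i0] := leP 0 (Im z).
  exists (acos (Re z)); first by rewrite ger0_norm.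
  by rewrite /cis ca sa sE ger0_norm //; case: (z).
exists (- acos (Re z)); first by rewrite normrN ger0_norm.
by rewrite /cis cosN sinN ca sa sE ltr0_norm // opprK; case: (z).
Qed.

Lemma cis_continuous t (e : R) : 0 < e -> exists2 r : R, 0 < r &
  forall s, `|s - t| < r -> cmod (cis s - cis t) < e.
Proof.
move=> e0; have e20 : 0 < e / 2 by rewrite divr_gt0.
have /cvgrPdist_lt /(_ _ e20) /nbhs_ballP[r1 /= r10 H1] := @continuous_cos R t.
have /cvgrPdist_lt /(_ _ e20) /nbhs_ballP[r2 /= r20 H2] := @continuous_sin R t.
exists (Num.min r1 r2); first by rewrite lt_min r10.
move=> s; rewrite lt_min => /andP[s1 s2].
apply: le_lt_trans (cmod_leReIm _) _; rewrite /cis /=.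
have := H1 s; have := H2 s; rewrite /ball /= ![`|t - s|]distrC => /(_ s2) + /(_ s1).
by rewrite [`|cos t - _|]distrC [`|sin t - _|]distrC; lra.
Qed.

Lemma circle_connected w :
  connected [set x : R[i] * R[i] | cmod x.1 = 1 /\ x.2 = w].
Proof.
have -> : [set x : R[i] * R[i] | cmod x.1 = 1 /\ x.2 = w] =
    (fun t => (cis t, w)) @` [set: R].
  apply/seteqP; split=> [[z v] /= [z1 ->]|_ [t _ <-]] /=.
    by have [t _ ->] := cis_surj z1; exists t.
  by rewrite cmod_cis.
apply: connected_continuous_connected; first exact/connected_intervalP.
apply: continuous_subspaceT => t A /nbhsc2P[e e0 eA].
have [r r0 Hr] := cis_continuous t e0.
apply/nbhs_ballP; exists r => // s; rewrite /ball /= distrC => st.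
by apply: eA; [exact: Hr|rewrite subrr cmod0].
Qed.

(** The witness is a root of unity of order dividing N = d^n - 1. If s is an angle of z^N with |s|
    <= pi, subtracting s/N from the angle t of z moves it by at most pi/N. *)
Lemma circle_periodic_dense d z (e : R) : (1 < d)%N -> cmod z = 1 -> 0 < e ->
  exists r n, [/\ cmod r = 1, (0 < n)%N, r ^+ (d ^ n) = r & cmod (r - z) < e].
Proof.
move=> d2 /cis_surj[t _ ->] e0.
have [r r0 Hr] := cis_continuous t e0.
pose n := (Num.bound (pi / r)).+1.
have dn : (n < d ^ n)%N by exact: ltn_expl.
pose N := (d ^ n).-1.
have N0 : (0 < N)%N by rewrite /N; lia.
have NR : (0 : R) < N%:R by rewrite ltr0n.
have rN : pi / r < N%:R.
  apply: lt_le_trans (archi_boundP _) _; first by rewrite divr_ge0 ?pi_ge0 // ltW.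
  by rewrite ler_nat /N; lia.
have [s sp sE] := cis_surj (cmod_cis (N%:R * t)).
pose u := t - s / N%:R.
have uN : cis u ^+ N = 1.
  rewrite -cisMn /u mulrBr cisD sE -cisD.
  have -> : N%:R * (s / N%:R) = s by field; rewrite gt_eqF.
  by rewrite subrr cis0.
exists (cis u), n; split=> //; first exact: cmod_cis.
  by rewrite -[(d ^ n)%N]prednK ?exprSr -/N ?uN ?mul1r //; lia.
apply: Hr; rewrite /u addrAC subrr add0r normrN normrM normfV normr_nat.
rewrite ltr_pdivrMr // mulrC; apply: le_lt_trans sp _.
by rewrite -ltr_pdivrMr.
Qed.

Lemma bounded_cluster (w : nat -> R[i]) (B : R) : (forall n, cmod (w n) <= B) ->
  exists v, forall N (e : R), 0 < e ->
    exists2 n, (N <= n)%N & cmod (w n - v) < e.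
Proof.
move=> wB; pose u n : R * R := (Re (w n), Im (w n)).
have := compact_setX (@segment_compact R (- B) B) (@segment_compact R (- B) B).
move=> /(_ (u @ \oo) _)[|[a b] [_ clu]].
  exists 0%N => // n _; split; rewrite /= in_itv /= -ler_norml.
    exact: le_trans (cmod_geRe _) (wB n).
  exact: le_trans (cmod_geIm _) (wB n).
exists (a +i* b) => N e e0; have e20 : 0 < e / 2 by rewrite divr_gt0.
have [||_ [[n /= Nn <-] [ua ub]]] := clu (u @` [set n | (N <= n)%N])
    [set x | ball a (e / 2) x.1 /\ ball b (e / 2) x.2].
- by exists N => // n /= Nn; exists n.
- by exists (ball a (e / 2), ball b (e / 2)) => //=; split; exact: nbhsx_ballx.
exists n => //; apply: le_lt_trans (cmod_leReIm _) _.
move: ua ub; rewrite /ball /= => ua ub.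
rewrite [`|complex.Re _|](_ : _ = `|a - Re (w n)|); last first.
  by rewrite distrC; case: (w n).
rewrite [`|complex.Im _|](_ : _ = `|b - Im (w n)|); last first.
  by rewrite distrC; case: (w n).
by lra.
Qed.

(** Captures limits of transient points: the starting point may vary with n, provided that the n-th
    iterates lie in one fiber at bounded height. *)
Lemma accumulation_cluster d (f : coefs R d) (X : set (R[i] * R[i])) y (B : R) :
  (forall n, exists2 x : R[i] * R[i], X x & (iter n (skew_map f) x).1 = y /\
                              cmod (iter n (skew_map f) x).2 <= B) ->
  exists w, accumulation f X (y, w).
Proof.
move=> H.
have /choice[x xH] : forall n, exists x : R[i] * R[i], X x /\
    (iter n (skew_map f) x).1 = y /\ cmod (iter n (skew_map f) x).2 <= B.
  by move=> n; have [x] := H n; exists x.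
have [|w Hw] := @bounded_cluster (fun n => (iter n (skew_map f) (x n)).2) B.
  by move=> n; have [_ []] := xH n.
exists w; apply/accumulationP => N e e0.
have [n Nn wn] := Hw N e e0; have [Xx [xy _]] := xH n.
by exists n, (x n); split=> //=; rewrite xy subrr cmod0.
Qed.

Lemma accumulation_periodic d (f : coefs R d) (X : set (R[i] * R[i])) (x : R[i] * R[i]) n : X x -> (0 < n)%N ->
  iter n (skew_map f) x = x -> accumulation f X x.
Proof.
move=> Xx n0 fx; apply/accumulationP => N e e0.
exists (N * n)%N, x; split=> //; first by rewrite leq_pmulr.
  have -> : iter (N * n) (skew_map f) x = x.
    by elim: N => //= N IH; rewrite mulSn iterD IH.
  by rewrite subrr cmod0.
have -> : iter (N * n) (skew_map f) x = x.
  by elim: N => //= N IH; rewrite mulSn iterD IH.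
by rewrite subrr cmod0.
Qed.

Lemma closure_point (X : set (R[i] * R[i])) (x : R[i] * R[i]) :
  X `<=` [set x] -> closure X `<=` [set x].
Proof.
move=> Xx [y1 y2] /closurec2P cl.
have cl0 z z' : (forall e : R, 0 < e -> cmod (z - z') < e) -> z = z'.
  move=> H; apply/eqP; rewrite -subr_eq0 -cmod_eq0; apply/eqP.
  apply/eqP; rewrite eq_le cmod_ge0 andbT leNgt; apply/negP => /H.
  by rewrite ltxx.
case: x Xx cl => x1 x2 Xx cl /=.
by congr pair; apply/esym/cl0 => e /cl[y [/Xx -> h1 h2]].
Qed.

Lemma accumulation_fixed d (f : coefs R d) (x : R[i] * R[i]) : skew_map f x = x ->
  accumulation f [set x] `<=` [set x].
Proof.
move=> fx y /(_ 0%N I); apply: closure_point => _ [n _ [_ -> <-]].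
exact: iter_fixed.
Qed.

(** This avoids a separate study of the line at infinity: in every example its polynomial equals the
    fiber polynomial over some fixed point of the base. *)
Lemma axiomA_P2I d (f : coefs R d) a : axiomA f -> (base f).[a] = a ->
  infinity_poly f = fiber f a -> axiomA_P2 f.
Proof. by move=> Af fa fE; split=> //; rewrite fE; apply: axiomA_fixed_hyperbolic. Qed.

Lemma vertically_expandingS d (f : coefs R d) (Y Z : set R[i]) : Y `<=` Z ->
  vertically_expanding f Z -> vertically_expanding f Y.
Proof.
move=> YZ [c [L [c0 L1 H]]]; exists c, L; split=> // z w n /YZ; exact: H.
Qed.

Lemma bounded_alongS d (f : coefs R d) z w : bounded_along (fiber_seq f z) w ->
  bounded_along (fiber_seq f (base f).[z]) (fiber f z).[w].
Proof.
move=> /(bounded_along_shift 1); rewrite poly_comp_seqS poly_comp_seq0.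
suff -> : (fun k => fiber_seq f z (k + 1)%N) = fiber_seq f (base f).[z] by [].
by apply/funext => n; rewrite /fiber_seq addn1 iterSr.
Qed.

Lemma fiber_seq_fixed d (f : coefs R d) a : (base f).[a] = a ->
  fiber_seq f a = fun=> fiber f a.
Proof. by move=> fa; apply/funext => n; rewrite /fiber_seq iter_fixed. Qed.

Lemma filled_julia_fixed d (f : coefs R d) a : (base f).[a] = a ->
  filled_julia (fiber f a) = bounded_along (fiber_seq f a).
Proof. by move=> fa; rewrite fiber_seq_fixed // bounded_along_const. Qed.

End Circle.

(** * Quadratic skew products and the first example *)

Section Quadratic.
Variable R : realType.
Implicit Types (x y z w : R[i]).

(* p(z) = z^2 + b z  and  q(z, w) = w^2 + c0 + c1 z + c2 z^2 *)
Definition quad (b c0 c1 c2 : R[i]) : coefs R 2 :=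
  (\row_(i < 3) [:: 0; b; 1]`_i,
   \matrix_(i < 3, j < 3) [:: [:: c0; c1; c2]`_i; 0; (i == 0 :> nat)%:R]`_j).

Variables b c0 c1 c2 : R[i].
Let f := quad b c0 c1 c2.
Let c z := c0 + c1 * z + c2 * z ^+ 2.

Lemma base_quad : base f = 'X^2 + b *: 'X.
Proof.
apply/polyP => i; have [i3|i3] := ltnP i 3; last first.
  rewrite nth_default ?(leq_trans (size_rVpoly_le _)) //.
  by case: i i3 => [|[|[|i]]] // _; rewrite coefD coefXn coefZ coefX mulr0 addr0.
rewrite (coef_base f (Ordinal i3)) mxE /= coefD coefXn coefZ coefX.
by case: i i3 => [|[|[|i]]] //= _; rewrite ?mulr0 ?mulr1 ?addr0 ?add0r.
Qed.

Lemma horner_base_quad z : (base f).[z] = z ^+ 2 + b * z.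
Proof. by rewrite base_quad hornerD hornerXn hornerZ hornerX. Qed.

Lemma fiber_quad z : fiber f z = 'X^2 + (c z)%:P.
Proof.
apply/polyP => i; have [i3|i3] := ltnP i 3; last first.
  rewrite nth_default ?(leq_trans (size_fiber_le _ _)) //.
  by case: i i3 => [|[|[|i]]] // _; rewrite coefD coefXn coefC addr0.
rewrite (coef_fiber f z (Ordinal i3)) (horner_coef_wide _ (size_rVpoly_le _)).
under eq_bigr do rewrite (coef_fiber_coef f _ (Ordinal i3)) mxE.
rewrite coefD coefXn coefC !big_ord_recl big_ord0 /= addr0.
by case: i i3 => [|[|[|i]]] //= _; rewrite /c ?expr0; ring.
Qed.

Lemma deriv_fiber_quad z w : (fiber f z)^`().[w] = 2 * w.
Proof.
by rewrite fiber_quad derivD derivC addr0 derivXn expr1 hornerMn hornerX mulr_natl.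
Qed.

Lemma skew_quad : skew_product f.
Proof.
split=> //.
- move=> [i i3] [j j3]; rewrite mxE /=.
  case: j j3 => [|[|[|j]]] //= _; case: i i3 => [|[|[|i]]] //= _.
- move=> z w t; rewrite /hom_base /hom_fiber !big_ord_recl !big_ord0.
  do 3 rewrite big_mkcond !big_ord_recl big_ord0 /=.
  rewrite !mxE /= => h1 h2 /eqP; rewrite expf_eq0 /= => /eqP t0.
  move: h1 h2; rewrite {}t0.
  rewrite /bump /= !addn0 !add1n !subn0 !subSS !subn0 !expr0n /=.
  rewrite !expr0 !mul0r !mul1r ?mulr0 ?mulr1 !addr0 ?add0r.
  move=> /eqP; rewrite expf_eq0 /= => /eqP ->.
  rewrite ?expr0n /= ?expr0 ?mulr0 ?mulr1 ?mul0r ?mul1r ?addr0 ?add0r.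
  by move=> /eqP; rewrite expf_eq0 /= => /eqP ->.
Qed.

Lemma infinity_quad : infinity_poly f = 'X^2 + c2%:P.
Proof.
rewrite /infinity_poly !big_ord_recl big_ord0 !mxE /= /bump /= !addn0 !add1n.
by rewrite !divr1 expr0 scale0r scale1r add0r addr0 addrC alg_polyC.
Qed.

Lemma fiber_seq_quad z w n : (poly_comp_seq (fiber_seq f z) n.+1).[w] =
  (poly_comp_seq (fiber_seq f z) n).[w] ^+ 2 + c (iter n (horner (base f)) z).
Proof. by rewrite poly_comp_seqS /fiber_seq fiber_quad hornerD hornerXn hornerC. Qed.

Lemma skew_map_quad z w : skew_map f (z, w) = (z ^+ 2 + b * z, w ^+ 2 + c z).
Proof.
by rewrite /skew_map /= horner_base_quad fiber_quad hornerD hornerXn hornerC.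
Qed.

Lemma critical_quad z w :
  critical_locus f (z, w) <-> julia (base f) z /\ w = 0.
Proof.
rewrite /critical_locus /= deriv_fiber_quad; split=> -[zJ w0]; split=> //.
  by move/eqP: w0; rewrite mulf_eq0 pnatr_eq0 /= => /eqP.
by rewrite w0 mulr0.
Qed.

End Quadratic.

(** * Escape and trapping for the recursion u' = u^2 + v *)

Section QuadraticOrbits.
Variable R : realType.
Implicit Types (u v : nat -> R[i]) (s : nat -> R).

(** If |u| >= 3 and |v| <= s <= |u|^2 / 3, then |u^2 + v| >= 2/3 |u|^2 >= 2 |u|. Thus |u|^2 grows at
    least by the factor 4, as fast as [s] may grow, and the hypotheses reproduce themselves. *)
Lemma quad_escape u v s N : (forall n, u n.+1 = u n ^+ 2 + v n) ->
  (forall n, cmod (v n) <= s n) -> (forall n, s n.+1 <= 4 * s n) ->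
  3 <= cmod (u N) -> 3 * s N <= cmod (u N) ^+ 2 ->
  forall n, 2 ^+ n * 3 <= cmod (u (n + N)%N).
Proof.
move=> uS vs sS u3 us n.
suff [_ _] : [/\ 3 <= cmod (u (n + N)%N),
    3 * s (n + N)%N <= cmod (u (n + N)%N) ^+ 2 &
    2 ^+ n * 3 <= cmod (u (n + N)%N)] by [].
elim: n => [|n [IH1 IH2 IH3]]; first by rewrite add0n expr0 mul1r.
rewrite addSn; have := vs (n + N)%N; have := sS (n + N)%N; rewrite uS.
have := cmod_geB (u (n + N)%N ^+ 2) (v (n + N)%N).
rewrite cmodX [2 ^+ n.+1]exprS.
move: (cmod (_ + _)) (cmod (v _)) (s _.+1) (s (n + N)%N) (cmod (u _)) (2 ^+ n)
  IH1 IH2 IH3 => a b s1 s0 x t x3 xs xt ax s10 bs.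
have x0 : 0 <= x by lra.
have xx : 3 * x <= x ^+ 2 by rewrite expr2 ler_wpM2r.
have x2 : 2 * x <= a by lra.
have xa : (2 * x) ^+ 2 <= a ^+ 2 by rewrite lerXn2r ?nnegrE //; lra.
by rewrite exprMn in xa; split; lra.
Qed.

(** The disc is preserved because r^2 + (r - r^2) = r. The statement stops at time [N] since in f3
    and f4 the additive terms may be small for a limited time only. *)
Lemma quad_trap u v (r : R) N : (forall n, u n.+1 = u n ^+ 2 + v n) ->
  (forall n, (n < N)%N -> cmod (v n) <= r - r ^+ 2) -> cmod (u 0%N) <= r ->
  forall n, (n <= N)%N -> cmod (u n) <= r.
Proof.
move=> uS vr u0; elim=> // n IH nN; rewrite uS.
apply: le_trans (cmodD _ _) _; rewrite cmodX.
have u2 : cmod (u n) ^+ 2 <= r ^+ 2.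
  by rewrite lerXn2r ?nnegrE ?IH 1?ltnW ?cmod_ge0 // (le_trans _ u0) ?cmod_ge0.
by have := vr n nN; lra.
Qed.

End QuadraticOrbits.

(** * The first example *)

Section Example1.
Variable R : realType.
Implicit Types (x y z w : R[i]).

Let f1 : coefs R 2 := quad 0 0 10 0.

Let c1E z : (0 + 10 * z + 0 * z ^+ 2 : R[i]) = 10 * z.
Proof. by ring. Qed.

Lemma example1_base : base f1 = 'X^2.
Proof. by rewrite base_quad scale0r addr0. Qed.

Let orbit z n : iter n (horner (base f1)) z = z ^+ (2 ^ n).
Proof. by rewrite example1_base iter_Xn. Qed.

Let cmod10 z : cmod (10 * z) = 10 * cmod z.
Proof. by rewrite cmodM cmod_nat. Qed.

Let step z w n : (poly_comp_seq (fiber_seq f1 z) n.+1).[w] =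
  (poly_comp_seq (fiber_seq f1 z) n).[w] ^+ 2 + 10 * z ^+ (2 ^ n).
Proof. by rewrite fiber_seq_quad c1E orbit. Qed.

(** The threshold 6 is admissible because 3 * 10 <= 6^2. *)
Lemma example1_escape z w N : cmod z = 1 ->
  6 <= cmod (poly_comp_seq (fiber_seq f1 z) N).[w] ->
  forall n, 2 ^+ n * 3 <= cmod (poly_comp_seq (fiber_seq f1 z) (n + N)).[w].
Proof.
move=> z1 w6.
apply: (@quad_escape _ (fun n => (poly_comp_seq (fiber_seq f1 z) n).[w])
  (fun n => 10 * z ^+ (2 ^ n)) (fun=> 10)).
- by move=> n; rewrite step.
- by move=> n; rewrite cmod10 cmodX z1 expr1n mulr1.
- by move=> _; lra.
- by lra.
- by nra.
Qed.

Lemma example1_bound z w : cmod z = 1 -> bounded_along (fiber_seq f1 z) w ->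
  cmod w <= 6.
Proof.
move=> z1 wK; rewrite leNgt; apply/negP => w6; move: wK.
apply: (@unbounded_of_doubling _ _ _ 3 0); first by [].
by apply: example1_escape => //; rewrite poly_comp_seq0 ltW.
Qed.

Lemma example1_axiomA : axiomA f1.
Proof.
have K1 z : cmod z <= 1 -> filled_julia (base f1) z.
  by rewrite example1_base => z1; apply/filled_julia_Xn.
split.
- exact: skew_quad.
- by rewrite example1_base; apply: hyperbolic_Xn.
- rewrite example1_base; have -> : julia 'X^2 = [set z : R[i] | cmod z = 1].
    by apply/seteqP; split=> z; rewrite (julia_Xn (isT : (1 < 2)%N)).
  apply: (@vertically_expandingI _ _ _ _ 6 2); first by lra.
  + by move=> z /= z1; apply: K1; rewrite z1.
  + by move=> z /= z1; rewrite example1_base hornerXn cmodX z1 expr1n.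
  + by move=> z w; apply: example1_bound.
  + move=> z w /= z1 wK _; rewrite deriv_fiber_quad cmodM cmod_nat.
    (* The image of w has a bounded orbit too, so |w^2 + 10 z| <= 6, which forces |w| >= 2. *)
    have pz1 : cmod (base f1).[z] = 1.
      by rewrite example1_base hornerXn cmodX z1 expr1n.
    have := example1_bound pz1 (bounded_alongS wK).
    rewrite fiber_quad c1E hornerD hornerXn hornerC.
    have := cmod_geB (10 * z) (w ^+ 2); rewrite [10 * z + _]addrC cmod10 z1 cmodX.
    by have := cmod_ge0 w; nra.
- apply: (@vertically_expandingS _ _ _ _ [set 0]).
    by move=> z; rewrite example1_base => /(attracting_periodic_Xn (isT : (1 < 2)%N)).
  have base0 : (base f1).[0] = 0 by rewrite example1_base hornerXn expr0n.
  have fiber0 : fiber f1 0 = 'X^2 by rewrite fiber_quad c1E mulr0 addr0.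
  have K0 : bounded_along (fiber_seq f1 0) = filled_julia 'X^2.
    by rewrite -filled_julia_fixed // fiber0.
  apply: (@vertically_expandingI _ _ _ _ 1 2); first by lra.
  + by move=> z ->; apply: K1; rewrite cmod0.
  + by move=> z ->.
  + by move=> z w ->; rewrite K0 => /(filled_julia_Xn (isT : (1 < 2)%N)).
  + move=> z w -> + wint; rewrite K0 in wint * => wK.
    have /(julia_Xn (isT : (1 < 2)%N)) w1 : julia 'X^2 w.
      by split=> //; apply: subset_closure.
    by rewrite deriv_fiber_quad cmodM cmod_nat w1 mulr1.
Qed.

Lemma example1 : exists f : coefs R 2,
  [/\ axiomA f, axiomA_P2 f, mixed f & A_crit f = set0].
Proof.
have base0 : (base f1).[0] = 0 by rewrite example1_base hornerXn expr0n.
have base1 : (base f1).[1] = 1 by rewrite example1_base hornerXn expr1n.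
have cr1 : cmod (1 : R[i]) = 1 by rewrite cmod1.
have escape z n : cmod z = 1 ->
    2 ^+ n * 3 <= cmod (poly_comp_seq (fiber_seq f1 z) (n + 1)).[0].
  move=> z1; apply: example1_escape => //.
  rewrite step poly_comp_seq0 expr0n add0r expn0 expr1 cmod10 z1; lra.
exists f1; split.
- exact: example1_axiomA.
- apply: (axiomA_P2I example1_axiomA base0).
  by rewrite infinity_quad fiber_quad c1E mulr0.
- exists 0, 1; split=> //.
    move=> w; rewrite deriv_fiber_quad => /eqP.
    rewrite mulf_eq0 pnatr_eq0 /= => /eqP ->.
    rewrite fiber_quad c1E mulr0 addr0; apply/filled_julia_Xn => //.
    by rewrite cmod0.
  move=> /(_ 0); rewrite deriv_fiber_quad mulr0 => /(_ erefl).
  rewrite filled_julia_fixed //; apply: (@unbounded_of_doubling _ _ _ 3 1) => // n.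
  exact: escape.
- apply: (@accumulation_set0 _ _ _ _ 3 1) => // -[z w] n.
  rewrite critical_quad example1_base => -[zJ ->].
  rewrite iter_skew_map2; apply: escape.
  by move: zJ; rewrite julia_Xn.
Qed.

End Example1.

(** * The second example *)

Section Example2.
Variable R : realType.
Implicit Types (x y z w : R[i]).

(* p(z) = z^3  and  q(z, w) = w^3 + 10 z w^2 *)
Let f2 : coefs R 3 :=
  (\row_(i < 4) (i == 3 :> nat)%:R,
   \matrix_(i < 4, j < 4)
     [:: 0; 0; 10 * (i == 1 :> nat)%:R; (i == 0 :> nat)%:R]`_j).

Lemma example2_base : base f2 = 'X^3.
Proof.
apply/polyP => i; rewrite coefXn; have [i4|i4] := ltnP i 4; last first.
  rewrite nth_default ?(leq_trans (size_rVpoly_le _)) //.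
  by case: i i4 => [|[|[|[|i]]]].
by rewrite (coef_base f2 (Ordinal i4)) mxE.
Qed.

Lemma example2_fiber z : fiber f2 z = 'X^3 + (10 * z) *: 'X^2.
Proof.
apply/polyP => i; have [i4|i4] := ltnP i 4; last first.
  rewrite nth_default ?(leq_trans (size_fiber_le _ _)) //.
  by case: i i4 => [|[|[|[|i]]]] // _; rewrite coefD coefZ !coefXn mulr0 addr0.
rewrite (coef_fiber f2 z (Ordinal i4)) (horner_coef_wide _ (size_rVpoly_le _)).
under eq_bigr do rewrite (coef_fiber_coef f2 _ (Ordinal i4)) mxE.
rewrite coefD coefZ !coefXn !big_ord_recl big_ord0 /= addr0.
by case: i i4 => [|[|[|[|i]]]] //= _; rewrite ?expr0; ring.
Qed.

Lemma example2_horner z w : (fiber f2 z).[w] = w ^+ 2 * (w + 10 * z).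
Proof. by rewrite example2_fiber hornerD hornerZ !hornerXn; ring. Qed.

Lemma example2_deriv z w : (fiber f2 z)^`().[w] = w * (3 * w + 20 * z).
Proof.
rewrite example2_fiber derivD derivZ !derivXn hornerD hornerZ !hornerMn !hornerXn.
by rewrite /= expr1; ring.
Qed.

Lemma example2_skew : skew_product f2.
Proof.
split=> //.
- move=> [i i4] [j j4]; rewrite mxE /=.
  by case: j j4 => [|[|[|[|j]]]] //= _; case: i i4 => [|[|[|[|i]]]] //= _ _;
    rewrite ?mulr0.
- move=> z w t; rewrite /hom_base /hom_fiber !big_ord_recl !big_ord0.
  do 4 rewrite big_mkcond !big_ord_recl big_ord0 /=.
  rewrite !mxE /= => h1 h2 /eqP; rewrite expf_eq0 /= => /eqP t0.
  move: h1 h2; rewrite {}t0.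
  rewrite /bump /= !addn0 !add1n !subn0 !subSS !subn0 !expr0n /=.
  rewrite !expr0 ?mul0r ?mul1r ?mulr0 ?mulr1 ?addr0 ?add0r.
  move=> /eqP; rewrite expf_eq0 /= => /eqP ->.
  rewrite ?expr0n /= ?expr0 ?mulr0 ?mulr1 ?mul0r ?mul1r ?mulr0 ?mul0r ?addr0 ?add0r.
  by move=> /eqP; rewrite expf_eq0 /= => /eqP ->.
Qed.

Lemma example2_infinity : infinity_poly f2 = fiber f2 1.
Proof.
rewrite /infinity_poly !big_ord_recl big_ord0 !mxE /= /bump /= !addn0 !add1n.
rewrite example2_fiber !divr1 expr0 !scale0r scale1r !add0r addr0 addrC.
by [].
Qed.

Let orbit z n : iter n (horner (base f2)) z = z ^+ (3 ^ n).
Proof. by rewrite example2_base iter_Xn. Qed.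

Let circle_orbit z n : cmod z = 1 -> cmod (z ^+ (3 ^ n)) = 1.
Proof. by move=> z1; rewrite cmodX z1 expr1n. Qed.

Let step z w n : (poly_comp_seq (fiber_seq f2 z) n.+1).[w] =
  (poly_comp_seq (fiber_seq f2 z) n).[w] ^+ 2 *
    ((poly_comp_seq (fiber_seq f2 z) n).[w] + 10 * z ^+ (3 ^ n)).
Proof. by rewrite poly_comp_seqS /fiber_seq example2_horner orbit. Qed.

Let cmod10 z : cmod z = 1 -> cmod (10 * z) = 10.
Proof. by move=> z1; rewrite cmodM (cmod_nat R 10) z1 mulr1. Qed.

(** From |w| >= 12 on, the factor w + 10 z has modulus at least 2. *)
Lemma example2_escape z w N : cmod z = 1 ->
  12 <= cmod (poly_comp_seq (fiber_seq f2 z) N).[w] ->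
  forall n, 2 ^+ n * 12 <= cmod (poly_comp_seq (fiber_seq f2 z) (n + N)).[w].
Proof.
move=> z1 w12 n.
pose u n := cmod (poly_comp_seq (fiber_seq f2 z) (n + N)).[w].
have uS k : 12 <= u k -> 2 * u k <= u k.+1.
  rewrite /u addSn step cmodM cmodX; move: (_.[w]) => v v12.
  have := cmod_geB v (10 * z ^+ (3 ^ (k + N))); rewrite cmod10 ?circle_orbit //.
  move: (cmod (v + _)) (cmod v) v12 => b t t12 tb.
  have h1 : 0 <= t * (t - 12) by rewrite mulr_ge0; lra.
  have h2 : 0 <= t ^+ 2 * (b - 2) by rewrite mulr_ge0 ?sqr_ge0 //; lra.
  by lra.
have M0 : (0 : R) <= 12 by [].
have [_] := doubling_ge M0 w12 uS n; apply: le_trans.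
by rewrite ler_wpM2l // exprn_ge0.
Qed.

Lemma example2_bound z w : cmod z = 1 -> bounded_along (fiber_seq f2 z) w ->
  cmod w <= 12.
Proof.
move=> z1 wK; rewrite leNgt; apply/negP => w12; move: wK.
apply: (@unbounded_of_doubling _ _ _ 12 0); first by [].
by apply: example2_escape => //; rewrite poly_comp_seq0 ltW.
Qed.

(** The radius is slightly below 1/10, the solution of 10 r^2 = r; the slack absorbs the cubic
    term. *)
Lemma example2_trap z w n : cmod z = 1 -> cmod w <= 9 / 100 ->
  cmod (poly_comp_seq (fiber_seq f2 z) n).[w] <= 9 / 100.
Proof.
move=> z1 w9; elim: n => [|n IH]; first by rewrite poly_comp_seq0.
rewrite step cmodM cmodX; move: (_.[w]) IH => v v9.
have := cmodD v (10 * z ^+ (3 ^ n)); rewrite cmod10 ?circle_orbit //.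
have := cmod_ge0 v; have := cmod_ge0 (v + 10 * z ^+ (3 ^ n)).
move: (cmod (v + _)) (cmod v) v9 => b t t9 b0 t0 bt.
have h1 : t ^+ 2 <= (9 / 100) ^+ 2 by rewrite lerXn2r ?nnegrE //; lra.
have h2 : t ^+ 2 * b <= (9 / 100) ^+ 2 * (9 / 100 + 10).
  by apply: ler_pM => //; [exact: sqr_ge0|lra].
by lra.
Qed.

(** The lower bound on |w| keeps away from the critical point 0, the bound on the image from the
    other one, -20 z / 3. If |w| > 3/2, the image bound gives |w + 10 z| <= 16/3, hence |w| >= 14/3;
    used again, it gives |w + 10 z| <= 12/21, so that w is close to -10 z, where the derivative is
    large. *)
Lemma example2_expands z w : cmod z = 1 -> 9 / 100 <= cmod w ->
  cmod w ^+ 2 * cmod (w + 10 * z) <= 12 ->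
  13 / 10 <= cmod w * cmod (3 * w + 20 * z).
Proof.
move=> z1 w9 q12.
have D1 : 20 - 3 * cmod w <= cmod (3 * w + 20 * z).
  have := cmod_geB (20 * z) (3 * w).
  by rewrite [20 * z + _]addrC !cmodM (cmod_nat R 20) (cmod_nat R 3) z1 mulr1.
have D2 : 10 - 3 * cmod (w + 10 * z) <= cmod (3 * w + 20 * z).
  have := cmod_geB (- (10 * z)) (3 * (w + 10 * z)); rewrite cmodN cmod10 //.
  have -> : - (10 * z) + 3 * (w + 10 * z) = 3 * w + 20 * z by ring.
  by rewrite cmodM (cmod_nat R 3).
have D3 : 10 - cmod (w + 10 * z) <= cmod w.
  have := cmod_geB (10 * z) (- (w + 10 * z)); rewrite cmod10 // cmodN.
  have -> : 10 * z - (w + 10 * z) = - w by ring.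
  by rewrite cmodN.
have := cmod_ge0 (w + 10 * z).
move: (cmod w) (cmod (3 * w + _)) (cmod (w + _)) w9 q12 D1 D2 D3 => t D b.
move=> t9 q12 D1 D2 D3 b0.
have [t1|t1] := leP t (3 / 2).
  have h : 0 <= (t - 9 / 100) * (3 / 2 - t) by rewrite mulr_ge0 //; lra.
  have h2 : 0 <= t * (D - 20 + 3 * t) by rewrite mulr_ge0 //; lra.
  by nra.
have b1 : b <= 16 / 3.
  have h : 0 <= (t ^+ 2 - (3 / 2) ^+ 2) * b.
    by rewrite mulr_ge0 // subr_ge0 lerXn2r ?nnegrE //; lra.
  by lra.
have t2 : 14 / 3 <= t by lra.
have b2 : b <= 12 / 21.
  have h : 0 <= (t ^+ 2 - (14 / 3) ^+ 2) * b.
    by rewrite mulr_ge0 // subr_ge0 lerXn2r ?nnegrE //; lra.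
  by lra.
have h : 0 <= (t - 1) * (D - 8) by rewrite mulr_ge0 //; lra.
by lra.
Qed.

Let base0 : (base f2).[0] = 0.
Proof. by rewrite example2_base hornerXn expr0n. Qed.

Let base1 : (base f2).[1] = 1.
Proof. by rewrite example2_base hornerXn expr1n. Qed.

Let fiber0 : fiber f2 0 = 'X^3.
Proof. by rewrite example2_fiber mulr0 scale0r addr0. Qed.

Lemma example2_axiomA : axiomA f2.
Proof.
have K1 z : cmod z <= 1 -> filled_julia (base f2) z.
  by rewrite example2_base => z1; apply/filled_julia_Xn.
split.
- exact: example2_skew.
- by rewrite example2_base; apply: hyperbolic_Xn.
- rewrite example2_base; have -> : julia 'X^3 = [set z : R[i] | cmod z = 1].
    by apply/seteqP; split=> z; rewrite (julia_Xn (isT : (1 < 3)%N)).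
  apply: (@vertically_expandingI _ _ _ _ 12 (13 / 10)); first by lra.
  + by move=> z /= z1; apply: K1; rewrite z1.
  + by move=> z /= z1; rewrite example2_base hornerXn cmodX z1 expr1n.
  + by move=> z w; apply: example2_bound.
  + move=> z w /= z1 wK wint; rewrite example2_deriv cmodM.
    have pz1 : cmod (base f2).[z] = 1.
      by rewrite example2_base hornerXn cmodX z1 expr1n.
    apply: example2_expands => //.
      rewrite leNgt; apply/negP => w9; apply: wint; apply/interiorcP.
      exists (9 / 100 - cmod w); first by lra.
      move=> y yw; exists (9 / 100) => n; apply: example2_trap => //.
      by have := cmodD (y - w) w; rewrite subrK; lra.
    by have := example2_bound pz1 (bounded_alongS wK); rewrite example2_horner cmodM cmodX.
- apply: (@vertically_expandingS _ _ _ _ [set 0]).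
    by move=> z; rewrite example2_base => /(attracting_periodic_Xn (isT : (1 < 3)%N)).
  have K0 : bounded_along (fiber_seq f2 0) = filled_julia 'X^3.
    by rewrite -filled_julia_fixed // fiber0.
  apply: (@vertically_expandingI _ _ _ _ 1 3); first by lra.
  + by move=> z ->; apply: K1; rewrite cmod0.
  + by move=> z ->.
  + by move=> z w ->; rewrite K0 => /(filled_julia_Xn (isT : (1 < 3)%N)).
  + move=> z w -> + wint; rewrite K0 in wint * => wK.
    have /(julia_Xn (isT : (1 < 3)%N)) w1 : julia 'X^3 w.
      by split=> //; apply: subset_closure.
    by rewrite example2_deriv mulr0 addr0 !cmodM (cmod_nat R 3) w1 mulr1 mul1r.
Qed.

Lemma example2_critical z w : critical_locus f2 (z, w) <->
  cmod z = 1 /\ (w = 0 \/ w = - (20 / 3) * z).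
Proof.
rewrite /critical_locus /= example2_deriv example2_base julia_Xn //.
split=> -[z1 wE]; split=> //.
  move/eqP: wE; rewrite mulf_eq0 => /orP[/eqP|]; first by left.
  rewrite addr_eq0 => /eqP w3; right.
  have -> : w = 3 * w / 3 by field.
  by rewrite w3; field.
by case: wE => ->; [rewrite mul0r|field].
Qed.

Lemma example2_critical_escape z : cmod z = 1 -> forall n, 2 ^+ n * 12 <=
  cmod (poly_comp_seq (fiber_seq f2 z) (n + 1)).[- (20 / 3) * z].
Proof.
move=> z1; apply: example2_escape => //.
rewrite step poly_comp_seq0 expn0 expr1.
have -> : (- (20 / 3) * z) ^+ 2 * (- (20 / 3) * z + 10 * z) =
    (10 / 3) ^+ 3 * 4 * z ^+ 3 by field.
rewrite !(cmodM, cmodX) z1 expr1n mulr1 cmodV (cmod_nat R 10) (cmod_nat R 3).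
by rewrite (cmod_nat R 4); lra.
Qed.

Lemma example2_zero z n : (poly_comp_seq (fiber_seq f2 z) n).[0] = 0.
Proof.
by elim: n => [|n IH]; rewrite ?poly_comp_seq0 // step IH expr0n mul0r.
Qed.

Lemma example2_zero_periodic z n : z ^+ (3 ^ n) = z ->
  iter n (skew_map f2) (z, 0) = (z, 0).
Proof.
move=> zn; apply: injective_projections; first by rewrite iter_skew_map orbit.
by rewrite iter_skew_map2 example2_zero.
Qed.

(** The second critical point escapes at a rate independent of z, so late critical orbit points near
    a given point come from the invariant circle w = 0, which is closed. *)
Lemma example2_A_crit z w : A_crit f2 (z, w) -> cmod z = 1 /\ w = 0.
Proof.
move=> /accumulationP acc.
have near (e : R) : 0 < e -> exists z', [/\ cmod z' = 1, cmod (z' - z) < e & cmod w < e].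
  move=> e0.
  have [N HN] : exists N, cmod w + e < 2 ^+ N * 12.
    apply: contrapT => nex.
    apply: (@doubling_unbounded _ (fun n => 2 ^+ n * 12) 12) => //.
    exists (cmod w + e) => n; rewrite leNgt; apply/negP => h.
    by apply: nex; exists n.
  have [n [[z' w'] [Nn]]] := acc (N + 1)%N e e0.
  rewrite example2_critical iter_skew_map iter_skew_map2 orbit /= => -[z1 w'E] zn wn.
  exists (z' ^+ (3 ^ n)); split=> //; first exact: circle_orbit.
  case: w'E wn => ->; first by rewrite example2_zero sub0r cmodN.
  have := example2_critical_escape z1 (n - 1).
  rewrite subnK; last by rewrite (leq_trans _ Nn) // leq_addl.
  have : 2 ^+ N * 12 <= 2 ^+ (n - 1) * 12 :> R.
    by rewrite ler_wpM2r // ler_weXn2l ?ler1n //; lia.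
  move: (_.[_]) => v h1 h2 h3.
  by have := cmodD (v - w) w; rewrite subrK; lra.
split.
  apply/eqP; rewrite eq_le; apply/andP; split; rewrite leNgt; apply/negP => h.
    have e0 : 0 < cmod z - 1 by rewrite subr_gt0.
    have [z' [z1 zz' _]] := near _ e0.
    by have := cmodD (z - z') z'; rewrite subrK cmodB; lra.
  have e0 : 0 < 1 - cmod z by rewrite subr_gt0.
  have [z' [z1 zz' _]] := near _ e0.
  by have := cmodD (z' - z) z; rewrite subrK; lra.
apply/eqP; rewrite -cmod_eq0 eq_le cmod_ge0 andbT leNgt; apply/negP => w0.
by have [z' [_ _]] := near _ w0; rewrite ltxx.
Qed.

Lemma example2 : exists f : coefs R 3,
  [/\ axiomA f, axiomA_P2 f, mixed f &
      [/\ A_pt f = A_cc f, A_cc f = A_crit f & A_crit f <> set0]].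
Proof.
exists f2; split.
- exact: example2_axiomA.
- exact: (axiomA_P2I example2_axiomA base1 example2_infinity).
- exists 0, 1; split=> //.
    move=> w; rewrite example2_deriv mulr0 addr0 => /eqP.
    rewrite !mulf_eq0 pnatr_eq0 /= orbb => /eqP ->.
    by rewrite fiber0; apply/filled_julia_Xn => //; rewrite cmod0.
  have c1 : cmod (1 : R[i]) = 1 by rewrite cmod1.
  move=> /(_ (- (20 / 3) * 1)); rewrite example2_deriv => /(_ _).
  have -> : - (20 / 3) * 1 * (3 * (- (20 / 3) * 1) + 20 * 1) = 0 :> R[i] by field.
  move=> /(_ erefl); rewrite filled_julia_fixed //.
  apply: (@unbounded_of_doubling _ _ _ 12 1) => // n.
  exact: example2_critical_escape.
have crit0 z : cmod z = 1 -> critical_locus f2 (z, 0).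
  by move=> z1; apply/example2_critical; split=> //; left.
(* Periodic points of z^3 are dense in the circle and each lies in its own accumulation set, so the
   closure of the pointwise accumulation sets already contains the whole circle. *)
have A_sub : A_crit f2 `<=` A_pt f2.
  move=> [z w] /example2_A_crit[z1 ->]; apply/closurec2P => e e0.
  have [r [n [r1 n0 rn rz]]] := circle_periodic_dense (isT : (1 < 3)%N) z1 e0.
  exists (r, 0); split=> //=; last by rewrite subrr cmod0.
  exists (r, 0); first exact: crit0.
  by apply: (@accumulation_periodic _ _ _ _ _ n) => //; apply: example2_zero_periodic.
have ptcc := @A_pt_sub _ _ f2; have cccr := @A_cc_sub _ _ f2.
split.
- by apply/seteqP; split=> // y /cccr /A_sub.
- by apply/seteqP; split=> // y /A_sub /ptcc.
- move=> A0; have : A_crit f2 (1, 0); last by rewrite A0.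
  apply: (@accumulation_periodic _ _ _ _ _ 1) => //; first by apply/crit0/cmod1.
  by apply: example2_zero_periodic; rewrite expr1n.
Qed.

End Example2.

(** * The third example *)

Section Example3.
Variable R : realType.
Implicit Types (x y z w : R[i]).
Variable a : R.
Hypothesis a_big : 10 ^+ 7 <= a.

Let f3 : coefs R 2 := quad 0 (- a%:C) (2 * a%:C) (- a%:C).
Let s z : R := a * cmod (1 - z) ^+ 2.

Let a0 : 0 < a.
Proof. by have := a_big; lra. Qed.

Let cE z : - a%:C + 2 * a%:C * z + - a%:C * z ^+ 2 = - a%:C * (1 - z) ^+ 2.
Proof. by ring. Qed.

Let cmodc z : cmod (- a%:C * (1 - z) ^+ 2) = s z.
Proof. by rewrite cmodM cmodN cmodR gtr0_norm // cmodX. Qed.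

Let unit_sqr z : cmod z = 1 -> Re z ^+ 2 + Im z ^+ 2 = 1.
Proof. by move=> z1; rewrite -cmod_sqr z1 expr1n. Qed.

Let uE z : cmod z = 1 -> cmod (1 - z) ^+ 2 = 2 - 2 * Re z.
Proof.
move=> /unit_sqr; rewrite cmod_sqr; case: z => al be /= h.
by rewrite sub0r sqrrN; lra.
Qed.

(** On the unit circle -(1 - z)^2 = z (2 - z - 1/z) = z (2 - 2 Re z) = z |1 - z|^2. *)
Lemma example3_circle z : cmod z = 1 -> - a%:C * (1 - z) ^+ 2 = (s z)%:C * z.
Proof.
move=> z1; rewrite /s uE //; have := unit_sqr z1; case: z {z1} => al be /= h.
have h' : be ^+ 2 = 1 - al ^+ 2 by lra.
apply/eqP; rewrite eq_complex /= !mul0r ?subr0 ?addr0 ?oppr0.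
by apply/andP; split; apply/eqP; ring: h'.
Qed.

(** 1 - z^2 = (1 - z)(1 + z), and |1 + z|^2 + |1 - z|^2 = 4 on the circle. *)
Lemma example3_sS z : cmod z = 1 -> s (z ^+ 2) = s z * (4 - cmod (1 - z) ^+ 2).
Proof.
move=> z1; rewrite /s.
have -> : 1 - z ^+ 2 = (1 - z) * (1 + z) by ring.
rewrite cmodM exprMn mulrA; congr (_ * _).
rewrite uE //; have := unit_sqr z1; rewrite cmod_sqr; case: (z) => al be /= h.
by rewrite add0r; lra.
Qed.

Let s_ge0 z : 0 <= s z.
Proof. by rewrite mulr_ge0 ?sqr_ge0 // ltW. Qed.

Let sS4 z : cmod z = 1 -> s (z ^+ 2) <= 4 * s z.
Proof.
move=> z1; rewrite example3_sS //.
by have := mulr_ge0 (s_ge0 z) (sqr_ge0 (cmod (1 - z))); lra.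
Qed.

Lemma example3_base : base f3 = 'X^2.
Proof. by rewrite base_quad scale0r addr0. Qed.

Let orbit z n : iter n (horner (base f3)) z = z ^+ (2 ^ n).
Proof. by rewrite example3_base iter_Xn. Qed.

Let circle_orbit z n : cmod z = 1 -> cmod (z ^+ (2 ^ n)) = 1.
Proof. by move=> z1; rewrite cmodX z1 expr1n. Qed.

Let step z w n : (poly_comp_seq (fiber_seq f3 z) n.+1).[w] =
  (poly_comp_seq (fiber_seq f3 z) n).[w] ^+ 2
    + - a%:C * (1 - z ^+ (2 ^ n)) ^+ 2.
Proof. by rewrite fiber_seq_quad cE orbit. Qed.

Lemma example3_escape z w N : cmod z = 1 ->
  3 <= cmod (poly_comp_seq (fiber_seq f3 z) N).[w] ->
  3 * s (z ^+ (2 ^ N)) <= cmod (poly_comp_seq (fiber_seq f3 z) N).[w] ^+ 2 ->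
  forall n, 2 ^+ n * 3 <= cmod (poly_comp_seq (fiber_seq f3 z) (n + N)).[w].
Proof.
move=> z1.
apply: (@quad_escape _ (fun n => (poly_comp_seq (fiber_seq f3 z) n).[w])
  (fun n => - a%:C * (1 - z ^+ (2 ^ n)) ^+ 2) (fun n => s (z ^+ (2 ^ n)))).
- by move=> n; rewrite step.
- by move=> n; rewrite cmodc.
- by move=> n; rewrite expnSr exprM; apply/sS4/circle_orbit.
Qed.

(** For r = 51/100, r - r^2 equals 1/4 - 10^-4. A radius slightly above 1/2 makes 2 |w| exceed 1
    outside the disc while losing little of 1/4, the largest value of r - r^2. *)
Lemma example3_trap z w N : (forall n, (n < N)%N ->
    s (z ^+ (2 ^ n)) <= (1 / 4 - 1 / (100 * 100))) -> cmod w <= 51 / 100 ->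
  forall n, (n <= N)%N -> cmod (poly_comp_seq (fiber_seq f3 z) n).[w] <= 51 / 100.
Proof.
move=> zD w1.
apply: (@quad_trap _ _ (fun n => - a%:C * (1 - z ^+ (2 ^ n)) ^+ 2)).
- by move=> n; rewrite step.
- by move=> n /zD; rewrite cmodc; lra.
- by rewrite poly_comp_seq0.
Qed.

(* By [example3_circle] the additive term of the fiber map is [s z * z]: near
   [z = 1] it is almost the positive number [s], and [s] grows by a factor of
   almost 4 at each step. Once [s z > 1/4 - 10^-4], the point [w] therefore
   moves along a cone around the positive axis and is dominated by [s]: if
   [s z < 13], then four steps give [|w_4| >= 62 s z], while
   [s z_4 <= 256 s z], which is enough to escape. *)
Lemma example3_near1 z : cmod z = 1 -> s z <= 13 * 64 ->
  [/\ (4 - 1 / 100) * s z <= s (z ^+ 2), 99 / 100 <= Re z & `|Im z| <= 1 / 100].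
Proof.
move=> z1 sz; rewrite example3_sS //.
have u0 := sqr_ge0 (cmod (1 - z)).
have usmall : cmod (1 - z) ^+ 2 <= 1 / (100 * 100).
  rewrite leNgt; apply/negP => u1; move: sz; rewrite /s leNgt => /negP; apply.
  (* This is what [a_big] is made for: 10^7 * 10^-4 exceeds 13 * 64, a bound for [s] during the
     first four steps when it starts below 13. *)
  apply: (@lt_le_trans _ _ (10 ^+ 7 * (1 / (100 * 100)))); first by lra.
  by apply: ler_pM; [lra|lra|exact: a_big|exact: ltW].
have sz0 := s_ge0 z; have us := uE z1; have := unit_sqr z1 => zE.
split.
- by nra.
- by lra.
- have q0 : (0 : R) <= 1 / 100 by lra.
  rewrite -(ler_pXn2r (n := 2)) ?nnegrE ?normr_ge0 //.
  by rewrite real_normK ?num_real //; nra.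
Qed.

Lemma Re_sqr z : Re (z ^+ 2) = Re z ^+ 2 - Im z ^+ 2.
Proof. by rewrite !expr2; case: z. Qed.

Lemma Im_sqr z : Im (z ^+ 2) = 2 * (Re z * Im z).
Proof. by rewrite expr2; case: z => al be /=; ring. Qed.

Lemma example3_cone (X1 Y1 s0 s1 al be : R) : (1 / 4 - 1 / (100 * 100)) <= s0 -> s0 <= 13 ->
  `|Y1| <= (51 / 100) ^+ 2 + s0 / 100 -> (4 - 1 / 100) * s0 <= s1 -> 99 / 100 <= al ->
  `|be| <= 1 / 100 ->
  `|2 * (X1 * Y1) + s1 * be| <= 2 / 5 * (X1 ^+ 2 - Y1 ^+ 2 + s1 * al).
Proof.
move=> s0a s0b Y1s s01 al1.
rewrite !ler_norml => /andP[be1 be2].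
have s10 : 0 <= s1 by lra.
have YY : Y1 ^+ 2 <= ((51 / 100) ^+ 2 + s0 / 100) ^+ 2.
  by rewrite -[Y1 ^+ 2]real_normK ?num_real // lerXn2r ?nnegrE //; lra.
have h1 : 0 <= s1 * (al - 99 / 100) by rewrite mulr_ge0 //; lra.
have h2 : 0 <= s1 * (1 / 100 - be) by rewrite mulr_ge0 //; lra.
have h3 : 0 <= s1 * (be + 1 / 100) by rewrite mulr_ge0 //; lra.
have h4 := sqr_ge0 (2 * X1 - 5 * Y1).
have h5 := sqr_ge0 (2 * X1 + 5 * Y1).
have h6 : 0 <= s0 * (13 - s0) by rewrite mulr_ge0 //; lra.
by apply/andP; split; lra.
Qed.

(** Squaring doubles the argument, and a slope of 2/5 becomes (4/5) / (1 - 4/25) = 20/21 < 1. *)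
Lemma example3_diag (X Y t al be : R) : `|Y| <= 2 / 5 * X -> 0 <= t ->
  99 / 100 <= al -> `|be| <= 1 / 100 ->
  `|2 * (X * Y) + t * be| <= X ^+ 2 - Y ^+ 2 + t * al.
Proof.
rewrite !ler_norml => /andP[y1 y2] t0 al1 /andP[b1 b2].
have h1 : 0 <= t * (al - be) by rewrite mulr_ge0 //; lra.
have h2 : 0 <= t * (al + be) by rewrite mulr_ge0 //; lra.
have h3 : 0 <= (2 / 5 * X - Y) * (2 / 5 * X + Y) by rewrite mulr_ge0 //; lra.
have X0 : 0 <= X by lra.
have h4 : 0 <= X * (2 / 5 * X - Y) by rewrite mulr_ge0 //; lra.
have h5 : 0 <= X * (2 / 5 * X + Y) by rewrite mulr_ge0 //; lra.
have h6 := sqr_ge0 X.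
by apply/andP; split; lra.
Qed.

Lemma example3_core z w : cmod z = 1 -> (1 / 4 - 1 / (100 * 100)) < s z ->
  cmod w <= 51 / 100 -> exists M, forall n,
    2 ^+ n * 3 <= cmod (poly_comp_seq (fiber_seq f3 z) (n + M)).[w].
Proof.
move=> z1 sz w1.
have w2 : cmod (w ^+ 2) <= (51 / 100) ^+ 2.
  have : cmod w ^+ 2 <= (51 / 100) ^+ 2.
    by rewrite lerXn2r ?nnegrE ?cmod_ge0 //; lra.
  by rewrite cmodX; lra.
have step1 : (poly_comp_seq (fiber_seq f3 z) 1).[w] = w ^+ 2 + (s z)%:C * z.
  by rewrite step poly_comp_seq0 expn0 expr1 example3_circle.
(* From 13 on a single step is enough whatever its direction: |w_1| >= s - 0.2601, and (s -
   0.2601)^2 >= 12 s >= 3 s(z^2). *)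
have [s13|s13] := leP 13 (s z).
  have W1 : s z - (51 / 100) ^+ 2 <= cmod (poly_comp_seq (fiber_seq f3 z) 1).[w].
    rewrite step1; have := cmod_geB ((s z)%:C * z) (w ^+ 2).
    rewrite [(s z)%:C * z + _]addrC cmodM z1 mulr1 cmodR ger0_norm //.
    by lra.
  exists 1%N; apply: example3_escape => //; first by lra.
  rewrite expn1; have := sS4 z1.
  have : (s z - (51 / 100) ^+ 2) ^+ 2 <=
      cmod (poly_comp_seq (fiber_seq f3 z) 1).[w] ^+ 2.
    by rewrite lerXn2r ?nnegrE ?cmod_ge0 //; lra.
  by nra.
exists 4%N.
pose S k := s (z ^+ (2 ^ k)); pose W k := (poly_comp_seq (fiber_seq f3 z) k).[w].
have SS k : S k.+1 <= 4 * S k.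
  by rewrite /S expnSr exprM; apply/sS4/circle_orbit.
have S0 : S 0%N = s z by rewrite /S expn0 expr1.
have near k : (k < 4)%N -> [/\ (4 - 1 / 100) * S k <= S k.+1,
    99 / 100 <= Re (z ^+ (2 ^ k)) & `|Im (z ^+ (2 ^ k))| <= 1 / 100].
  move=> k4; rewrite /S expnSr exprM; apply: example3_near1.
    exact: circle_orbit.
  rewrite -/(S k).
  have := SS 0%N; have := SS 1%N; have := SS 2%N; rewrite S0.
  by case: k k4 => [|[|[|[|k]]]] // _; rewrite ?S0; lra.
have WE k : W k.+1 = W k ^+ 2 + (S k)%:C * z ^+ (2 ^ k).
  by rewrite /W step example3_circle //; apply: circle_orbit.
have ReW k : Re (W k.+1) = Re (W k) ^+ 2 - Im (W k) ^+ 2 + S k * Re (z ^+ (2 ^ k)).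
  rewrite WE -Re_sqr; case: (_ ^+ 2) => p q; case: (z ^+ _) => al be /=.
  by rewrite mul0r subr0.
have ImW k : Im (W k.+1) = 2 * (Re (W k) * Im (W k)) + S k * Im (z ^+ (2 ^ k)).
  rewrite WE -Im_sqr; case: (_ ^+ 2) => p q; case: (z ^+ _) => al be /=.
  by rewrite mul0r addr0.
have [d0 al0 be0] := near 0%N isT; have [d1 al1 be1] := near 1%N isT.
have [d2 al2 be2] := near 2%N isT; have [d3 al3 be3] := near 3%N isT.
have Y1 : `|Im (W 1%N)| <= (51 / 100) ^+ 2 + S 0%N / 100.
  rewrite (ImW 0%N) -Im_sqr {1}/W poly_comp_seq0.
  apply: le_trans (ler_normD _ _) _; apply: lerD.
    exact: le_trans (cmod_geIm _) w2.
  have S00 : 0 <= S 0%N by apply: s_ge0.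
  rewrite normrM (ger0_norm S00).
  have : 0 <= S 0%N * (1 / 100 - `|Im (z ^+ (2 ^ 0))|).
    by rewrite mulr_ge0 // subr_ge0.
  by lra.
have Y2 : `|Im (W 2%N)| <= 2 / 5 * Re (W 2%N).
  rewrite (ImW 1%N) (ReW 1%N); apply: (@example3_cone _ _ (S 0%N)) => //; rewrite S0; exact: ltW.
have S2 : 0 <= S 2%N by apply: s_ge0.
have Y3 : `|Im (W 3%N)| <= Re (W 3%N).
  by rewrite (ImW 2%N) (ReW 2%N); apply: example3_diag.
have S3 : 0 <= S 3%N by apply: s_ge0.
(* Since |Im w_3| <= Re w_3, the square of w_3 has non-negative real part, and the additive term
   contributes at least 0.99 * 3.99^3 * s > 62 s. *)
have X4 : 62 * s z <= cmod (W 4%N).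
  apply: le_trans (le_trans (ler_norm _) (cmod_geRe _)); rewrite (ReW 3%N).
  have : Im (W 3%N) ^+ 2 <= Re (W 3%N) ^+ 2.
    rewrite -[Im _ ^+ 2]real_normK ?num_real // lerXn2r ?nnegrE //.
    exact: le_trans Y3.
  have : 0 <= S 3%N * (Re (z ^+ (2 ^ 3)) - 99 / 100).
    by rewrite mulr_ge0 // subr_ge0.
  by rewrite -S0; lra.
apply: example3_escape => //; rewrite -/(W 4%N); first by lra.
rewrite -/(S 4%N); have := SS 3%N; have := SS 2%N; have := SS 1%N; have := SS 0%N.
have : (62 * s z) ^+ 2 <= cmod (W 4%N) ^+ 2.
  have z0 : 0 <= 62 * s z by have := s_ge0 z; lra.
  by rewrite lerXn2r ?nnegrE ?cmod_ge0.
move: (S 4%N) (S 3%N) (S 2%N) (S 1%N) (cmod _ ^+ 2) => t4 t3 t2 t1 W4.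
rewrite S0; move: (s z) sz => t0 t0a.
have : 0 <= t0 * (t0 - 1 / 5) by rewrite mulr_ge0 //; lra.
by lra.
Qed.

(** While [s] is small it more than doubles at each step, so for z other than 1 it passes 1/4 -
    10^-4. Until the first such time the trap holds [w]; then [example3_core] takes over. *)
Lemma example3_leave z w : cmod z = 1 -> z != 1 -> cmod w <= 51 / 100 ->
  exists M, forall n,
    2 ^+ n * 3 <= cmod (poly_comp_seq (fiber_seq f3 z) (n + M)).[w].
Proof.
move=> z1 zn1 w1.
have exN : exists n, ~~ (s (z ^+ (2 ^ n)) <= (1 / 4 - 1 / (100 * 100))).
  apply: contrapT => nex.
  have small n : s (z ^+ (2 ^ n)) <= (1 / 4 - 1 / (100 * 100)).
    by apply: contrapT => h; apply: nex; exists n; apply/negP.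
  apply: (@doubling_unbounded _ (fun n => s (z ^+ (2 ^ n))) (s z)).
  - by rewrite mulr_gt0 // exprn_gt0 // cmod_gt0 subr_eq0 eq_sym.
  - elim=> [|n IH]; first by rewrite expr0 mul1r expn0 expr1.
    have [|h _ _] := example3_near1 (circle_orbit n z1); first by have := small n; lra.
    have zS : z ^+ (2 ^ n.+1) = (z ^+ (2 ^ n)) ^+ 2 by rewrite expnSr exprM.
    by rewrite zS [2 ^+ n.+1]exprS; have := s_ge0 (z ^+ (2 ^ n)); lra.
  - by exists ((1 / 4 - 1 / (100 * 100))).
case: (ex_minnP exN) => m; rewrite -ltNge => sm mmin.
have wm : cmod (poly_comp_seq (fiber_seq f3 z) m).[w] <= 51 / 100.
  apply: (@example3_trap z w m) => // n; apply: contraLR.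
  by rewrite -leqNgt; apply: mmin.
have [M HM] := example3_core (circle_orbit m z1) sm wm.
exists (M + m)%N => n; have := HM n.
have -> : fiber_seq f3 (z ^+ (2 ^ m)) = fun k => fiber_seq f3 z (k + m)%N.
  by apply/funext => k; rewrite /fiber_seq -(orbit z m) -iterD.
by rewrite poly_comp_seq_shift addnA.
Qed.

Let base1 : (base f3).[1] = 1.
Proof. by rewrite example3_base hornerXn expr1n. Qed.

Let base0 : (base f3).[0] = 0.
Proof. by rewrite example3_base hornerXn expr0n. Qed.

Let fiber1 : fiber f3 1 = 'X^2.
Proof. by rewrite fiber_quad cE subrr expr0n mulr0 addr0. Qed.

Lemma example3_bound z w : cmod z = 1 -> bounded_along (fiber_seq f3 z) w ->
  cmod w <= 12 * a.
Proof.
move=> z1 wK; rewrite leNgt; apply/negP => w6; move: wK.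
apply: (@unbounded_of_doubling _ _ _ 3 0); first by [].
have aa : 100 * a <= a ^+ 2 by rewrite expr2 ler_wpM2r ?ltW //; have := a_big; lra.
apply: example3_escape => //; rewrite poly_comp_seq0; first by have := a_big; lra.
rewrite expn0 expr1.
have : (12 * a) ^+ 2 <= cmod w ^+ 2.
  by rewrite lerXn2r ?nnegrE ?cmod_ge0 ?mulr_ge0 // ltW.
have : s z <= 4 * a.
  rewrite /s uE //; have := cmod_geRe z; rewrite z1 ler_norml => /andP[h _].
  by have := a0; nra.
by have := a_big; nra.
Qed.

Let pt0 w : (poly_comp_seq (fiber_seq f3 0) 1).[w] = w ^+ 2 - a%:C.
Proof. by rewrite step poly_comp_seq0 expn0 expr1 subr0 expr1n mulr1. Qed.

Lemma example3_escape0 w N : 3 <= cmod (poly_comp_seq (fiber_seq f3 0) N).[w] ->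
  3 * a <= cmod (poly_comp_seq (fiber_seq f3 0) N).[w] ^+ 2 ->
  ~ bounded_along (fiber_seq f3 0) w.
Proof.
move=> h1 h2; apply: (@unbounded_of_doubling _ _ _ 3 N) => //.
apply: (@quad_escape _ (fun n => (poly_comp_seq (fiber_seq f3 0) n).[w])
  (fun n => - a%:C) (fun=> a)) => //.
- move=> n; rewrite step expr0n expn_eq0 /= subr0 expr1n mulr1 //.
- by move=> _; rewrite cmodN cmodR gtr0_norm.
- by move=> _; have := a0; lra.
Qed.

Lemma example3_axiomA : axiomA f3.
Proof.
have K1 z : cmod z <= 1 -> filled_julia (base f3) z.
  by rewrite example3_base => z1; apply/filled_julia_Xn.
split.
- exact: skew_quad.
- by rewrite example3_base; apply: hyperbolic_Xn.
- rewrite example3_base; have -> : julia 'X^2 = [set z : R[i] | cmod z = 1].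
    by apply/seteqP; split=> z; rewrite (julia_Xn (isT : (1 < 2)%N)).
  apply: (@vertically_expandingI _ _ _ _ (12 * a) (102 / 100)); first by lra.
  + by move=> z /= z1; apply: K1; rewrite z1.
  + by move=> z /= z1; rewrite example3_base hornerXn cmodX z1 expr1n.
  + by move=> z w; apply: example3_bound.
  + move=> z w /= z1 wK wint; rewrite deriv_fiber_quad cmodM cmod_nat.
    suff : 51 / 100 <= cmod w by lra.
    rewrite leNgt; apply/negP => w1.
    (* Over z = 1 the fiber map is w^2 and [w] is interior; over any other z it would escape. *)
    have [zE|zn1] := eqVneq z 1; last first.
      have [M HM] := example3_leave z1 zn1 (ltW w1).
      exact: unbounded_of_doubling HM wK.
    apply: wint; apply/interiorcP; exists (1 - cmod w); first by lra.
    move=> y yw; rewrite zE -filled_julia_fixed // fiber1; apply/filled_julia_Xn => //.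
    by have := cmodD (y - w) w; rewrite subrK; lra.
- apply: (@vertically_expandingS _ _ _ _ [set 0]).
    by move=> z; rewrite example3_base => /(attracting_periodic_Xn (isT : (1 < 2)%N)).
  apply: (@vertically_expandingI _ _ _ _ (3 * a) 2); first by lra.
  + by move=> z ->; apply: K1; rewrite cmod0.
  + by move=> z ->.
  + move=> z w -> wK; rewrite leNgt; apply/negP => wa; move: wK.
    apply: (@example3_escape0 _ 0); rewrite poly_comp_seq0.
      by have := a_big; lra.
    have : (3 * a) ^+ 2 <= cmod w ^+ 2.
      by rewrite lerXn2r ?nnegrE ?cmod_ge0 ?mulr_ge0 // ltW.
    by have := a_big; nra.
  + move=> z w -> wK _; rewrite deriv_fiber_quad cmodM cmod_nat.
    suff : 1 <= cmod w by lra.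
    rewrite leNgt; apply/negP => w1; move: wK.
    have W1 : a - 1 <= cmod (poly_comp_seq (fiber_seq f3 0) 1).[w].
      rewrite pt0 cmodB; apply: le_trans (cmod_geB _ _).
      rewrite cmodR gtr0_norm // cmodN cmodX.
      by rewrite lerB // exprn_ile1 ?cmod_ge0 // ltW.
    apply: (@example3_escape0 _ 1); first by have := a_big; lra.
    have : (a - 1) ^+ 2 <= cmod (poly_comp_seq (fiber_seq f3 0) 1).[w] ^+ 2.
      by rewrite lerXn2r ?nnegrE ?cmod_ge0 //; have := a_big; lra.
    by have := a_big; nra.
Qed.

(** The square root with non-negative real part has |1 - z|^2 <= 2, so the factor in [example3_sS]
    is at least 2. *)
Lemma example3_sqrt y : cmod y = 1 -> exists z,
  [/\ cmod z = 1, z ^+ 2 = y & s z <= s y].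
Proof.
move=> y1.
have [z [z2 zr]] : exists z, z ^+ 2 = y /\ 0 <= Re z.
  have := sqr_sqrtc y; move: (sqrtc y) => z z2.
  have [h|h] := leP 0 (Re z); first by exists z.
  exists (- z); rewrite sqrrN; split=> //; move: h; case: z {z2} => al be /= h.
  by rewrite oppr_ge0 ltW.
have z1 : cmod z = 1.
  apply/eqP; rewrite -(@eqrXn2 _ 2) ?cmod_ge0 //.
  by rewrite -cmodX z2 y1 expr1n.
exists z; split=> //; rewrite -z2 example3_sS // uE //.
by have := mulr_ge0 (s_ge0 z) zr; have := s_ge0 z; lra.
Qed.

Lemma example3_start : exists y, [/\ cmod y = 1, y <> 1 & s y <= (1 / 4 - 1 / (100 * 100))].
Proof.
pose t : R := (4 * a)^-1.
have t0 : 0 < t by rewrite invr_gt0 mulr_gt0.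
have q0 : 0 < 1 + t ^+ 2 by rewrite ltr_pwDl ?sqr_ge0.
(* The rational parametrization of the circle; with a t = 1/4 it gives s(y) = t / (1 + t^2). *)
pose y : R[i] := ((1 - t ^+ 2) / (1 + t ^+ 2)) +i* (2 * t / (1 + t ^+ 2)).
have y1 : cmod y = 1.
  apply/eqP; rewrite -(@eqrXn2 _ 2) ?cmod_ge0 // cmod_sqr /= expr1n; apply/eqP.
  by field; rewrite gt_eqF.
exists y; split=> //.
  move=> [_ /eqP]; rewrite mulf_eq0 invr_eq0 (gt_eqF q0) orbF.
  by rewrite mulf_eq0 pnatr_eq0 /= gt_eqF.
have at1 : a * t = 1 / 4 by rewrite /t; field; rewrite gt_eqF.
rewrite /s uE //=.
have -> : a * (2 - 2 * ((1 - t ^+ 2) / (1 + t ^+ 2))) =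
    4 * (a * t) * t / (1 + t ^+ 2) by field; rewrite gt_eqF.
rewrite at1 ler_pdivrMr //.
have ta : t <= 1 / 10.
  by have := a_big; nra.
by have := sqr_ge0 t; lra.
Qed.

Lemma example3_exists : exists f : coefs R 2,
  [/\ axiomA f, axiomA_P2 f, mixed f & A_pt f <> A_cc f /\ A_cc f = A_crit f].
Proof.
exists f3; split.
- exact: example3_axiomA.
- apply: (axiomA_P2I example3_axiomA base0).
  by rewrite infinity_quad fiber_quad cE subr0 expr1n mulr1.
- exists 1, 0; split=> //.
    move=> w; rewrite deriv_fiber_quad => /eqP.
    rewrite mulf_eq0 pnatr_eq0 /= => /eqP ->.
    by rewrite fiber1; apply/filled_julia_Xn => //; rewrite cmod0.
  move=> /(_ 0); rewrite deriv_fiber_quad mulr0 => /(_ erefl).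
  rewrite filled_julia_fixed //; apply: (@example3_escape0 _ 1);
    rewrite pt0 expr0n sub0r cmodN cmodR gtr0_norm //; have := a_big; first by lra.
  by nra.
have C3 : critical_locus f3 = [set x : R[i] * R[i] | cmod x.1 = 1 /\ x.2 = 0].
  apply/seteqP; split=> -[z w]; rewrite critical_quad example3_base julia_Xn //.
have ccE : A_cc f3 = A_crit f3.
  apply/seteqP; split; first exact: A_cc_sub.
  have C1 : critical_locus f3 (1, 0) by rewrite C3 /= cmod1.
  move=> y yA; apply: subset_closure; exists (1, 0) => //.
  rewrite connected_component_id // C3; exact: circle_connected.
split=> //.
have pt1 : A_pt f3 `<=` [set (1, 0)].
  apply: closure_point => y [[z w]]; rewrite C3 /= => -[z1 ->].
  have [->|zn1] := eqVneq z 1.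
    apply: accumulation_fixed.
    by rewrite skew_map_quad cE subrr !expr0n /= mulr0 mul0r addr0 expr1n addr0.
  have w0 : cmod (0 : R[i]) <= 51 / 100 by rewrite cmod0; lra.
  have [M HM] := example3_leave z1 zn1 w0.
  rewrite (@accumulation_set0 _ _ _ _ 3 M) // => _ n ->.
  by rewrite iter_skew_map2.
rewrite ccE => ptE; have [y [y1 yn1 sy]] := example3_start.
(* A backward orbit of [y] along which [s] stays small. The critical orbits started on it are
   trapped until they reach the fiber over [y], after any prescribed number n of steps, and their
   endpoints cluster there. *)
have back n : exists z, [/\ cmod z = 1, z ^+ (2 ^ n) = y &
    forall k, (k <= n)%N -> s (z ^+ (2 ^ k)) <= (1 / 4 - 1 / (100 * 100))].
  elim: n => [|n [z [z1 zy zD]]].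
    by exists y; split=> // -[|k] // _; rewrite expn0 expr1.
  have [z' [z1' z2' sz']] := example3_sqrt z1.
  exists z'; split=> //; first by rewrite expnS exprM z2'.
  case=> [_|k kn]; last by rewrite expnS exprM z2'; apply: zD.
  rewrite expn0 expr1; apply: le_trans sz' _.
  by have := zD 0%N isT; rewrite expn0 expr1.
have [w] : exists w, A_crit f3 (y, w).
  apply: (@accumulation_cluster _ _ _ _ _ (51 / 100)) => n.
  have [z [z1 zy zD]] := back n; exists (z, 0); first by rewrite C3.
  rewrite iter_skew_map iter_skew_map2 orbit; split=> //.
  apply: (@example3_trap z 0 n) => //; last by rewrite cmod0; lra.
  by move=> k /ltnW; apply: zD.
by rewrite -ptE => /pt1 [] /yn1.
Qed.

End Example3.

Lemma example3 (R : realType) : exists f : coefs R 2,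
  [/\ axiomA f, axiomA_P2 f, mixed f & A_pt f <> A_cc f /\ A_cc f = A_crit f].
Proof. exact: (@example3_exists _ (10 ^+ 7)). Qed.

(** * The fourth example *)

Section Example4.
Variable R : realType.
Implicit Types (x y z w : R[i]).

(** The number 100 splits K_p into pieces within 5/4 of 0 and of -100. The factor 1/8 makes the
    additive term at most 5/32 on the first piece, below r - r^2 = 3/16 for the trap radius r = 3/4,
    and more than 12 on the second, enough for escape. *)
Let f4 : coefs R 2 := quad 100 0 8^-1 0.
Let p : {poly R[i]} := base f4.

Let pE z : p.[z] = z * (z + 100).
Proof. by rewrite /p horner_base_quad; ring. Qed.

Let cE z : (0 + 8^-1 * z + 0 * z ^+ 2 : R[i]) = 8^-1 * z.
Proof. by ring. Qed.

Let cmodc z : cmod (8^-1 * z) = cmod z / 8.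
Proof. by rewrite cmodM cmodV cmod_nat mulrC. Qed.

Let far_apart z : 100 <= cmod z + cmod (z + 100).
Proof.
have := cmodD (- z) (z + 100).
by rewrite cmodN addKr (cmod_nat R 100).
Qed.


(** From |z| >= 102 on, |z + 100| >= 2 and the orbit doubles. Hence |z| |z + 100| = |p(z)| < 102 on
    K_p; as the two factors add up to at least 100, one of them is at most 5/4. *)
Lemma example4_K z : filled_julia p z ->
  cmod z < 102 /\ (cmod z <= 5 / 4 \/ cmod (z + 100) <= 5 / 4).
Proof.
have bd y : filled_julia p y -> cmod y < 102.
  move=> /filled_juliaP yK; rewrite ltNge; apply/negP => y102.
  pose u n := cmod (iter n (horner p) y).
  have uS n : 102 <= u n -> 2 * u n <= u n.+1.
    rewrite /u iterS; move: (iter n _ y) => x x102; rewrite pE cmodM.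
    have := cmodD (x + 100) (- 100); rewrite addrK cmodN (cmod_nat R 100).
    by nra.
  have M0 : (0 : R) <= 102 by [].
  have ud := doubling_ge M0 y102 uS.
  apply: (@doubling_unbounded _ u (u 0%N)) yK.
    by rewrite (lt_le_trans _ y102).
  by move=> n; have [] := ud n.
move=> zK; split; first exact: bd.
have := bd _ ((filled_juliaS p z).1 zK); rewrite pE cmodM => zz.
have [z1|z1] := leP (cmod z) (5 / 4); first by left.
have [z2|z2] := leP (cmod (z + 100)) (5 / 4); first by right.
by have := far_apart z; nra.
Qed.

(** p(z) - p(y) = (z - y)(z + y + 100), and for two points of the same piece the second factor is
    within 5/2 of 100 or of -100. *)
Lemma example4_step_far z y : filled_julia p z -> filled_julia p y ->
  (cmod z <= 5 / 4) = (cmod y <= 5 / 4) ->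
  97 * cmod (z - y) <= cmod (p.[z] - p.[y]).
Proof.
move=> /example4_K[_ zD] /example4_K[_ yD] zy.
have -> : p.[z] - p.[y] = (z - y) * (z + y + 100) by rewrite !pE; ring.
rewrite cmodM mulrC ler_wpM2l ?cmod_ge0 //.
have [z1|z1] := boolP (cmod z <= 5 / 4).
  have y1 : cmod y <= 5 / 4 by rewrite -zy.
  have := cmodD (z + y + 100) (- (z + y)).
  have := cmodD z y; rewrite addrAC subrr add0r cmodN (cmod_nat R 100).
  by lra.
have [z2|z2] := zD; first by rewrite z2 in z1.
have [y2|y2] := yD; first by rewrite zy y2 in z1.
have := cmodD ((z + 100) + (y + 100)) (- (z + y + 100)).
have := cmodD (z + 100) (y + 100).
have -> : z + 100 + (y + 100) - (z + y + 100) = 100 by ring.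
by rewrite cmodN (cmod_nat R 100); lra.
Qed.

Let sp2 : (2 < size p)%N.
Proof. by rewrite /p (size_base (skew_quad 100 0 8^-1 0)). Qed.

Let iterK z n : filled_julia p z -> filled_julia p (iter n (horner p) z).
Proof. by move/(filled_julia_iter p n z).1. Qed.

Lemma example4_deriv z n : filled_julia p z ->
  97 ^+ n <= cmod (poly_iter p n)^`().[z].
Proof.
move=> zK; elim: n => [|n IH]; first by rewrite expr0 derivX hornerC cmod1.
rewrite -[poly_iter p n.+1]/(p \Po poly_iter p n) deriv_comp hornerM cmodM exprS.
apply: ler_pM => //.
rewrite horner_comp poly_iterE; have := iterK n zK.
move: (iter n _ z) => y yK; rewrite /p base_quad.
rewrite derivD derivXn derivZ derivX expr1 hornerD hornerMn hornerX hornerZ hornerC.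
rewrite mulr1; have [_ [yD|yD]] := example4_K yK.
- have := cmod_geB 100 (y *+ 2); rewrite [100 + _]addrC (cmod_nat R 100).
  by rewrite -[y *+ 2]mulr_natl cmodM cmod_nat; lra.
- have := cmod_geB (- 100) ((y + 100) *+ 2); rewrite cmodN (cmod_nat R 100).
  have -> : - 100 + (y + 100) *+ 2 = y *+ 2 + 100 by ring.
  by rewrite -[(y + 100) *+ 2]mulr_natl cmodM cmod_nat; lra.
Qed.

Let step z w n : (poly_comp_seq (fiber_seq f4 z) n.+1).[w] =
  (poly_comp_seq (fiber_seq f4 z) n).[w] ^+ 2 + 8^-1 * iter n (horner p) z.
Proof. by rewrite fiber_seq_quad cE. Qed.

(** On K_p the additive term is at most 102/8 < 13, and 3 * 13 <= 7^2. *)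
Lemma example4_escape z w N : filled_julia p z ->
  7 <= cmod (poly_comp_seq (fiber_seq f4 z) N).[w] ->
  forall n, 2 ^+ n * 3 <= cmod (poly_comp_seq (fiber_seq f4 z) (n + N)).[w].
Proof.
move=> zK w7.
apply: (@quad_escape _ (fun n => (poly_comp_seq (fiber_seq f4 z) n).[w])
  (fun n => 8^-1 * iter n (horner p) z) (fun=> 13)).
- by move=> n; rewrite step.
- by move=> n; rewrite cmodc; have [] := example4_K (iterK n zK); lra.
- by move=> _; lra.
- by lra.
- by nra.
Qed.

Lemma example4_bound z w : filled_julia p z ->
  bounded_along (fiber_seq f4 z) w -> cmod w <= 7.
Proof.
move=> zK wK; rewrite leNgt; apply/negP => w7; move: wK.
apply: (@unbounded_of_doubling _ _ _ 3 0); first by [].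
by apply: example4_escape => //; rewrite poly_comp_seq0 ltW.
Qed.

Lemma example4_trap z w N : (forall n, (n < N)%N ->
    cmod (iter n (horner p) z) <= 5 / 4) -> cmod w <= 3 / 4 ->
  forall n, (n <= N)%N -> cmod (poly_comp_seq (fiber_seq f4 z) n).[w] <= 3 / 4.
Proof.
move=> zD w1.
apply: (@quad_trap _ _ (fun n => 8^-1 * iter n (horner p) z)).
- by move=> n; rewrite step.
- by move=> n /zD; rewrite cmodc; lra.
- by rewrite poly_comp_seq0.
Qed.

(** At the first time outside the piece of 0 the base point is near -100, so the additive term
    exceeds 12, while the trap has kept |w| <= 3/4 until then. *)
Lemma example4_leave z w N : filled_julia p z -> cmod w <= 3 / 4 ->
  ~ cmod (iter N (horner p) z) <= 5 / 4 ->
  exists M, forall n,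
    2 ^+ n * 3 <= cmod (poly_comp_seq (fiber_seq f4 z) (n + M)).[w].
Proof.
move=> zK w1 zN.
have exN : exists n, ~~ (cmod (iter n (horner p) z) <= 5 / 4).
  by exists N; apply/negP.
case: (ex_minnP exN) => m zm mmin; exists m.+1.
apply: example4_escape => //; rewrite step.
have wm : cmod (poly_comp_seq (fiber_seq f4 z) m).[w] <= 3 / 4.
  apply: (@example4_trap z w m) => // n; apply: contraLR.
  by rewrite -leqNgt; apply: mmin.
have [_ [zD|zD]] := example4_K (iterK m zK); first by rewrite zD in zm.
have := cmod_geB (8^-1 * iter m (horner p) z)
  ((poly_comp_seq (fiber_seq f4 z) m).[w] ^+ 2).
rewrite [8^-1 * _ + _]addrC cmodc cmodX.
have := far_apart (iter m (horner p) z).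
have : cmod (poly_comp_seq (fiber_seq f4 z) m).[w] ^+ 2 <= (3 / 4) ^+ 2.
  by rewrite lerXn2r ?nnegrE ?cmod_ge0 //; lra.
by lra.
Qed.

Lemma example4_axiomA : axiomA f4.
Proof.
split.
- exact: skew_quad.
- exists 1, 97; split=> //; first by lra.
  move=> z n zJ _; rewrite mul1r normcE lecR.
  by apply: example4_deriv; apply: julia_sub.
- apply: (@vertically_expandingS _ _ _ _ (filled_julia p)).
    by move=> z; apply: julia_sub.
  apply: (@vertically_expandingI _ _ _ _ 7 (3 / 2)) => //; first by lra.
  + by move=> z /(filled_juliaS p z).1.
  + exact: example4_bound.
  + move=> z w /= zK wK wint; rewrite deriv_fiber_quad cmodM cmod_nat.
    suff : 3 / 4 <= cmod w by lra.
    rewrite leNgt; apply/negP => w1.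
    (* If the base orbit stays in the piece of 0, the disc of radius 3/4 is trapped forever and [w]
       is interior; otherwise [w] escapes. *)
    have [zD|] := pselect (forall n, cmod (iter n (horner p) z) <= 5 / 4).
      apply: wint; apply/interiorcP; exists (3 / 4 - cmod w); first by lra.
      move=> y yw; exists (3 / 4) => n.
      apply: (@example4_trap z y n) => //.
      by have := cmodD (y - w) w; rewrite subrK; lra.
    move=> /existsNP[N zN].
    have [M HM] := example4_leave zK (ltW w1) zN.
    exact: unbounded_of_doubling HM wK.
(* Periodic points have bounded orbits, along which derivatives grow by 97 per step, so every cycle
   is repelling. *)
- have -> : attracting_periodic (base f4) = set0; last exact: vertically_expanding_set0.
  apply/seteqP; split=> // z [n [n0 zn]].
  rewrite normcE -[1]/(1%:C) ltcR ltNge => /negP; apply.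
  have zK : filled_julia p z.
    apply: (@bounded_of_iter_mul _ _ n _ (cmod z)) => // m.
    suff -> : iter (n * m) (horner p) z = z by [].
    by elim: m => [|m IH]; rewrite ?muln0 // mulnS iterD IH.
  apply: le_trans (example4_deriv n zK).
  by rewrite exprn_ege1 //; lra.
Qed.

(** Positive real numbers escape under r (r + 100), however small they are. *)
Lemma example4_julia0 : julia p 0.
Proof.
have K0 : filled_julia p 0.
  apply/filled_juliaP; exists 0 => n.
  by rewrite iter_fixed ?cmod0 // pE mul0r.
apply/boundarycP => e e0; split; first by exists 0 => //; rewrite subrr cmod0.
have e20 : 0 < e / 2 by rewrite divr_gt0.
exists (e / 2)%:C; last by rewrite subr0 cmodR gtr0_norm //; lra.
move=> /filled_juliaP; apply: (@doubling_unbounded _ _ (e / 2)) => // n.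
suff [r er ->] : exists2 r : R, 2 ^+ n * (e / 2) <= r &
    iter n (horner p) (e / 2)%:C = r%:C.
  by rewrite cmodR (le_trans er) // ler_norm.
elim: n => [|n [r er IH]]; first by exists (e / 2); rewrite // expr0 mul1r.
exists (r * (r + 100)); last first.
  by rewrite iterS IH pE rmorphM rmorphD /= (rmorph_nat (real_complex R) 100).
have r0 : 0 <= r.
  by apply: le_trans er; rewrite mulr_ge0 ?exprn_ge0 // ltW.
by rewrite exprS; nra.
Qed.

(** The symmetry z -> -100 - z of p exchanges the two pieces, so of the two preimages y and -(y +
    100) one is near 0. *)
Lemma example4_preim x : julia p x ->
  exists y, [/\ julia p y, cmod y <= 5 / 4 & p.[y] = x].
Proof.
move=> xJ.
have /closed_rootP[y] : size (p - x%:P) != 1%N.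
  rewrite size_polyDl; first by rewrite neq_ltn; apply/orP; right; apply: ltn_trans sp2.
  by rewrite size_polyN (leq_ltn_trans (size_polyC_leq1 _)) // (ltn_trans _ sp2).
rewrite rootE hornerD hornerN hornerC subr_eq0 => /eqP py.
have yJ y' : p.[y'] = x -> julia p y' by move=> py'; apply: julia_preim; rewrite ?py'.
have [_ [yD|yD]] := example4_K (julia_sub sp2 (yJ y py)).
  by exists y; split; [exact: yJ|exact: yD|exact: py].
have py' : p.[- (y + 100)] = x by rewrite -py !pE; ring.
by exists (- (y + 100)); split; [exact: yJ|rewrite cmodN|exact: py'].
Qed.

(** Distinct points of J_p lie in different pieces at some time n, since otherwise their distance
    would grow by 97 at each step. As |p^n| is at most 5/4 or more than 98 over J_p, the condition
    |p^n| < 2 is clopen on the critical locus and separates them. *)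
Lemma example4_component (x : R[i] * R[i]) : critical_locus f4 x ->
  connected_component (critical_locus f4) x = [set x].
Proof.
move=> xC; apply/seteqP; split=> [y xy|_ ->]; last exact: connected_component_refl.
have yC := connected_component_sub xy.
case: x xC xy => z w xC xy; case: y yC xy => z' w' yC xy.
move: (xC) (yC); rewrite !critical_quad => -[zJ w0] [zJ' w0'].
rewrite w0 w0' in xC xy yC *; congr pair; apply: contrapT => zz'.
have [n zn] : exists n, (cmod (iter n (horner p) z) <= 5 / 4) !=
    (cmod (iter n (horner p) z') <= 5 / 4).
  apply: contrapT => nex.
  have same n : (cmod (iter n (horner p) z) <= 5 / 4) =
      (cmod (iter n (horner p) z') <= 5 / 4).
    by apply/eqP/negPn/negP => h; apply: nex; exists n.
  have zK := julia_sub sp2 zJ; have zK' := julia_sub sp2 zJ'.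
  apply: (@doubling_unbounded _
    (fun n => cmod (iter n (horner p) z - iter n (horner p) z')) (cmod (z - z'))).
  - by rewrite cmod_gt0 subr_eq0; apply/eqP => /esym.
  - elim=> [|n IH]; first by rewrite expr0 mul1r.
    have := example4_step_far (iterK n zK) (iterK n zK') (same n).
    have := cmod_ge0 (iter n (horner p) z - iter n (horner p) z').
    by rewrite !iterS exprS; lra.
  - exists (102 + 102) => n.
    have [h1 _] := example4_K (iterK n zK); have [h2 _] := example4_K (iterK n zK').
    by have := cmodD (iter n (horner p) z) (- iter n (horner p) z'); rewrite cmodN; lra.
pose S := connected_component (critical_locus f4) (z, 0).
pose P := poly_iter p n.
have SD (y : R[i] * R[i]) : S y -> cmod P.[y.1] <= 5 / 4 \/ 98 < cmod P.[y.1].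
  move=> /connected_component_sub; case: y => y v; rewrite critical_quad => -[yJ _].
  have yK := iterK n (julia_sub sp2 yJ).
  rewrite /P poly_iterE; have [_ [|h]] := example4_K yK; [by left|right].
  by have := far_apart (iter n (horner p) y); lra.
have cont (y : R[i] * R[i]) (e : R) : 0 < e -> exists2 r : R, 0 < r &
    forall v : R[i] * R[i], cmod (v.1 - y.1) < r -> cmod (v.2 - y.2) < r ->
      cmod (P.[v.1] - P.[y.1]) < e.
  move=> e0; have [r r0 Hr] := horner_continuous P y.1 e0.
  by exists r => // v /Hr.
have Sconn : connected S by apply: component_connected.
have openlt : open [set y : R[i] * R[i] | cmod P.[y.1] < 2].
  rewrite openE => y /= y2; apply/nbhsc2P; rewrite -subr_gt0 in y2.
  have [r r0 Hr] := cont y _ y2; exists r => // v /Hr h /h.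
  by have := cmodD (P.[v.1] - P.[y.1]) P.[y.1]; rewrite /= subrK; lra.
have opengt : open [set y : R[i] * R[i] | 2 < cmod P.[y.1]].
  rewrite openE => y /= y2; apply/nbhsc2P; rewrite -subr_gt0 in y2.
  have [r r0 Hr] := cont y _ y2; exists r => // v /Hr h /h.
  have := cmodD (P.[y.1] - P.[v.1]) P.[v.1].
  by rewrite (cmodB P.[y.1]) /= subrK; lra.
have Sz : S (z, 0) by apply: connected_component_refl.
have clop (y : R[i] * R[i]) : S y -> cmod P.[y.1] < 2 ->
    S `&` [set y : R[i] * R[i] | cmod P.[y.1] < 2] = S.
  move=> Sy y2; apply: Sconn; first by exists y.
    by exists [set y : R[i] * R[i] | cmod P.[y.1] < 2].
  exists (~` [set y : R[i] * R[i] | 2 < cmod P.[y.1]]); first exact: open_closedC.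
  apply/seteqP; split=> v [Sv] /=; split=> //.
    by apply/negP; rewrite -leNgt ltW.
  by have [|] := SD v Sv; lra.
have same (y y' : R[i] * R[i]) : S y -> S y' -> cmod P.[y.1] <= 5 / 4 -> cmod P.[y'.1] <= 5 / 4.
  move=> Sy Sy' y1; have y2 : cmod P.[y.1] < 2 by lra.
  have : (S `&` [set y : R[i] * R[i] | cmod P.[y.1] < 2]) y' by rewrite (clop y).
  by move=> [_ /=]; have [|] := SD y' Sy'; lra.
move/eqP: zn; apply; rewrite -!poly_iterE -/P.
by apply/idP/idP; [apply: (same (z, 0) (z', 0))|apply: (same (z', 0) (z, 0))].
Qed.

Lemma example4 : exists f : coefs R 2,
  [/\ axiomA f, axiomA_P2 f, mixed f & A_pt f = A_cc f /\ A_cc f <> A_crit f].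
Proof.
have base0 : p.[0] = 0 by rewrite pE mul0r.
have base1 : p.[- 99] = - 99 by rewrite pE; ring.
exists f4; split.
- exact: example4_axiomA.
- apply: (axiomA_P2I example4_axiomA base0).
  by rewrite infinity_quad fiber_quad cE mulr0.
- exists 0, (- 99); split=> //.
    move=> w; rewrite deriv_fiber_quad => /eqP.
    rewrite mulf_eq0 pnatr_eq0 /= => /eqP ->.
    rewrite fiber_quad cE mulr0 addr0; apply/filled_julia_Xn => //.
    by rewrite cmod0.
  move=> /(_ 0); rewrite deriv_fiber_quad mulr0 => /(_ erefl).
  rewrite filled_julia_fixed //; apply: (@unbounded_of_doubling _ _ _ 3 1) => //.
  apply: example4_escape.
    by apply/filled_juliaP; exists 99 => n; rewrite iter_fixed // cmodN (cmod_nat R 99).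
  by rewrite step poly_comp_seq0 expr0n add0r cmodc cmodN (cmod_nat R 99); lra.
have ccE : A_cc f4 = A_pt f4.
  congr closure; apply/seteqP; split=> y [x xC]; rewrite ?example4_component // => yx;
    by exists x => //; rewrite ?example4_component.
have pt0 : A_pt f4 `<=` [set (0, 0)].
  apply: closure_point => y [[z w]]; rewrite critical_quad => -[zJ ->].
  have zK := julia_sub sp2 zJ.
  have [->|z0] := eqVneq z 0.
    apply: accumulation_fixed.
    by rewrite skew_map_quad cE !mulr0 expr0n /= addr0.
  (* The point 0 is fixed, and an orbit staying in its piece would recede from it by the factor 97
     at each step. *)
  have [N zN] : exists N, ~ cmod (iter N (horner p) z) <= 5 / 4.
    apply/existsNP => zD; have K0 := julia_sub sp2 example4_julia0.
    apply: (@doubling_unbounded _ (fun n => cmod (iter n (horner p) z)) (cmod z)).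
    + by rewrite cmod_gt0.
    + elim=> [|n IH]; first by rewrite expr0 mul1r.
      have := @example4_step_far _ 0 (iterK n zK) K0.
      rewrite zD cmod0 base0 !subr0 iterS exprS => /(_ _).
      have -> : ((0 : R) <= 5 / 4) = true by apply/idP; lra.
      move=> /(_ erefl).
      by have := cmod_ge0 (iter n (horner p) z); lra.
    + by exists (5 / 4).
  have w0 : cmod (0 : R[i]) <= 3 / 4 by rewrite cmod0; lra.
  have [M HM] := example4_leave zK w0 zN.
  rewrite (@accumulation_set0 _ _ _ _ 3 M) // => _ n ->.
  by rewrite iter_skew_map2.
split; first by rewrite ccE.
rewrite ccE => ptE.
(* The path y -> -100 -> 0 puts [y] in J_p; it lies in the piece of 0 without being the fixed
   point. *)
have [y [yJ yD py]] : exists y, [/\ julia p y, cmod y <= 5 / 4 & p.[y] = - 100].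
  apply: example4_preim; apply: julia_preim => //.
  by rewrite pE addNr mulr0; apply: example4_julia0.
have y0 : y <> 0.
  move=> y0; move: py; rewrite y0 base0 => /esym/eqP.
  by rewrite oppr_eq0 pnatr_eq0.
(* Preimages are always taken in the piece of 0, so the trap works along the whole backward
   orbit. *)
have back n : exists z, [/\ julia p z, iter n (horner p) z = y &
    forall k, (k <= n)%N -> cmod (iter k (horner p) z) <= 5 / 4].
  elim: n => [|n [z [zJ zy zD]]].
    by exists y; split=> // k; rewrite leqn0 => /eqP ->.
  have [z' [zJ' zD' pz']] := example4_preim zJ.
  exists z'; split=> //; first by rewrite iterSr pz'.
  by case=> // k kn; rewrite iterSr pz'; apply: zD.
have [w] : exists w, A_crit f4 (y, w).
  apply: (@accumulation_cluster _ _ _ _ _ (3 / 4)) => n.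
  have [z [zJ zy zD]] := back n; exists (z, 0); first exact/critical_quad.
  rewrite iter_skew_map iter_skew_map2; split=> //.
  apply: (@example4_trap z 0 n) => //; last by rewrite cmod0; lra.
  by move=> k /ltnW; apply: zD.
by rewrite -ptE => /pt0 [] /y0.
Qed.

End Example4.

Theorem theorem1p3 (R : realType) :
  exists (d1 d2 d3 d4 : nat)
         (f1 : coefs R d1) (f2 : coefs R d2) (f3 : coefs R d3) (f4 : coefs R d4),
    [/\ [/\ axiomA f1, axiomA f2, axiomA f3 & axiomA f4],
        [/\ ~ in_component_of_product f1, ~ in_component_of_product f2,
            ~ in_component_of_product f3 & ~ in_component_of_product f4],
        [/\ [/\ A_pt f1 = A_cc f1, A_cc f1 = A_crit f1 & A_crit f1 = set0],
            [/\ A_pt f2 = A_cc f2, A_cc f2 = A_crit f2 & A_crit f2 <> set0],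
            A_pt f3 <> A_cc f3 /\ A_cc f3 = A_crit f3
          & A_pt f4 = A_cc f4 /\ A_cc f4 <> A_crit f4]
      & [/\ axiomA_P2 f1, axiomA_P2 f2, axiomA_P2 f3 & axiomA_P2 f4]].
Proof.
have [f1 [A1 B1 M1 C1]] := example1 R; have [f2 [A2 B2 M2 C2]] := example2 R.
have [f3 [A3 B3 M3 C3]] := example3 R; have [f4 [A4 B4 M4 C4]] := example4 R.
exists 2%N, 3%N, 2%N, 2%N, f1, f2, f3, f4; split=> //.
  by split; apply: mixed_not_in_component.
split=> //.
have cc0 : A_cc f1 = set0.
  by apply/seteqP; split=> // x /A_cc_sub; rewrite C1.
have pt0 : A_pt f1 = set0.
  by apply/seteqP; split=> // x /A_pt_sub; rewrite cc0.
by rewrite pt0 cc0 C1.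
Qed.
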